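(* For every threshold $\tau>0$, the SINR coverage probability $\mathrm{p_c}(\tau)=\mathbb{P}[\mathsf{SINR}>\tau]$ of the typical user in the 1D network is $$\mathrm{p_c}(\tau)=2\lambda\int_0^\infty\int_x^\infty\int_0^\infty e^{-\tau\sigma_n^2/\ell_{\mathsf L}(x)}\,\kappa_{\mathsf L}(\tau,x,q',q)\,\mu^2e^{-\mu q'-\mu q}\,g_{\mathsf L}(x\mid q,q')\,dq'\,dq\,dx$$ $$\qquad+2\lambda\int_0^\infty\int_0^x\int_0^\infty e^{-\tau\sigma_n^2/\ell_{\mathsf N}(x)}\,\kappa_{\mathsf N}(\tau,x,q',q)\,\mu^2e^{-\mu q'-\mu q}\,g_{\mathsf N}(x\mid q,q')\,dq'\,dq\,dx,$$ where $$g_{\mathsf L}(x\mid q,q')=\begin{cases}\mathbf 1(x<q)\,e^{-\lambda x}e^{-\lambda e_{\mathsf N|\mathsf L}(x)}, & q'\le e_{\mathsf N|\mathsf L}(x),\\ \mathbf 1(x<q)\,e^{-\lambda x}e^{-\lambda q'}, & e_{\mathsf N|\mathsf L}(x)\le q'<x,\\ \mathbf 1(x<q)\,e^{-2\lambda x}, & x\le q',\end{cases}$$ $$g_{\mathsf N}(x\mid q,q')=\begin{cases}\mathbf 1(x\ge q)\,e^{-2\lambda x}, & q'<x,\\ \mathbf 1(x\ge q)\,e^{-\lambda x}e^{-\lambda q'}, & x<q'<e_{\mathsf L|\mathsf N}(x),\\ \mathbf 1(x\ge q)\,e^{-\lambda x}e^{-\lambda e_{\mathsf L|\mathsf N}(x)},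 & q'>e_{\mathsf L|\mathsf N}(x),\end{cases}$$ $$\kappa_{\mathsf L}(\tau,x,q',q)=\exp\Big(-\lambda\Big(\int_q^\infty\frac{dy}{1+\tau^{-1}\frac{\ell_{\mathsf L}(x)}{\ell_{\mathsf N}(y)}}+\int_{e_{\mathsf N|\mathsf L}(x)}^\infty\frac{\mathbf 1(y>q')\,dy}{1+\tau^{-1}\frac{\ell_{\mathsf L}(x)}{\ell_{\mathsf N}(y)}}+\int_x^q\frac{dy}{1+\tau^{-1}\frac{\ell_{\mathsf L}(x)}{\ell_{\mathsf L}(y)}}+\int_x^\infty\frac{\mathbf 1(y<q')\,dy}{1+\tau^{-1}\frac{\ell_{\mathsf L}(x)}{\ell_{\mathsf L}(y)}}\Big)\Big),$$ $$\kappa_{\mathsf N}(\tau,x,q',q)=\exp\Big(-\lambda\Big(\int_x^\infty\frac{dy}{1+\tau^{-1}\frac{\ell_{\mathsf N}(x)}{\ell_{\mathsf N}(y)}}+\int_x^\infty\frac{\mathbf 1(y>q')\,dy}{1+\tau^{-1}\frac{\ell_{\mathsf N}(x)}{\ell_{\mathsf N}(y)}}+\int_{e_{\mathsf L|\mathsf N}(x)}^\infty\frac{\mathbf 1(y<q')\,dy}{1+\tau^{-1}\frac{\ell_{\mathsf N}(x)}{\ell_{\mathsf L}(y)}}\Big)\Big).$$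
   Context: 1D network. Base stations (BSs) form a homogeneous Poisson point process (PPP) $\Phi=\{X_i\}$ of density $\lambda>0$ on $\mathbb R$; the typical user is at the origin. Blockages are points of an independent homogeneous PPP of density $\mu>0$ on $\mathbb R$. Let $q$ (resp. $q'$) be the distance from the origin to the nearest blockage in $(0,\infty)$ (resp. $(-\infty,0)$); these are independent with density $\mu e^{-\mu t}$, $t\ge0$. A BS at $y$ is LoS (type $\mathsf L$) if no blockage lies between $0$ and $y$ (i.e. $0<y<q$, or $y<0$ and $|y|<q'$), and NLoS (type $\mathsf N$) otherwise. Path loss: $\ell_{\mathsf L},\ell_{\mathsf N}:[0,\infty)\to[0,\infty)$ are bounded and nonincreasing with $\ell_{\mathsf L}\ge\ell_{\mathsf N}$. A BS of type $s$ at distance $x$ gives average received power $\ell_s(x)$ and received power $H\ell_s(x)$, with fading variables $H$ i.i.d. exponential of mean $1$, independent of everything else. Exclusion radii: $e_{\mathsf L|\mathsf L}(x)=e_{\mathsf N|\mathsf N}(x)=x$, $e_{\mathsf N|\mathsf L}(x)=\min\{y\ge0:\ell_{\mathsf N}(y)\le\ell_{\mathsf L}(x)\}$, $e_{\mathsf L|\mathsf N}(x)=\min\{y\ge 0:\ell_{\mathsf L}(y)\le\ell_{\mathsf N}(x)\}$ (min read as infimum, $\infty$ if the set is empty), with $e_{\mathsf N|\mathsf L}(x)<x<e_{\mathsf L|\mathsf N}(x)$ for $x>0$. The user is served by the BS with maximum average received power: a BS of type $s$ at distance $x$ is serving iff every other BS of type $v$ is at distance greater than $e_{v|s}(x)$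 from the origin, for $v\in\{\mathsf L,\mathsf N\}$. The serving BS is assumed almost surely unique. If the serving BS has distance $X_0$, type $s_0$ and fading $H_0$, then $\mathsf{SINR}=H_0\ell_{s_0}(X_0)/(\sigma_n^2+I)$, where $\sigma_n^2>0$ is the noise power and $I$ is the sum of received powers $H_i\ell_{s_i}(|X_i|)$ over all other BSs. Conventions: a fraction $1/(1+\tau^{-1}a/b)$ is $0$ when $b=0$, and an integrand containing $e^{-\tau\sigma_n^2/\ell_s(x)}$ is $0$ when $\ell_s(x)=0$. *)

(* Defs.v *)
From HB Require Import structures.
From mathcomp Require Export all_boot all_order all_algebra.
From mathcomp Require Export all_classical all_reals all_analysis.
Export Order.TTheory GRing.Theory Num.Theory.
Export numFieldNormedType.Exports.

Set Implicit Arguments.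
Unset Strict Implicit.
Unset Printing Implicit Defensive.

Local Open Scope classical_set_scope.
Local Open Scope ring_scope.
Local Open Scope ereal_scope.

(* A point process on the line with infinitely many points is given by a
   measurable enumeration Z_0, Z_1, ... of its points (with multiplicity). *)
Definition point_count (R : realType) d (T : measurableType d)
    (P : probability T R) (Z : nat -> {RV P >-> R}) (A : set R) (w : T) : \bar R :=
  \sum_(0 <= i <oo) (\1_A (Z i w))%:E.

(* Homogeneous PPP: the counts of finitely many pairwise disjoint Borel sets
   A_j of finite length are independent, Poisson of mean rho * |A_j|.  The
   Poisson weights are written out because [poisson_pmf 0 k] is 1 for every k,
   hence not the Dirac mass at 0 that null sets require. *)
Definition homogeneous_PPP (R : realType) d (T : measurableType d)
    (P : probability T R) (rho : R) (Z : nat -> {RV P >-> R}) : Prop :=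
  forall (n : nat) (A : 'I_n -> set R) (k : 'I_n -> nat),
    (forall j, measurable (A j)) ->
    (forall j, lebesgue_measure (A j) < +oo) ->
    trivIset setT A ->
    P [set w | forall j, point_count Z (A j) w = ((k j)%:R)%:E] =
    (\prod_(j < n)
       let m := rho * fine (lebesgue_measure (A j)) in
       m ^+ k j / (k j)`!%:R * expR (- m))%R%:E.

Definition iid_exponential (R : realType) d (T : measurableType d)
    (P : probability T R) (H : nat -> {RV P >-> R}) : Prop :=
  (forall i (B : set R), measurable B ->
     P (H i @^-1` B) = exponential_prob 1 B) /\
  (forall (s : seq nat) (B : nat -> set R), uniq s ->
     (forall i, measurable (B i)) ->
     P [set w | forall i, i \in s -> B i (H i w)] =
     \prod_(i <- s) P (H i @^-1` B i)).

Definition sigma_family (R : realType) d (T : measurableType d)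
    (P : probability T R) (Z : nat -> {RV P >-> R}) : set (set T) :=
  <<s [set A | exists i, exists2 B : set R, measurable B & A = Z i @^-1` B] >>.

(* Pairwise independence is the special case where one event is setT. *)
Definition independent_families (R : realType) d (T : measurableType d)
    (P : probability T R) (X Y H : nat -> {RV P >-> R}) : Prop :=
  forall A B C : set T,
    sigma_family X A -> sigma_family Y B -> sigma_family H C ->
    P (A `&` B `&` C) = P A * P B * P C.

Inductive link := LoS | NLoS.

(* Functions on [0, +oo[ are represented by functions on R of which only the
   values at nonnegative arguments are ever constrained or used. *)
Definition path_loss (R : realType) (l : R -> R) : Prop :=
  [/\ forall x, (0 <= x)%R -> (0 <= l x)%R,
      [bounded l x : R^o | x in `[0%R, +oo[%classic]
    & forall x y, (0 <= x)%R -> (x <= y)%R -> (l y <= l x)%R].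

(* [excl ell v s x] is e_{v|s}(x); the infimum of the empty set is +oo. *)
Definition excl (R : realType) (ell : link -> R -> R) (v s : link) (x : R) :
    \bar R :=
  match v, s with
  | LoS, LoS | NLoS, NLoS => x%:E
  | _, _ => ereal_inf [set y%:E | y in [set y | (0 <= y)%R /\ (ell v y <= ell s x)%R]]
  end.

(* From here to [sinr], [x], [b] and [h] are one realization of the base
   stations, of the blockages and of the fading variables. *)

(* q: distance to the nearest blockage in ]0, +oo[ *)
Definition nearest_right (R : realType) (b : nat -> R) : \bar R :=
  ereal_inf [set (b j)%:E | j in [set j | (0 < b j)%R]].

(* q': distance to the nearest blockage in ]-oo, 0[ *)
Definition nearest_left (R : realType) (b : nat -> R) : \bar R :=
  ereal_inf [set `|b j|%:E | j in [set j | (b j < 0)%R]].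

Definition bs_type (R : realType) (b : nat -> R) (y : R) : link :=
  if ((0 < y)%R && (y%:E < nearest_right b))
     || ((y < 0)%R && (`|y|%:E < nearest_left b))
  then LoS else NLoS.

Definition serving (R : realType) (ell : link -> R -> R) (x b : nat -> R)
    (i : nat) : Prop :=
  forall j, j <> i ->
    excl ell (bs_type b (x j)) (bs_type b (x i)) `|x i|%R < `|x j|%:E.

Definition received (R : realType) (ell : link -> R -> R) (x b h : nat -> R)
    (i : nat) : R :=
  (h i * ell (bs_type b (x i)) `|x i|)%R.

Definition interference (R : realType) (ell : link -> R -> R)
    (x b h : nat -> R) (i : nat) : \bar R :=
  \esum_(j in [set~ i]) (received ell x b h j)%:E.

(* SINR when base station [i] is the serving one; [noise] is sigma_n^2.  An
   infinite interference gives 0, since +oo^-1 = 0. *)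
Definition sinr (R : realType) (ell : link -> R -> R) (noise : R)
    (x b h : nat -> R) (i : nat) : \bar R :=
  (received ell x b h i)%:E / (noise%:E + interference ell x b h i).

(* The event SINR > tau: the SINR is that of the serving base station, which is
   well defined outside the null set where the latter is not unique. *)
Definition covered (R : realType) d (T : measurableType d)
    (P : probability T R) (ell : link -> R -> R) (noise tau : R)
    (X Y H : nat -> {RV P >-> R}) : set T :=
  [set w | exists2 i, serving ell (X ^~ w) (Y ^~ w) i
         & tau%:E < sinr ell noise (X ^~ w) (Y ^~ w) (H ^~ w) i].

Definition coverage_probability (R : realType) d (T : measurableType d)
    (P : probability T R) (ell : link -> R -> R) (noise tau : R)
    (X Y H : nat -> {RV P >-> R}) : \bar R :=
  P (covered ell noise tau X Y H).

(* exp (- tau sigma_n^2 / a), read as 0 when a = 0 *)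
Definition noise_factor (R : realType) (noise tau a : R) : R :=
  if a == 0%R then 0%R else expR (- (tau * noise / a)).

(* 1 / (1 + tau^-1 a / b), read as 0 when b = 0 *)
Definition frac (R : realType) (tau a b : R) : R :=
  if b == 0%R then 0%R else (1 / (1 + tau^-1 * (a / b)))%R.

(* The g's and kappa's are extended-real valued: exclusion radii and the
   integrals below may be +oo, with expeR -oo = 0. *)

Definition g_L (R : realType) (ell : link -> R -> R) (lambda x q q' : R) :
    \bar R :=
  let e := excl ell NLoS LoS x in
  ((x < q)%R%:R)%:E * (expR (- (lambda * x)))%:E *
  (if q'%:E <= e then expeR (- (lambda%:E * e))
   else if (q' < x)%R then (expR (- (lambda * q')))%:E
   else (expR (- (lambda * x)))%:E).

(* At the boundary points q' = x and q' = e_{L|N}(x), the neighbouring cases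
   agree. *)
Definition g_N (R : realType) (ell : link -> R -> R) (lambda x q q' : R) :
    \bar R :=
  let e := excl ell LoS NLoS x in
  ((q <= x)%R%:R)%:E * (expR (- (lambda * x)))%:E *
  (if (q' < x)%R then (expR (- (lambda * x)))%:E
   else if q'%:E < e then (expR (- (lambda * q')))%:E
   else expeR (- (lambda%:E * e))).

Definition kappa_L (R : realType) (ell : link -> R -> R)
    (lambda tau x q' q : R) : \bar R :=
  let mu := @lebesgue_measure R in
  let a := ell LoS x in
  expeR (- (lambda%:E *
    (\int[mu]_(y in `]q, +oo[) (frac tau a (ell NLoS y))%:E
   + \int[mu]_(y in [set y | excl ell NLoS LoS x < y%:E])
       ((q' < y)%R%:R * frac tau a (ell NLoS y))%:E
   + \int[mu]_(y in `]x, q[) (frac tau a (ell LoS y))%:E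
   + \int[mu]_(y in `]x, +oo[) ((y < q')%R%:R * frac tau a (ell LoS y))%:E))).

Definition kappa_N (R : realType) (ell : link -> R -> R)
    (lambda tau x q' q : R) : \bar R :=
  let mu := @lebesgue_measure R in
  let a := ell NLoS x in
  expeR (- (lambda%:E *
    (\int[mu]_(y in `]x, +oo[) (frac tau a (ell NLoS y))%:E
   + \int[mu]_(y in `]x, +oo[) ((q' < y)%R%:R * frac tau a (ell NLoS y))%:E
   + \int[mu]_(y in [set y | excl ell LoS NLoS x < y%:E])
       ((y < q')%R%:R * frac tau a (ell LoS y))%:E))).

(* Main.v *)
(* Given the base stations and the blockages, station i covers the user if and
   only if its fading exceeds an affine function of the other fading variables.
   For independent exponential variables this has an explicit probability,
   which, with the serving condition encoded as an infinite penalty, has the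
   form c(x_i) exp (- sum_(j <> i) Phi(x_i, x_j)).  For fixed distances q and q'
   of the nearest blockages, the expected sum over i of these weights is
   int lambda c(x) exp (- lambda int (1 - exp (- Phi(x, y))) dy) dx.  This
   instance of Mecke's formula follows from the Laplace functional alone: c is
   nonincreasing, Phi is nondecreasing in x, and two stations of the same type
   on the same side never both have positive weight, so that on a short
   interval ]a, b] the expectation lies between the integrand at b and at a, up
   to a factor exp (lambda (b - a)).  Finally q and q' are averaged out; the
   negative half-line is the mirror image of the positive one with q and q'
   exchanged, whence the factor 2. *)
From HB Require Import structures.
Require Import Defs.
From mathcomp Require Import ring lra measurable_realfun.
Set Implicit Arguments.
Unset Strict Implicit.
Unset Printing Implicit Defensive.
Import HBNNSimple.
Local Open Scope classical_set_scope.
Local Open Scope ring_scope.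
Local Open Scope ereal_scope.

(** The obstacle is that the weight of a station involves all the others, while the Laplace
    functional singles out no point. A distinguished point is supplied by counting: the functional
    is needed jointly with the number of points of a short cell, and that is what the
    finite-dimensional laws of a PPP give, through simple functions. The penalty ln (1 + tau g / a)
    is minus the logarithm of 1 / (1 + tau g / a), the Laplace transform of a fading variable; it
    grows with the serving distance because path losses are nonincreasing and exclusion radii
    nondecreasing. In the exponent, 1 - exp (- Phi) is 1 on the exclusion zones and [frac]
    elsewhere: the lengths of the zones make up g, the remaining integrals make up kappa. Almost
    sure uniqueness of the serving station turns the probability of a union into the sum over i.
    Independence of the three processes is a statement on generated sigma-algebras, so it is used
    through identity maps of T into T with a coarser sigma-algebra. *)

(** * Uniqueness of measures, independence and densities *)

Lemma finite_measure_unique d (T : measurableType d) (R : realType)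
    (m1 m2 : {measure set T -> \bar R}) (G : set (set T)) :
  G `<=` measurable -> setI_closed G -> m1 setT = m2 setT -> m1 setT < +oo ->
  (forall A, G A -> m1 A = m2 A) -> forall A, <<s G >> A -> m1 A = m2 A.
Proof.
move=> mG GI eT fT eG A GA.
have HG : [set X | G X /\ X `<=` setT] = G by apply/seteqP; split => [X []|X].
apply: (g_sigma_algebra_measure_unique_trace G setT); rewrite ?HG //.
Qed.

Section independence.
Context d (T : measurableType d) (R : realType) (P : probability T R).

(** As functions of A, both sides are finite measures of equal total mass: P restricted to B, and P
    scaled by the constant P B. *)
Lemma indep_pi_system_left (G : set (set T)) (B : set T) :
  G `<=` measurable -> setI_closed G -> measurable B ->
  (forall A, G A -> P (A `&` B) = P A * P B) ->
  forall A, <<s G >> A -> P (A `&` B) = P A * P B.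
Proof.
move=> mG GI mB GB A GA.
have PBfin : P B = (fine (P B))%:E by rewrite fineK// fin_num_measure.
have fB0 : (0 <= fine (P B))%R by rewrite fine_ge0.
rewrite muleC PBfin.
apply: (@finite_measure_unique _ _ _ (mrestr P mB) (mscale (NngNum fB0) P) G)
  => //=.
- by rewrite /mrestr /mscale/= setTI probability_setT mule1 -PBfin.
- by rewrite /mrestr setTI PBfin ltry.
- by move=> C GC; rewrite /mrestr/= /mscale/= -PBfin muleC GB.
Qed.

Lemma indep_pi_system (G1 G2 : set (set T)) :
  G1 `<=` measurable -> setI_closed G1 -> G2 `<=` measurable ->
  setI_closed G2 ->
  (forall A B, G1 A -> G2 B -> P (A `&` B) = P A * P B) ->
  forall A B, <<s G1 >> A -> <<s G2 >> B -> P (A `&` B) = P A * P B.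
Proof.
move=> mG1 GI1 mG2 GI2 G12 A B GA GB.
have mA : measurable A by exact: (smallest_sub (sigma_algebra_measurable T) mG1).
rewrite setIC muleC; apply: (@indep_pi_system_left G2) => // C GC.
rewrite setIC muleC; apply: (@indep_pi_system_left G1) => //.
  exact: mG2.
by move=> D GD; exact: G12.
Qed.

(** Independence says that the law of (f1, f2) is the product of the two laws. Tonelli then keeps
    the first argument at w and averages the second over a separate copy w' of the sample; the
    conditionings below all have this form. *)
Lemma ge0_integral_indep d1 d2 (T1 : measurableType d1) (T2 : measurableType d2)
    (f1 : T -> T1) (f2 : T -> T2) (g : T1 * T2 -> \bar R) :
  measurable_fun setT f1 -> measurable_fun setT f2 ->
  (forall A B, measurable A -> measurable B ->
     P (f1 @^-1` A `&` f2 @^-1` B) = P (f1 @^-1` A) * P (f2 @^-1` B)) ->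
  measurable_fun setT g -> (forall z, 0 <= g z) ->
  \int[P]_w g (f1 w, f2 w) = \int[P]_w \int[P]_w' g (f1 w, f2 w').
Proof.
move=> mf1 mf2 indep mg g0.
pose f w := (f1 w, f2 w).
have mf : measurable_fun setT f by exact: measurable_fun_pair.
pose F1 : {mfun T >-> T1} := HB.pack f1 (isMeasurableFun.Build _ _ _ _ f1 mf1).
pose F2 : {mfun T >-> T2} := HB.pack f2 (isMeasurableFun.Build _ _ _ _ f2 mf2).
pose F : {mfun T >-> (T1 * T2)%type} :=
  HB.pack f (isMeasurableFun.Build _ _ _ _ f mf).
have prodE A : measurable A ->
    (distribution P F1 \x distribution P F2) A = distribution P F A.
  apply: product_measure_unique => A1 A2 mA1 mA2.
  by rewrite /distribution /pushforward/= -indep.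
transitivity (\int[distribution P F]_z g z).
  by rewrite ge0_integral_distribution.
transitivity (\int[distribution P F1 \x distribution P F2]_z g z).
  by apply: eq_measure_integral => A mA _; apply/esym; exact: prodE.
rewrite fubini_tonelli1// ge0_integral_distribution//=; last 2 first.
- exact: measurable_fun_fubini_tonelli_F.
- by move=> x; exact: integral_ge0.
apply: eq_integral => w _; rewrite /fubini_F ge0_integral_distribution//.
exact: measurableT_comp (measurable_pair1 _).
Qed.

End independence.

(** For an indicator this is the hypothesis on nu; simple functions increasing to f give the general
    case by monotone convergence on both sides. *)
Lemma ge0_integral_density d (U : measurableType d) (R : realType)
    (m nu : {measure set U -> \bar R}) (p : U -> R) (f : U -> \bar R) :
  measurable_fun setT p -> (forall x, (0 <= p x)%R) ->
  (forall A, measurable A -> nu A = \int[m]_(x in A) (p x)%:E) ->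
  measurable_fun setT f -> (forall x, 0 <= f x) ->
  \int[nu]_x f x = \int[m]_x (f x * (p x)%:E).
Proof.
move=> mp p0 nuE mf f0.
have mpE : measurable_fun setT (EFin \o p) by exact/measurable_EFinP.
pose h := nnsfun_approx measurableT mf.
have hf x : (h n x)%:E @[n --> \oo] --> f x by exact: cvg_nnsfun_approx.
transitivity (limn (fun n => \int[nu]_x (h n x)%:E)).
  rewrite -monotone_convergence//.
  - by apply: eq_integral => x _; apply/esym/cvg_lim.
  - by move=> n; exact/measurable_EFinP.
  - by move=> *; rewrite lee_fin.
  - by move=> x _ a b ab; rewrite lee_fin; exact/lefP/nd_nnsfun_approx.
transitivity (limn (fun n => \int[m]_x ((h n x)%:E * (p x)%:E))); last first.
  rewrite -monotone_convergence//.
  - by apply: eq_integral => x _; apply: cvg_lim => //; exact: cvgeZr.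
  - by move=> n; apply: emeasurable_funM => //; exact/measurable_EFinP.
  - by move=> n x _; rewrite mule_ge0// lee_fin.
  - move=> x _ a b ab; rewrite lee_wpmul2r ?lee_fin//.
    exact/lefP/nd_nnsfun_approx.
congr (limn _); apply: funext => n.
have mind r : measurable_fun setT (fun x => (r * \1_(h n @^-1` [set r]) x)%:E).
  by apply/measurable_EFinP; exact: measurable_funM.
transitivity (\int[nu]_x
    (\sum_(y \in range (h n)) (y * \1_(h n @^-1` [set y]) x)%:E)).
  by apply: eq_integral => t tE; rewrite /= fimfunE -fsumEFin.
rewrite ge0_integral_fsum//; last by move=> r y _; exact: nnfun_muleindic_ge0.
transitivity (\int[m]_x (\sum_(y \in range (h n))
    (y * \1_(h n @^-1` [set y]) x)%:E * (p x)%:E)); last first.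
  apply: eq_integral => x _.
  rewrite -ge0_mule_fsuml => [|y]; last exact: nnfun_muleindic_ge0.
  by rewrite fsumEFin // -(fimfunE _ x).
rewrite ge0_integral_fsum//; last 2 first.
  - by move=> y; exact: emeasurable_funM.
  - by move=> r y _; rewrite mule_ge0 ?lee_fin// -lee_fin nnfun_muleindic_ge0.
apply: eq_fsbigr => r rhn.
under eq_integral do rewrite EFinM.
rewrite integralZl_indic_nnsfun// integral_indic// setIT nuE//.
under [RHS]eq_integral do rewrite EFinM -muleA.
rewrite ge0_integralZl//; last 3 first.
- by apply: emeasurable_funM => //; exact/measurable_EFinP.
- by move=> x _; rewrite mule_ge0 ?lee_fin.
- by move: rhn; rewrite inE => -[t _ <-]; rewrite lee_fin.
congr (_ * _); rewrite integral_mkcond; apply: eq_integral => x _.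
by rewrite epatch_indic muleC.
Qed.

(** * Exponential fading *)

Section expeRN.
Context {R : realType}.

Lemma expeRN_ge0_le1 (x : \bar R) : 0 <= x -> expeR (- x) <= 1.
Proof. by move=> x0; rewrite -(@expeR0 R) lee_expeR oppe_le0. Qed.

Lemma expeRN_fin_num (x : \bar R) : 0 <= x -> expeR (- x) \is a fin_num.
Proof.
move=> x0; rewrite ge0_fin_numE ?expeR_ge0//.
by rewrite (le_lt_trans (expeRN_ge0_le1 x0))// ltry.
Qed.

(** Continuity is wanted up to +oo, where exp (- u) is 0, because penalties and exponents may be
    infinite. For an infinite limit, u >= - ln e forces exp (- u) <= e. *)
Lemma cvg_expeRN (u : (\bar R)^nat) (l : \bar R) :
  (forall n, 0 <= u n) -> u @ \oo --> l ->
  expeR (- u n) @[n --> \oo] --> expeR (- l).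
Proof.
move=> u0; case: l => [r|ul|ul]; last 2 first.
- apply/fine_cvgP; split; first by near=> n; exact: expeRN_fin_num.
  apply/cvgrPdist_le => e e0.
  have : \forall n \near \oo, (- ln e)%:E <= u n by move/cvgeyPge : ul; exact.
  apply: filterS => n une; rewrite sub0r normrN /= ger0_norm; last first.
    by rewrite fine_ge0// expeR_ge0.
  rewrite -lee_fin fineK ?expeRN_fin_num//.
  rewrite -[e in leRHS](lnK e0) -[leRHS]/(expeR (ln e)%:E) lee_expeR.
  by rewrite leeNl.
- have : \forall n \near \oo, u n <= (-1)%:E by move/cvgeNyPle : ul; exact.
  case=> n _ /(_ n (leqnn n)) /= /(le_trans (u0 n)).
  by rewrite lee_fin ler0N1.
move=> /fine_cvgP[ufin ur]; apply/fine_cvgP; split.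
  by near=> n; exact: expeRN_fin_num.
have : expR (- fine (u n))%R @[n --> \oo] --> expR (- r).
  by apply: continuous_cvg; [exact: continuous_expR|exact: cvgN].
apply: cvg_trans; apply: near_eq_cvg; near=> n.
have ufn : u n \is a fin_num by near: n.
by rewrite /= -{2}(fineK ufn).
Unshelve. all: by end_near. Qed.

Lemma measurable_expeR : measurable_fun setT (@expeR R).
Proof.
rewrite (_ : @expeR R = fun x : \bar R =>
  if x == +oo then +oo else if x == -oo then 0 else (expR (fine x))%:E).
  apply: measurable_fun_ifT => //; first exact: measurable_fun_eqe.
  apply: measurable_fun_ifT => //; first exact: measurable_fun_eqe.
  apply/measurable_EFinP; apply: measurableT_comp => //.
by apply: funext; case.
Qed.

End expeRN.

Lemma measurable_expeRN d (T : measurableType d) (R : realType)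
    (f : T -> \bar R) :
  measurable_fun setT f -> measurable_fun setT (fun x => expeR (- f x)).
Proof.
by move=> mf; apply: (measurableT_comp measurable_expeR); exact: measurableT_comp.
Qed.

(** Dominated convergence: the constant 1 dominates and P is finite. *)
Lemma integral_expeRN_cvg d (T : measurableType d) (R : realType)
    (P : probability T R) (u : nat -> T -> \bar R) (l : T -> \bar R)
    (D : set T) : measurable D ->
  (forall n, measurable_fun setT (u n)) -> (forall n x, 0 <= u n x) ->
  (forall x, u n x @[n --> \oo] --> l x) ->
  \int[P]_(x in D) expeR (- u n x) @[n --> \oo] -->
  \int[P]_(x in D) expeR (- l x).
Proof.
move=> mD mu u0 ul; apply: (@dominated_cvg _ _ _ _ _ _ _ _ (cst 1)) => //.
- move=> n; apply: measurable_funTS; apply: measurableT_comp measurable_expeR _.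
  exact: measurableT_comp.
- by move=> x _; exact: cvg_expeRN.
- exact: finite_measure_integrable_cst.
- by move=> n x _; rewrite gee0_abs ?expeR_ge0// expeRN_ge0_le1.
Qed.

Lemma integral_indic_set d (T : measurableType d) (R : realType)
    (P : {measure set T -> \bar R}) (b : T -> bool) : measurable_fun setT b ->
  \int[P]_w ((b w)%:R)%:E = P [set w | b w].
Proof.
move=> mb; have mB : measurable [set w | b w].
  by have := mb measurableT [set true] I; rewrite setTI.
rewrite -(setIT [set w | b w]) -integral_indic//.
by apply: eq_integral => w _; rewrite indicE; congr ((nat_of_bool _)%:R%:E);
  apply/idP/idP; rewrite ?inE.
Qed.

Lemma exponential_prob_gt (R : realType) (r x : R) : (0 < r)%R -> (0 <= x)%R ->
  exponential_prob r `]x, +oo[ = (expR (- (r * x)))%:E.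
Proof.
move=> r0 x0.
have mpdf A : measurable_fun A (EFin \o exponential_pdf r).
  by apply/measurable_EFinP/measurable_funTS; exact: measurable_exponential_pdf.
have pdf0 y : 0 <= (exponential_pdf r y)%:E.
  by rewrite lee_fin exponential_pdf_ge0// ltW.
have cx : exponential_prob r `[0%R, x] = 1 - (expR (- (r * x)))%:E.
  have [->|xn0] := eqVneq x 0%R.
    rewrite mulr0 oppr0 expR0 subee// /exponential_prob set_itv1.
    by rewrite integral_set1.
  by rewrite exponential_prob_itv0c ?lt0r ?xn0// mulNr.
have cN : exponential_prob r `]-oo, 0%R[ = 0.
  rewrite /exponential_prob integral0_eq// => y /=; rewrite in_itv/= => y0.
  by rewrite lt0_exponential_pdf.
have : exponential_prob r setT = 1 by exact: integral_exponential_pdf.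
have -> : [set: R] = `]-oo, 0%R[ `|` `[0%R, x] `|` `]x, +oo[.
  apply/seteqP; split => // y _; rewrite /= !in_itv/= andbT.
  by case: (ltP y 0%R) => y0; [left; left|case: (leP y x); [left; right|right]].
rewrite {1}/exponential_prob.
rewrite ge0_integral_setU//=; [|exact: measurableU| |]; last 2 first.
- exact: mpdf.
- apply/disj_set2P/seteqP; split => // y [/= + ]; rewrite !in_itv/= andbT.
  case=> [y0 xy|/andP[_ yx] xy]; last by rewrite ltNge yx in xy.
  by move: xy; rewrite ltNge (le_trans (ltW y0) x0).
rewrite ge0_integral_setU//=; last 2 first.
- exact: mpdf.
- apply/disj_set2P/seteqP; split => // y [/= + ]; rewrite !in_itv/=.
  by move=> y0 /andP[]; rewrite leNgt y0.
rewrite -!/(exponential_prob r _) cN cx add0e.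
case: (exponential_prob r `]x, +oo[) => [p| |] // [] ?.
by congr EFin; lra.
Qed.

(** This is the Laplace transform of the exponential law: the integrand is (1 + c)^-1 times the
    exponential density of rate 1 + c. The positive part changes nothing where the density is
    nonzero, and it is the form in which fading enters the interference. *)
Lemma integral_exponential_decay (R : realType) (c : R) : (0 <= c)%R ->
  \int[lebesgue_measure]_x ((expR (- (c * Num.max x 0)))%:E *
    (exponential_pdf 1 x)%:E) = ((1 + c)^-1)%:E.
Proof.
move=> c0; have c1 : (0 < 1 + c)%R by rewrite ltr_wpDr.
transitivity (\int[lebesgue_measure]_x
    (((1 + c)^-1)%:E * (exponential_pdf (1 + c)%R x)%:E)).
  apply: eq_integral => x _; rewrite -!EFinM; congr EFin.
  have [x0|x0] := ltP x 0%R; first by rewrite !lt0_exponential_pdf// !mulr0.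
  rewrite !exponential_pdfE// mul1r.
  rewrite mulrA mulVf ?gt_eqF// mul1r -expRD; congr expR.
  by ring.
rewrite ge0_integralZl//=; last 3 first.
- by apply/measurable_EFinP; exact: measurable_exponential_pdf.
- by move=> x _; rewrite lee_fin exponential_pdf_ge0// ltW.
- by rewrite lee_fin invr_ge0 ltW.
by rewrite integral_exponential_pdf// mule1.
Qed.

Lemma measurable_pos_part d (T : measurableType d) (R : realType) (D : set T)
    (f : T -> R) :
  measurable_fun D f -> measurable_fun D (fun x => Num.max (f x) 0)%R.
Proof. by move=> mf; apply: (@measurable_maxr _ _ _ _ _ (fun=> 0%R)).  Qed.

Lemma measurable_bool_indic d (T : measurableType d) (R : realType)
    (b : T -> bool) :
  measurable_fun setT b -> measurable_fun setT (fun x => ((b x)%:R%:E : \bar R)).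
Proof.
move=> mb; rewrite (_ : (fun _ => _) = fun x => if b x then 1 else 0 : \bar R).
  exact: measurable_fun_ifT.
by apply: funext => x; case: (b x).
Qed.

Section iid.
Context (R : realType) d (T : measurableType d) (P : probability T R).
Variable H : nat -> {RV P >-> R}.
Hypothesis iidH : iid_exponential H.

(** A pi-system of events on finitely many of the variables with index in D. The list of indices is
    duplicate-free because independence is stated for such lists. *)
Definition cylinders (D : pred nat) : set (set T) :=
  [set A | exists s, [/\ uniq s, all D s &
    exists2 B : nat -> set R, (forall j, measurable (B j)) &
      A = [set w | forall j, j \in s -> B j (H j w)]]].

Lemma cylinders_measurable D : cylinders D `<=` measurable.
Proof.
move=> A [s [_ _ [B mB ->]]].
rewrite (_ : [set _ | _] = \bigcap_(j in [set` s]) (H j @^-1` B j)); last first.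
  by apply/seteqP; split => w h j; exact: h.
apply: bigcap_measurableType => j _.
exact: measurable_funPTI.
Qed.

Lemma cylinders_setI D : setI_closed (cylinders D).
Proof.
move=> _ _ [s1 [_ a1 [B1 mB1 ->]]] [s2 [_ a2 [B2 mB2 ->]]].
exists (undup (s1 ++ s2)); split; first exact: undup_uniq.
  by apply/allP => j; rewrite mem_undup mem_cat => /orP[] /(allP _ _); exact.
exists (fun j => (if j \in s1 then B1 j else setT) `&`
                 (if j \in s2 then B2 j else setT)).
  by move=> j; apply: measurableI; case: ifP.
apply/seteqP; split => w /=.
  move=> [h1 h2] j _; split; case: ifPn => // js; [exact: h1|exact: h2].
move=> h; split => j js; have := h j; rewrite mem_undup mem_cat js ?orbT.
  by case/(_ isT).
by case/(_ isT).
Qed.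

(** Since i lies outside D, it can be added to the index list of any cylinder, where the product
    formula applies; the pi-system argument extends this to the generated sigma-algebra. *)
Lemma cylinder_indep D i (A : set T) (B : set R) : ~~ D i ->
  <<s cylinders D >> A -> measurable B ->
  P (A `&` H i @^-1` B) = P A * P (H i @^-1` B).
Proof.
move=> Di DA mB; apply: (@indep_pi_system_left _ _ _ _ (cylinders D)) => //.
- exact: cylinders_measurable.
- exact: cylinders_setI.
- exact: measurable_funPTI.
move=> _ [s [us aD [C mC ->]]].
have iNs : i \notin s by apply: contra Di => /(allP aD).
pose E j := if j == i then B else C j.
have mE j : measurable (E j) by rewrite /E; case: ifP.
rewrite [LHS](_ : _ = P [set w | forall j, j \in i :: s -> E j (H j w)]); last first.
  congr (P _); apply/seteqP; split => w /=.
    move=> [hC hB] j; rewrite inE /E => /predU1P[->|js]; first by rewrite eqxx.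
    by case: eqVneq js => [->|_ /hC//]; rewrite (negbTE iNs).
  move=> h; split; last by have := h i; rewrite inE eqxx/= /E eqxx; exact.
  move=> j js; have := h j; rewrite inE js orbT /E => /(_ isT).
  by case: eqVneq js => [->|//]; rewrite (negbTE iNs).
have [_ ind] := iidH.
rewrite ind//= ?iNs// big_cons /E eqxx muleC; congr (_ * _).
rewrite ind//; apply: eq_big_seq => j js.
by case: eqVneq js => [->|//]; rewrite (negbTE iNs).
Qed.

(** T with only the events determined by the variables indexed by D. The identity map into it stands
    for the whole, possibly infinite, subfamily, so that its independence from a further [H i] is
    that of two measurable maps. *)
Let TD (D : pred nat) := g_sigma_algebraType (cylinders D).

Let measurable_H (D : pred nat) j : D j -> measurable_fun setT (H j : TD D -> R).
Proof.
move=> Dj _ B mB; rewrite setTI; apply: sub_sigma_algebra.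
exists [:: j]; split => //=; first by rewrite Dj.
exists (fun=> B) => //; apply/seteqP; split => w /=.
  by move=> ? k; rewrite inE => /eqP->.
by apply; rewrite inE.
Qed.

Let integral_fading_indep (D : pred nat) i (g : TD D * R -> \bar R) : ~~ D i ->
  measurable_fun setT g -> (forall z, 0 <= g z) ->
  \int[P]_w g (w, H i w) = \int[P]_w \int[P]_w' g (w, H i w').
Proof.
move=> Di mg g0.
apply: (@ge0_integral_indep _ _ _ P _ _ (TD D) R idfun (H i) g) => //.
  move=> _ A DA; rewrite setTI.
  exact: (smallest_sub (sigma_algebra_measurable T) (@cylinders_measurable D)).
by move=> A B DA mB; exact: (cylinder_indep Di DA mB).
Qed.

Let integral_fading (f : R -> \bar R) i : measurable_fun setT f ->
  (forall x, 0 <= f x) ->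
  \int[P]_w f (H i w) =
  \int[lebesgue_measure]_x (f x * (exponential_pdf 1 x)%:E).
Proof.
move=> mf f0.
have mH : measurable_fun setT (H i : T -> measurableTypeR R).
  by move=> _ B mB; rewrite setTI; exact: (@measurable_funPTI _ _ _ _ (H i)).
pose Hi : {mfun T >-> measurableTypeR R} :=
  HB.pack (H i : T -> measurableTypeR R) (isMeasurableFun.Build _ _ _ _ _ mH).
rewrite -(@ge0_integral_distribution _ _ _ _ _ P Hi)//.
apply: ge0_integral_density => //.
- exact: measurable_exponential_pdf.
- by move=> x; rewrite exponential_pdf_ge0// ler01.
- by move=> A mA; rewrite /distribution /pushforward; exact: (iidH.1 i A mA).
Qed.

(** Induction on n: the last variable is independent of the earlier ones and contributes its Laplace
    transform 1 / (1 + c n), written exp (- ln (1 + c n)) so that the factors add up in the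
    exponent. *)
Lemma integral_fading_sum (c : nat -> R) (D : pred nat) n :
  (forall j, (0 <= c j)%R) ->
  \int[P]_w (expR (- \sum_(0 <= j < n | D j) c j * Num.max (H j w) 0))%:E =
  (expR (- \sum_(0 <= j < n | D j) ln (1 + c j)))%:E.
Proof.
move=> c0; elim: n => [|n IHn].
  under eq_integral do rewrite big_nil oppr0 expR0.
  rewrite big_nil oppr0 expR0 integral_cst//.
  by rewrite -[X in _ * X]/(P setT) probability_setT mule1.
under eq_integral do rewrite big_mkcond big_nat_recr//= -big_mkcond/=.
rewrite [in RHS]big_mkcond big_nat_recr//= -big_mkcond/=.
case: ifPn => Dn; last by under eq_integral do rewrite addr0; rewrite addr0.
(* The bound j < n keeps the index n out of the predicate, as independence of [H n] from the partial
   sum requires. *)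
pose Dn' := [pred j | D j && (j < n)%N].
pose g (z : TD Dn' * R) := ((expR (- \sum_(0 <= j < n | D j)
  c j * Num.max (H j z.1) 0))%:E * (expR (- (c n * Num.max z.2 0)))%:E).
under eq_integral do rewrite opprD expRD EFinM -[_ * _]/(g (_, H n _)).
have mexp : measurable_fun setT (fun x : R => (expR (- (c n * Num.max x 0)))%:E).
  apply/measurable_EFinP; apply: measurableT_comp => //.
  apply: measurableT_comp => //; apply: measurable_funM => //.
  exact: measurable_pos_part.
rewrite integral_fading_indep; last 3 first.
- by rewrite /= ltnn andbF.
- apply: emeasurable_funM; last exact: (measurableT_comp mexp).
  apply/measurable_EFinP; apply: measurableT_comp => //.
  apply: measurableT_comp => //.
  under eq_fun do rewrite big_mkcond/= big_mkord.
  rewrite -/(measurable_fun _ _).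
  apply: measurable_sum => j; have [Dj|Dj] := boolP (D j); last exact: measurable_cst.
  apply: measurable_funM => //.
  apply: (@measurable_pos_part _ _ _ _ (fun z : TD Dn' * R => H j z.1)).
  have Dj' : Dn' j by rewrite /Dn'/= Dj ltn_ord.
  exact: (measurableT_comp (measurable_H Dj')).
- by move=> z; rewrite mule_ge0 ?lee_fin ?expR_ge0.
rewrite /g/=.
under eq_integral => w _.
  rewrite ge0_integralZl//; last exact: (measurableT_comp mexp).
  rewrite (@integral_fading (fun y => (expR (- (c n * Num.max y 0)))%:E))//.
  rewrite integral_exponential_decay//; over.
rewrite ge0_integralZr//; last 2 first.
- apply/measurable_EFinP; apply: measurableT_comp => //.
  apply: measurableT_comp => //.
  under eq_fun do rewrite big_mkcond/= big_mkord.
  rewrite -/(measurable_fun _ _).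
  apply: measurable_sum => j; have [Dj|Dj] := boolP (D j); last exact: measurable_cst.
  by apply: measurable_funM => //; exact: measurable_pos_part.
- by rewrite lee_fin invr_ge0 addr_ge0.
rewrite IHn -EFinM opprD expRD; congr (_ * _)%:E.
by rewrite expRN lnK// posrE ltr_wpDr.
Qed.

(** Given the other variables, the exponential tail yields exp (- c0 - S), with S their weighted
    sum; averaging exp (- S) multiplies the Laplace transforms 1 / (1 + c j). *)
Lemma fading_race (c : nat -> R) (c0 : R) (i : nat) :
  (0 <= c0)%R -> (forall j, (0 <= c j)%R) ->
  P [set w | c0%:E + \sum_(0 <= j <oo | j != i) (c j * Num.max (H j w) 0)%:E
             < (H i w)%:E] =
  (expR (- c0))%:E * expeR (- \sum_(0 <= j <oo | j != i) (ln (1 + c j))%:E).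
Proof.
move=> c00 c_ge0.
have term0 j (y : R) : (0 <= c j * Num.max y 0)%R.
  by rewrite mulr_ge0// le_max lexx orbT.
pose S w := \sum_(0 <= j <oo | j != i) (c j * Num.max (H j w) 0)%:E.
have S0 w : 0 <= S w by apply: nneseries_ge0 => j _ _; rewrite lee_fin.
have mterm (D : pred nat) j : D j ->
    measurable_fun setT (fun w : TD D => (c j * Num.max (H j w) 0)%:E).
  move=> Dj; apply/measurable_EFinP; apply: measurable_funM => //.
  by apply: measurable_pos_part; exact: measurable_H.
have mS : measurable_fun setT (S : TD (predC1 i) -> \bar R).
  apply: (@ge0_emeasurable_sum _ _ _ _ _ (predC1 i)).
    by move=> j w _ _; rewrite lee_fin.
  by move=> j ji; exact: mterm.
pose g (z : TD (predC1 i) * R) := (c0%:E + S z.1 < z.2%:E)%E%:R%:E : \bar R.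
have mg : measurable_fun setT (fun z : TD (predC1 i) * R =>
    (c0%:E + S z.1 < z.2%:E)).
  apply: measurable_fun_lte.
    by apply: emeasurable_funD => //; exact: (measurableT_comp mS).
  by apply/measurable_EFinP.
have mST : measurable_fun setT S.
  apply: (@ge0_emeasurable_sum _ _ _ _ _ (predC1 i)).
    by move=> j w _ _; rewrite lee_fin.
  move=> j _; apply/measurable_EFinP; apply: measurable_funM => //.
  exact: measurable_pos_part.
transitivity (\int[P]_w g (w, H i w)).
  rewrite (@integral_indic_set _ _ _ P (fun w => c0%:E + S w < (H i w)%:E))//.
  apply: measurable_fun_lte; last by apply/measurable_EFinP.
  exact: emeasurable_funD.
rewrite integral_fading_indep//; last 3 first.
- by rewrite /= eqxx.
- exact: measurable_bool_indic mg.
- by move=> z; rewrite lee_fin.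
transitivity (\int[P]_w ((expR (- c0))%:E * expeR (- S w))).
  apply: eq_integral => w _; rewrite /g/=.
  rewrite (@integral_indic_set _ _ _ P (fun w' => c0%:E + S w < (H i w')%:E)).
    (* If S w = +oo the event is empty, in agreement with exp (- S w) = 0. *)
    have [|] := boolP (S w \is a fin_num); last first.
      rewrite ge0_fin_numE// -leNgt leye_eq => /eqP ->.
      rewrite /= mule0 (_ : [set _ | _] = set0) ?measure0//.
      by apply/seteqP; split => // w'; rewrite /= addey.
    move: (S0 w); case: (S w) => // s; rewrite lee_fin => s0 _.
    have := exponential_prob_gt (@ltr01 R) (addr_ge0 c00 s0).
    rewrite -(iidH.1 i)// mul1r opprD expRD EFinM => <-; congr (P _).
    by apply/seteqP; split => w'; rewrite /= in_itv/= andbT lte_fin.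
  by apply: measurable_fun_lte; last by apply/measurable_EFinP.
rewrite ge0_integralZl//; last 2 first.
- by apply: (measurableT_comp measurable_expeR); exact: measurableT_comp.
- by move=> w _; rewrite expeR_ge0.
congr (_ * _).
(* The transform is known for finite sums; both sides converge along the partial sums. *)
pose Sn n w := \sum_(0 <= j < n | j != i) (c j * Num.max (H j w) 0)%:E.
have SnE n w : Sn n w =
    (\sum_(0 <= j < n | predC1 i j) c j * Num.max (H j w) 0)%R%:E.
  by rewrite /Sn sumEFin.
have lhs : \int[P]_w expeR (- Sn n w) @[n --> \oo] --> \int[P]_w expeR (- S w).
  apply: integral_expeRN_cvg => //.
  - move=> n; rewrite (_ : Sn n = fun w => \sum_(j < n)
        if val j != i then (c j * Num.max (H j w) 0)%:E else 0); last first.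
      by apply: funext => w; rewrite /Sn big_mkcond big_mkord.
    apply: emeasurable_sum => j.
    have [Dj|Dj] := boolP (val j != i); last exact: measurable_cst.
    apply/measurable_EFinP; apply: measurable_funM => //.
    exact: measurable_pos_part.
  - by move=> n w; apply: sume_ge0 => j _; rewrite lee_fin.
  - by move=> w; apply: is_cvg_nneseries => j _ _; rewrite lee_fin.
have rhs : expeR (- \sum_(0 <= j < n | j != i) (ln (1 + c j))%:E) @[n --> \oo]
    --> expeR (- \sum_(0 <= j <oo | j != i) (ln (1 + c j))%:E).
  have ln0 j : 0 <= (ln (1 + c j))%:E by rewrite lee_fin ln_ge0// lerDl.
  apply: cvg_expeRN; first by move=> n; exact: sume_ge0.
  by apply: is_cvg_nneseries.
apply/esym; apply: cvg_unique rhs _ => //; apply: cvg_trans lhs.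
apply: near_eq_cvg; apply: nearW => n.
under eq_integral do rewrite SnE/=.
by rewrite integral_fading_sum// sumEFin.
Qed.

End iid.

(** * Laplace functional of a Poisson process *)

(** Monotone convergence for the counting measure. *)
Lemma cvg_nneseries_monotone (R : realType) (u : nat -> nat -> \bar R)
    (l : nat -> \bar R) :
  (forall n j, 0 <= u n j) -> (forall j, nondecreasing_seq (u ^~ j)) ->
  (forall j, u n j @[n --> \oo] --> l j) ->
  \sum_(0 <= j <oo) u n j @[n --> \oo] --> \sum_(0 <= j <oo) l j.
Proof.
move=> u0 ndu ul.
have l0 j : 0 <= l j by apply: (cvge_to_ge (ul j)); exact: nearW.
under eq_fun do rewrite -ge0_integral_count//.
rewrite -ge0_integral_count// (_ : (fun j => l j) = fun j => limn (u ^~ j)); last first.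
  by apply: funext => j; apply/esym/cvg_lim.
exact: cvg_monotone_convergence.
Qed.

Lemma measurable_scaled_indic d (U : measurableType d) (R : realType) (c : R)
    (A : set U) :
  measurable A -> measurable_fun setT (fun x => (c * \1_A x)%:E).
Proof.
by move=> mA; apply/measurable_EFinP; apply: measurable_funM => //;
  exact: measurable_indic.
Qed.

Lemma integral_scaled_indic d (U : measurableType d) (R : realType)
    (mu : {measure set U -> \bar R}) (c : R) (A : set U) :
  (0 <= c)%R -> measurable A -> \int[mu]_x (c * \1_A x)%:E = c%:E * mu A.
Proof.
move=> c0 mA; under eq_integral do rewrite EFinM.
rewrite ge0_integralZl//; first by rewrite integral_indic// setIT.
by apply/measurable_EFinP; exact: measurable_indic.
Qed.

Lemma point_count_eq0 (R : realType) d (T : measurableType d) (P : probability T R)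
    (Y : nat -> {RV P >-> R}) (A : set R) w :
  point_count Y A w = 0 <-> forall i, ~ A (Y i w).
Proof.
split=> [+ i Ai|h].
  rewrite /point_count (@nneseriesD1 _ _ i)//=.
  rewrite indicE mem_set//; set S := \sum_(0 <= k <oo | _) _ => S1.
  have S0 : 0 <= S by apply: nneseries_ge0 => k _ _; rewrite lee_fin.
  have : 0 < 1 + S by rewrite (@lt_le_trans _ _ 1)// leeDl.
  by rewrite S1 ltxx.
by apply: eseries0 => i _ _; rewrite indicE memNset.
Qed.

Section poisson.
Context {R : realType}.

Definition poisson_weight (m : R) (k : nat) : R := (m ^+ k / k`!%:R * expR (- m))%R.

Lemma poisson_weight_ge0 (m : R) k : (0 <= m)%R -> (0 <= poisson_weight m k)%R.
Proof. by move=> m0; rewrite !mulr_ge0 ?exprn_ge0 ?invr_ge0 ?expR_ge0. Qed.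

(** The Laplace transform at s of the Poisson law of mean m, read off the exponential series at m
    exp (- s). At s = 0 it says that the weights add up to 1. *)
Lemma poisson_series (m s : R) : (0 <= m)%R -> (0 <= s)%R ->
  \sum_(0 <= k <oo) ((expR (- (s * k%:R)))%:E * (poisson_weight m k)%:E) =
  (expR (- (m * (1 - expR (- s)))))%:E.
Proof.
move=> m0 s0.
transitivity ((expR (- m))%:E *
    \sum_(0 <= k <oo) (exp_coeff (m * expR (- s)) k)%:E).
  rewrite -nneseriesZl; last first.
    by move=> k _; rewrite lee_fin exp_coeff_ge0// mulr_ge0// expR_ge0.
  apply: eq_eseriesr => k _; rewrite -!EFinM; congr EFin.
  rewrite /poisson_weight /exp_coeff/= exprMn -expRM_natr mulNr.
  by ring.
rewrite (_ : \sum_(0 <= k <oo) _ = (expR (m * expR (- s)))%:E).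
  by rewrite -EFinM -expRD; congr (expR _)%:E; ring.
apply/cvg_lim => //.
under eq_fun do rewrite sumEFin.
apply: cvg_EFin; first exact: nearW.
exact: is_cvg_series_exp_coeff.
Qed.

End poisson.

Section PPP.
Context (R : realType) d (T : measurableType d) (P : probability T R).
Variables (lam : R) (X : nat -> {RV P >-> R}).
Hypothesis lam0 : (0 < lam)%R.
Hypothesis PPPX : homogeneous_PPP lam X.
Local Notation leb := (@lebesgue_measure R).
Local Notation N := (point_count X).
Let m (A : set R) := (lam * fine (leb A))%R.

Let m0 A : (0 <= m A)%R.
Proof. by rewrite /m mulr_ge0 ?fine_ge0// ltW. Qed.

Lemma measurable_point_count A : measurable A -> measurable_fun setT (N A).
Proof.
move=> mA; apply: (@ge0_emeasurable_sum _ _ _ _ _ xpredT).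
  by move=> k x _ _; rewrite lee_fin.
move=> k _; apply/measurable_EFinP.
exact: (measurableT_comp (measurable_indic mA)).
Qed.

Lemma measurable_count_eq A (k : nat) : measurable A ->
  measurable [set w | N A w = k%:R%:E].
Proof.
move=> mA; rewrite -[X in measurable X]setTI.
exact: (measurable_point_count mA measurableT (emeasurable_set1 _)).
Qed.

Lemma PPP_count (A : set R) k : measurable A -> leb A < +oo ->
  P [set w | N A w = k%:R%:E] = (poisson_weight (m A) k)%:E.
Proof.
move=> mA Aoo.
have := PPPX (A := fun=> A) (fun _ : 'I_1 => k) (fun=> mA) (fun=> Aoo).
rewrite big_ord_recl big_ord0 mulr1 => <-; last first.
  by move=> i j _ _ _; rewrite !ord1.
by congr (P _); apply/seteqP; split => w /= h; [move=> _ //|exact: (h ord0)].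
Qed.

(** A set of finite length almost surely holds finitely many points: the Poisson weights add up to
    1, so the levels N A = k leave out only a null set. *)
Lemma integral_count_split (A : set R) (E : set T) (f : T -> \bar R) :
  measurable A -> leb A < +oo -> measurable E -> measurable_fun setT f ->
  (forall w, 0 <= f w) ->
  \int[P]_(w in E) f w =
  \sum_(0 <= k <oo) \int[P]_(w in E `&` [set w | N A w = k%:R%:E]) f w.
Proof.
move=> mA Aoo mE mf f0.
have mF k : measurable (E `&` [set w | N A w = k%:R%:E]).
  by apply: measurableI => //; exact: measurable_count_eq.
pose C := \bigcup_k [set w | N A w = k%:R%:E].
have mC : measurable C by apply: bigcup_measurable => k _; exact: measurable_count_eq.
have tC : trivIset setT (fun k => [set w | N A w = k%:R%:E]).
  move=> i j _ _ [w [/= -> /eqP]]; rewrite eqe eqr_nat => /eqP//.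
have PC : P (~` C) = 0.
  rewrite probability_setC// measure_bigcup//; last first.
    by move=> k _; exact: measurable_count_eq.
  rewrite (_ : \sum_(0 <= k <oo | _) _ = 1) ?subee//.
  have := poisson_series (m0 A) (lexx 0%R).
  rewrite oppr0 expR0 subrr mulr0 oppr0 expR0 => <-.
  rewrite (@eq_eseriesl _ _ xpredT); last by move=> k; rewrite in_setT.
  by apply: eq_eseriesr => k _; rewrite mul0r oppr0 expR0 mul1e; exact: PPP_count.
rewrite (@ge0_negligible_integral _ _ _ _ E (~` C))//; last 2 first.
- exact: measurableC.
- exact: measurable_funTS.
rewrite setDE setCK setI_bigcupr ge0_integral_bigcup//.
- exact: measurable_funTS.
- by apply: trivIset_setIl.
Qed.

Section levels.
Variables (A : nat -> set R) (s : nat -> R).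
Hypotheses (mA : forall l, measurable (A l)) (Aoo : forall l, leb (A l) < +oo).
Hypotheses (tA : trivIset setT A) (s0 : forall l, (0 <= s l)%R).

(** Interpolates between the joint law of the counts (j = 0, the definition of a PPP) and their
    joint Laplace transform (j = n). Each step splits on the count of [A j] and sums a Poisson
    series, while the sets of index at least j keep prescribed counts. *)
Lemma PPP_levels n j (k : nat -> nat) : (j <= n)%N ->
  \int[P]_(w in [set w | forall l, (j <= l < n)%N -> N (A l) w = (k l)%:R%:E])
    expeR (- \sum_(0 <= l < j) (s l)%:E * N (A l) w) =
  (\prod_(0 <= l < j) expR (- (m (A l) * (1 - expR (- s l)))) *
   \prod_(j <= l < n) poisson_weight (m (A l)) (k l))%:E.
Proof.
have mD i q : measurable [set w | forall l, (i <= l < n)%N -> N (A l) w = (q l)%:R%:E].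
  rewrite (_ : [set _ | _] = \bigcap_(l in [set l | (i <= l < n)%N])
    [set w | N (A l) w = (q l)%:R%:E]); last by [].
  by apply: bigcap_measurableType => l _; exact: measurable_count_eq.
elim: j k => [|j IHj] k jn.
  under eq_integral do rewrite big_nil oppe0 expeR0.
  rewrite big_nil mul1r integral_cst// mul1e big_mkord.
  rewrite -(PPPX (A := fun l : 'I_n => A l) (fun l : 'I_n => k l))//; last first.
    by move=> a b _ _ ab; apply: val_inj; exact: tA ab.
  congr (P _); apply/seteqP; split => w /= h l; first by apply: h => /=.
  by move=> ln; exact: (h (Ordinal ln)).
have mexp i : measurable_fun setT (fun w =>
    expeR (- \sum_(0 <= l < i) (s l)%:E * N (A l) w)).
  apply: (measurableT_comp measurable_expeR); apply: measurableT_comp => //.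
  apply: emeasurable_sum => l; apply: emeasurable_funM => //.
  exact: measurable_point_count.
rewrite (@integral_count_split (A j))//; last by move=> w; exact: expeR_ge0.
transitivity (\sum_(0 <= i <oo) ((expR (- (s j * i%:R)))%:E *
    (\prod_(0 <= l < j) expR (- (m (A l) * (1 - expR (- s l)))) *
     \prod_(j.+1 <= l < n) poisson_weight (m (A l)) (k l))%:E *
    (poisson_weight (m (A j)) i)%:E)).
  apply: eq_eseriesr => i _.
  (* Prescribing the value i for the count of [A j] gives an event of the induction hypothesis, with
     k altered at j. *)
  have -> : [set w | forall l, (j < l < n)%N -> N (A l) w = (k l)%:R%:E] `&`
      [set w | N (A j) w = i%:R%:E] = [set w | forall l, (j <= l < n)%N ->
        N (A l) w = (if l == j then i else k l)%:R%:E].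
    apply/seteqP; split => w /=.
      move=> [h1 h2] l; rewrite leq_eqVlt eq_sym.
      by case: eqVneq => [->//|_]; exact: h1.
    move=> h; split; last by have := h j; rewrite leqnn eqxx; exact.
    move=> l /andP[jl ln]; have := h l; rewrite (ltnW jl) ln gtn_eqF//; exact.
  transitivity ((expR (- (s j * i%:R)))%:E * \int[P]_(w in
      [set w | forall l, (j <= l < n)%N ->
        N (A l) w = (if l == j then i else k l)%:R%:E])
      expeR (- \sum_(0 <= l < j) (s l)%:E * N (A l) w)).
    rewrite -ge0_integralZl//; last 2 first.
    - exact: measurable_funTS.
    - by move=> w _; exact: expeR_ge0.
    apply: eq_integral => w; rewrite inE/= => /(_ j).
    rewrite leqnn jn eqxx => /(_ isT) Nj.
    rewrite big_nat_recr//= Nj fin_num_oppeD ?fin_numM//.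
    by rewrite expeRD muleC -EFinM.
  rewrite (IHj (fun l => if l == j then i else k l) (ltnW jn)) -!EFinM.
  congr EFin; rewrite (@big_ltn _ _ _ j)// eqxx.
  rewrite (_ : \prod_(j.+1 <= l < n) poisson_weight (m (A l)) (if l == j then i else k l)
             = \prod_(j.+1 <= l < n) poisson_weight (m (A l)) (k l))%R; first by ring.
  by apply: eq_big_nat => l /andP[jl _]; rewrite gtn_eqF.
under eq_eseriesr do rewrite muleAC muleC.
rewrite nneseriesZl; last first.
  by move=> i _; rewrite -EFinM lee_fin mulr_ge0 ?expR_ge0// poisson_weight_ge0.
rewrite poisson_series// -EFinM; congr EFin.
by rewrite big_nat_recr//= mulrAC.
Qed.

Let sum_levels n (c : nat -> R) (y : R) :
  \sum_(0 <= l < n) (c l * \1_(A l) y)%:E =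
  (\sum_(0 <= l < n) c l * \1_(A l) y)%R%:E.
Proof. by rewrite sumEFin. Qed.

(** By disjointness at most one indicator is nonzero at y, so 1 - exp acts on a single term. *)
Let one_sub_exp_levels n y :
  1 - expeR (- \sum_(0 <= l < n) (s l * \1_(A l) y)%:E) =
  \sum_(0 <= l < n) ((1 - expR (- s l)) * \1_(A l) y)%:E.
Proof.
rewrite !sum_levels -EFinN /= -EFinB; congr EFin.
elim: n => [|n IHn]; first by rewrite !big_nil oppr0 expR0 subrr.
rewrite !big_nat_recr//=; have [Any|Any] := boolP (y \in A n); last first.
  by rewrite indicE (negbTE Any) !mulr0 !addr0.
have -> : (\1_(A n) y = 1 :> R)%R by rewrite indicE Any.
rewrite !mulr1.
have z (c : nat -> R) : (\sum_(0 <= l < n) c l * \1_(A l) y)%R = 0%R.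
  rewrite big_nat big1// => l ln; rewrite indicE.
  have [Aly|] := boolP (y \in A l); last by rewrite mulr0.
  have := tA I I (ex_intro _ y (conj (set_mem Aly) (set_mem Any))).
  by move=> e; rewrite e ltnn andbF in ln.
by rewrite !z !add0r.
Qed.

(** The Laplace functional of a step function carried by the first n sets, jointly with the count of
    [A n]; the latter is disjoint from them and contributes an independent Poisson factor. *)
Lemma PPP_laplace_levels n (k : nat) :
  \int[P]_(w in [set w | N (A n) w = k%:R%:E])
    expeR (- \sum_(0 <= j <oo) \sum_(0 <= l < n) (s l * \1_(A l) (X j w))%:E) =
  (poisson_weight (m (A n)) k)%:E *
  expeR (- (lam%:E * \int[leb]_y
    (1 - expeR (- \sum_(0 <= l < n) (s l * \1_(A l) y)%:E)))).
Proof.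
have es0 l : (0 <= 1 - expR (- s l))%R.
  by rewrite subr_ge0 -expR0 ler_expR oppr_le0.
transitivity (\int[P]_(w in [set w | forall l, (n <= l < n.+1)%N ->
      N (A l) w = ((fun=> k) l)%:R%:E])
    expeR (- \sum_(0 <= l < n) (s l)%:E * N (A l) w)).
  rewrite (_ : [set w | N (A n) w = k%:R%:E] = [set w | forall l,
      (n <= l < n.+1)%N -> N (A l) w = ((fun=> k) l)%:R%:E]); last first.
    apply/seteqP; split => w /= h; last by apply: h; rewrite leqnn ltnSn.
    by move=> l; rewrite ltnS -eqn_leq => /eqP <-.
  apply: eq_integral => w _; rewrite nneseries_sum_nat; last first.
    by move=> i j; rewrite lee_fin mulr_ge0.
  congr (expeR (- _)); apply: eq_bigr => l _.
  rewrite -nneseriesZl; last by move=> j _; rewrite lee_fin.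
  by apply: eq_eseriesr => j _; rewrite EFinM.
rewrite PPP_levels// big_nat1 mulrC EFinM; congr (_ * _).
under eq_integral do rewrite one_sub_exp_levels.
rewrite ge0_integral_sum//; last 2 first.
- by move=> l; exact: (@measurable_scaled_indic _ (measurableTypeR R) _ _ _ (mA l)).
- by move=> l y _; rewrite lee_fin mulr_ge0.
have intA l : \int[leb]_y ((1 - expR (- s l)) * \1_(A l) y)%:E =
    ((1 - expR (- s l)) * fine (leb (A l)))%:E.
  rewrite (@integral_scaled_indic _ (measurableTypeR R))//; last exact: mA.
  by rewrite EFinM fineK// ge0_fin_numE.
rewrite (eq_bigr _ (fun l _ => intA l)) sumEFin -EFinM -EFinN/= -expR_sum; congr (expR _)%:E.
rewrite mulr_sumr -sumrN; apply: eq_bigr => l _.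
by rewrite /m; ring.
Qed.

End levels.

(** Simple functions increasing to phi reduce this to finitely many level sets. The left side
    converges by dominated convergence, the exponent on the right by monotone convergence. *)
Lemma PPP_laplace (B : set R) (k : nat) (phi : R -> \bar R) :
  measurable B -> leb B < +oo -> measurable_fun setT phi ->
  (forall y, 0 <= phi y) -> (forall y, B y -> phi y = 0) ->
  \int[P]_(w in [set w | N B w = k%:R%:E])
    expeR (- \sum_(0 <= j <oo) phi (X j w)) =
  (poisson_weight (m B) k)%:E *
  expeR (- (lam%:E * \int[leb]_y (1 - expeR (- phi y)))).
Proof.
move=> mB Boo mphi phi0 phiB.
pose f n := nnsfun_approx measurableT mphi n.
(* The window gives every level set finite length, as the law of the counts requires. Removing B
   keeps the levels disjoint from it, and changes nothing in the limit as phi vanishes on B. *)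
pose D n : set R := `[(- n%:R)%R, n%:R] `\` B.
have mD n : measurable (D n) by apply: measurableD.
have Doo n : leb (D n) < +oo.
  apply: (@le_lt_trans _ _ (leb `[(- n%:R)%R, n%:R])).
    apply: le_measure; rewrite ?inE; last exact: subDsetl.
      exact: mD.
    exact: measurable_itv.
  rewrite lebesgue_measure_itv/=; case: ifP => _; last by rewrite ltry.
  by rewrite -EFinB ltry.
pose u n y := (f n y * \1_(D n) y)%:E.
have u0 n y : 0 <= u n y by rewrite lee_fin mulr_ge0.
have mu n : measurable_fun setT (u n).
  apply/measurable_EFinP; apply: measurable_funM; last exact: (measurable_indic (mD n)).
  exact: measurable_funPT.
have ndu y : nondecreasing_seq (u ^~ y).
  move=> a b ab; rewrite lee_fin ler_pM//.
    exact/lefP/nd_nnsfun_approx.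
  rewrite !indicE ler_nat; case: (boolP (y \in D a)) => // /set_mem[ya nBy].
  rewrite mem_set//; split => //; move: ya; rewrite /= !in_itv/= => /andP[h1 h2].
  rewrite (le_trans _ h1) ?lerN2 ?ler_nat// (le_trans h2)// ler_nat//.
have cvu y : u n y @[n --> \oo] --> phi y.
  have [By|nBy] := pselect (B y).
    rewrite phiB//; apply: cvg_near_cst; apply: nearW => n.
    by rewrite /u indicE memNset ?mulr0//; case.
  have : (f n y)%:E @[n --> \oo] --> phi y by exact: cvg_nnsfun_approx.
  apply: cvg_trans; apply: near_eq_cvg; near=> n.
  rewrite /u indicE mem_set ?mulr1//; split => //=; rewrite in_itv/= -ler_norml.
  by near: n; exact: nbhs_infty_ger.
have step n : \int[P]_(w in [set w | N B w = k%:R%:E])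
      expeR (- \sum_(0 <= j <oo) u n (X j w)) =
    (poisson_weight (m B) k)%:E *
    expeR (- (lam%:E * \int[leb]_y (1 - expeR (- u n y)))).
  pose r : seq R := finmap.enum_fset (fset_set (range (f n))).
  (* The values of the simple function come first, index [size r] carries B, the set with prescribed
     count, and the remaining indices are padded with the empty set. *)
  pose A l := if (l < size r)%N then D n `&` f n @^-1` [set r`_l]%R
              else if l == size r then B else set0.
  have uE y : u n y = \sum_(0 <= l < size r) (r`_l%R * \1_(A l) y)%:E.
    rewrite sumEFin; congr EFin; rewrite fimfunE fsbig_finite//=.
    rewrite -/r mulr_suml (big_nth 0%R) big_nat [RHS]big_nat.
    apply: eq_bigr => l /andP[_ ln]; rewrite /A ln -mulrA; congr (_ * _)%R.
    by rewrite indicI mulrC.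
  have mf y : measurable (f n @^-1` [set y]).
    by rewrite -[X in measurable X]setTI; apply: (measurable_funPT (f n)).
  have mA l : measurable (A l).
    rewrite /A; case: ifP => _; last by case: ifP.
    exact: measurableI.
  have Aoo l : leb (A l) < +oo.
    rewrite /A; case: ifP => _; last by case: ifP => // _; rewrite measure0.
    apply: le_lt_trans (Doo n); apply: le_measure; rewrite ?inE.
    - by apply: measurableI; [exact: mD|exact: mf].
    - exact: mD.
    - exact: subIsetl.
  have tA : trivIset setT A.
    move=> i j _ _ [y []]; rewrite /A.
    have [ir|ir] := ltnP i (size r); have [jr|jr] := ltnP j (size r).
    - move=> [_ /= fi] [_ /= fj]; apply/eqP.
      have ur : uniq r by exact: finmap.fset_uniq.
      by rewrite -(nth_uniq 0%R ir jr ur) -fi -fj.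
    - by move=> [Dy _]; case: ifP => // _ By; case: Dy => _ /(_ By).
    - by case: ifP => // _ By [Dy _]; case: Dy => _ /(_ By).
    - by case: eqP => // -> _; case: eqP.
  have s0 l : (0 <= r`_l)%R.
    have [lr|lr] := ltnP l (size r); last by rewrite nth_default.
    have : r`_l%R \in r by exact: mem_nth.
    by rewrite in_fset_set// inE => -[t _ <-].
  have := PPP_laplace_levels mA Aoo tA s0 (size r) k.
  have -> : A (size r) = B by rewrite /A ltnn eqxx.
  by rewrite (_ : u n = fun y => \sum_(0 <= l < size r) (r`_l%R * \1_(A l) y)%:E);
    last exact/funext.
have lhs : \int[P]_(w in [set w | N B w = k%:R%:E])
    expeR (- \sum_(0 <= j <oo) u n (X j w)) @[n --> \oo] -->
  \int[P]_(w in [set w | N B w = k%:R%:E])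
    expeR (- \sum_(0 <= j <oo) phi (X j w)).
  apply: integral_expeRN_cvg.
  - exact: measurable_count_eq.
  - move=> n; apply: (@ge0_emeasurable_sum _ _ _ _ _ xpredT).
      by move=> j w _ _; exact: u0.
    by move=> j _; exact: (measurableT_comp (mu n)).
  - by move=> n w; apply: nneseries_ge0 => j _ _; exact: u0.
  - by move=> w; apply: cvg_nneseries_monotone.
suff rhs : (poisson_weight (m B) k)%:E *
    expeR (- (lam%:E * \int[leb]_y (1 - expeR (- u n y)))) @[n --> \oo] -->
  (poisson_weight (m B) k)%:E *
    expeR (- (lam%:E * \int[leb]_y (1 - expeR (- phi y)))).
  by rewrite -(eq_cvg _ _ step) in rhs; exact: (cvg_unique _ lhs rhs).
apply: cvgeZl => //; apply: cvg_expeRN.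
  move=> n; apply: mule_ge0; first by rewrite lee_fin ltW.
  apply: integral_ge0 => y _.
  by rewrite sube_ge0 ?expeRN_ge0_le1// expeRN_fin_num.
apply: cvgeZl => //.
have cg y : 1 - expeR (- u n y) @[n --> \oo] --> 1 - expeR (- phi y).
  by apply: cvgeB; [exact: fin_num_adde_defr|exact: cvg_cst|exact: cvg_expeRN].
rewrite (_ : (fun y => 1 - expeR (- phi y)) =
    fun y => limn (fun n => 1 - expeR (- u n y))); last first.
  by apply: funext => y; apply/esym/cvg_lim => //; exact: cg.
apply: cvg_monotone_convergence => //.
- move=> n; apply: emeasurable_funB; first exact: measurable_cst.
  by apply: measurable_expeRN; exact: (mu n).
- by move=> n y _; rewrite sube_ge0 ?expeRN_ge0_le1// expeRN_fin_num.
- move=> y _ a b ab; apply: leeB => //.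
  by rewrite lee_expeR leeN2; exact: ndu.
Unshelve. all: by end_near. Qed.

End PPP.

(** * Campbell-Mecke formula for monotone weights *)

Section campbell.
Context (R : realType) d (T : measurableType d) (P : probability T R).
Variables (lam : R) (X : nat -> {RV P >-> R}) (c : R -> R) (Phi : R -> R -> \bar R).
Local Notation leb := (@lebesgue_measure R).
Local Notation N := (point_count X).

Definition point_weight i w : \bar R :=
  (c (X i w))%:E * expeR (- \sum_(0 <= j <oo | j != i) Phi (X i w) (X j w)).

Definition campbell_sum (B : set R) : \bar R :=
  \sum_(0 <= i <oo) \int[P]_(w in X i @^-1` B) point_weight i w.

(** By the Laplace functional, exp (- lam * void_exponent x) is the expectation of exp (- sum_j Phi
    x (X j)), the serving position being held at x. *)
Definition void_exponent x : \bar R := \int[leb]_y (1 - expeR (- Phi x y)).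

Definition palm_density x : R :=
  (lam * c x * fine (expeR (- (lam%:E * void_exponent x))))%R.

Hypothesis c0 : forall x, (0 <= c x)%R.
Hypothesis Phi0 : forall x y, 0 <= Phi x y.
Hypothesis mc : measurable_fun setT c.
Hypothesis mPhi : forall i j, measurable_fun setT (fun w => Phi (X i w) (X j w)).
Hypothesis mPhir : forall x, measurable_fun setT (Phi x).

Lemma point_weight_ge0 i w : 0 <= point_weight i w.
Proof. by rewrite mule_ge0 ?lee_fin ?expeR_ge0. Qed.

Lemma measurable_point_weight i : measurable_fun setT (point_weight i).
Proof.
apply: emeasurable_funM.
  by apply/measurable_EFinP; exact: (measurableT_comp mc).
apply: measurable_expeRN; apply: (@ge0_emeasurable_sum _ _ _ _ _ (predC1 i)).
  by move=> j w _ _; exact: Phi0.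
by move=> j _; exact: mPhi.
Qed.

Let mXB i (B : set R) : measurable B -> measurable (X i @^-1` B).
Proof. by move=> mB; exact: measurable_funPTI. Qed.

Lemma campbell_sumE B : measurable B -> campbell_sum B =
  \int[P]_w \sum_(0 <= i <oo) (\1_B (X i w))%:E * point_weight i w.
Proof.
move=> mB; rewrite integral_nneseries//; last 2 first.
- move=> i; apply: emeasurable_funM; last exact: measurable_point_weight.
  by apply/measurable_EFinP; exact: (measurableT_comp (measurable_indic mB)).
- by move=> i w _; rewrite mule_ge0 ?lee_fin ?point_weight_ge0.
apply: eq_eseriesr => i _; rewrite [LHS]integral_mkcond; apply: eq_integral => w _.
by rewrite epatch_indic muleC.
Qed.

Lemma campbell_sumU A B : measurable A -> measurable B -> [disjoint A & B] ->
  campbell_sum (A `|` B) = campbell_sum A + campbell_sum B.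
Proof.
move=> mA mB AB; rewrite -nneseriesD; last 2 first.
- by move=> i _ _; apply: integral_ge0 => w _; exact: point_weight_ge0.
- by move=> i _ _; apply: integral_ge0 => w _; exact: point_weight_ge0.
apply: eq_eseriesr => i _; rewrite preimage_setU ge0_integral_setU//.
- exact: mXB.
- exact: mXB.
- by apply: measurable_funTS; exact: measurable_point_weight.
- by move=> w _; exact: point_weight_ge0.
- move/disj_set2P : AB => AB; apply/disj_set2P.
  by rewrite -preimage_setI AB preimage_set0.
Qed.

Lemma campbell_sum_cvg (D : nat -> set R) : (forall n, measurable (D n)) ->
  nondecreasing_seq D ->
  campbell_sum (D n) @[n --> \oo] --> campbell_sum (\bigcup_n D n).
Proof.
move=> mD ndD.
have ndXD i : nondecreasing_seq (fun n => X i @^-1` D n).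
  by move=> m n mn; apply/subsetPset => w; apply: (subsetPset _ _ (ndD _ _ mn)).
apply: cvg_nneseries_monotone.
- by move=> n i; apply: integral_ge0 => w _; exact: point_weight_ge0.
- move=> i; apply: ge0_nondecreasing_set_nondecreasing_integral => //.
  + by move=> n; exact: mXB.
  + by move=> n; apply: measurable_funTS; exact: measurable_point_weight.
  + by move=> n w _; exact: point_weight_ge0.
- move=> i; rewrite preimage_bigcup.
  apply: ge0_nondecreasing_set_cvg_integral => //.
  + by move=> n; exact: mXB.
  + by move=> n; apply: measurable_funTS; exact: measurable_point_weight.
  + by move=> n w _; exact: point_weight_ge0.
Qed.

Lemma point_weight_excluded i j w : j != i -> Phi (X i w) (X j w) = +oo ->
  point_weight i w = 0.
Proof.
move=> ji Pij; rewrite /point_weight (@nneseries_pinfty _ _ _ j)//=.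
by rewrite mule0.
Qed.

Hypothesis lam0 : (0 < lam)%R.
Hypothesis PPPX : homogeneous_PPP lam X.

Lemma void_exponent_ge0 x : 0 <= void_exponent x.
Proof.
apply: integral_ge0 => y _.
by rewrite sube_ge0 ?expeRN_ge0_le1// expeRN_fin_num.
Qed.

Lemma palm_density_ge0 x : (0 <= palm_density x)%R.
Proof. by rewrite /palm_density !mulr_ge0 ?fine_ge0 ?expeR_ge0// ltW. Qed.

Lemma palm_densityE x : (palm_density x)%:E =
  (lam * c x)%:E * expeR (- (lam%:E * void_exponent x)).
Proof.
rewrite /palm_density EFinM fineK// expeRN_fin_num//.
by rewrite mule_ge0 ?lee_fin ?void_exponent_ge0// ltW.
Qed.

(** S will be a region of constant type on the positive half-line. Monotonicity is asked for serving
    positions in S only; the other station z ranges over the whole line. *)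
Variable S : set R.
Hypothesis c_anti : forall x y, S x -> S y -> (x <= y)%R -> (c y <= c x)%R.
Hypothesis Phi_mono : forall x y z, S x -> S y -> (x <= y)%R -> Phi x z <= Phi y z.
Hypothesis Phi_excl : forall x y, S x -> S y -> (y <= x)%R -> Phi x y = +oo.

Lemma palm_density_anti x y : S x -> S y -> (x <= y)%R ->
  (palm_density y <= palm_density x)%R.
Proof.
move=> Sx Sy xy; rewrite -lee_fin !palm_densityE.
apply: lee_pmul; rewrite ?lee_fin ?expeR_ge0//.
- by rewrite mulr_ge0// ltW.
- by rewrite ler_pM2l// c_anti.
rewrite lee_expeR leeN2 lee_pmul2l//.
apply: ge0_le_integral => //.
- by move=> z _; rewrite sube_ge0 ?expeRN_ge0_le1// expeRN_fin_num.
- by apply: emeasurable_funB => //; apply: measurable_expeRN; exact: mPhir.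
- by apply: emeasurable_funB => //; apply: measurable_expeRN; exact: mPhir.
- by move=> z _; rewrite leeB// lee_expeR leeN2 Phi_mono.
Qed.

Section cell.
Variables a b : R.
Hypothesis ab : (a <= b)%R.
Hypothesis abS : forall x, (a <= x <= b)%R -> S x.
Let B : set R := `]a, b].
Let h := (b - a)%R.

Let mB : measurable B.
Proof. exact: measurable_itv. Qed.

Let lebB : leb B = h%:E.
Proof.
rewrite lebesgue_measure_itv/= lte_fin; have [ab1|ba] := ltP a b.
  by rewrite EFinB.
by congr EFin; rewrite /h; apply/esym/eqP; rewrite subr_eq0 eq_le ab ba.
Qed.

Let Sa : S a. Proof. by apply: abS; rewrite lexx. Qed.
Let Sb : S b. Proof. by apply: abS; rewrite lexx andbT. Qed.
Let SB x : B x -> S x.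
Proof. by rewrite /B/= in_itv/= => /andP[/ltW ax xb]; apply: abS; rewrite ax. Qed.

(** Erasing A from f leaves a functional of the stations outside A, whose Laplace transform is known
    jointly with the count of A. *)
Definition off (A : set R) (f : R -> \bar R) y := if y \in A then 0 else f y.

Let off_ge0 x y : 0 <= off B (Phi x) y.
Proof. by rewrite /off; case: ifP. Qed.

Let moff x : measurable_fun setT (off B (Phi x)).
Proof.
apply: measurable_fun_ifT => //.
by apply: (measurable_fun_bool true); rewrite setTI preimage_mem_true.
Qed.

Let avoid x w := expeR (- \sum_(0 <= j <oo) off B (Phi x) (X j w)).

Let mavoid x : measurable_fun setT (avoid x).
Proof.
apply: measurable_expeRN; apply: (@ge0_emeasurable_sum _ _ _ _ _ xpredT).
  by move=> j w _ _; exact: off_ge0.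
by move=> j _; exact: (measurableT_comp (moff x)).
Qed.

Let avoid_laplace x k : \int[P]_(w in [set w | N B w = k%:R%:E]) avoid x w =
  (poisson_weight (lam * h) k)%:E *
  expeR (- (lam%:E * \int[leb]_y (1 - expeR (- off B (Phi x) y)))).
Proof.
rewrite /avoid (PPP_laplace lam0 PPPX)//; last 2 first.
- by rewrite lebB ltry.
- by move=> y By; rewrite /off mem_set.
by rewrite lebB.
Qed.

(* The two void exponents differ by at most h, since 1 - exp(- Phi) is at most 1. *)
Let off_exponent x :
  \int[leb]_y (1 - expeR (- off B (Phi x) y)) <= void_exponent x <=
  \int[leb]_y (1 - expeR (- off B (Phi x) y)) + h%:E.
Proof.
have off0 y : 0 <= 1 - expeR (- off B (Phi x) y).
  by rewrite sube_ge0 ?expeRN_ge0_le1// expeRN_fin_num.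
have moff1 : measurable_fun setT (fun y => 1 - expeR (- off B (Phi x) y)).
  by apply: emeasurable_funB => //; apply: measurable_expeRN.
have mPhi1 : measurable_fun setT (fun y => 1 - expeR (- Phi x y)).
  by apply: emeasurable_funB => //; apply: measurable_expeRN.
have Phi1 y : 0 <= 1 - expeR (- Phi x y).
  by rewrite sube_ge0 ?expeRN_ge0_le1// expeRN_fin_num.
apply/andP; split.
  apply: ge0_le_integral => // y _; rewrite leeB// lee_expeR leeN2 /off.
  by case: ifP.
have -> : h%:E = \int[leb]_y (\1_B y)%:E 
  by rewrite (@integral_indic _ (measurableTypeR R))// setIT; exact/esym/lebB.
have mI : measurable_fun setT (fun y => (\1_B y)%:E : \bar R).
  by apply/measurable_EFinP; exact: measurable_indic.
rewrite -ge0_integralD//.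
apply: ge0_le_integral => //.
- exact: emeasurable_funD.
- move=> y _; rewrite /off indicE; case: (y \in B); last by rewrite adde0.
  rewrite oppe0 expeR0 subee// add0e leeBlDr ?expeRN_fin_num//.
  by rewrite leeDl ?expeR_ge0.
Qed.

(** The gap of at most h between the exponents becomes a factor exp (lam * h). The two exponents are
    infinite together, and then every term vanishes. *)
Let off_density x :
  (lam * c x)%:E * expeR (- (lam%:E * \int[leb]_y (1 - expeR (- off B (Phi x) y))))
    <= (palm_density x)%:E * (expR (lam * h))%:E /\
  (palm_density x)%:E <=
  (lam * c x)%:E * expeR (- (lam%:E * \int[leb]_y (1 - expeR (- off B (Phi x) y)))).
Proof.
have /andP[] := off_exponent x.
have e0 : 0 <= \int[leb]_y (1 - expeR (- off B (Phi x) y)).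
  by apply: integral_ge0 => y _; rewrite sube_ge0 ?expeRN_ge0_le1// expeRN_fin_num.
move: (\int[leb]_y _) e0 => e e0 h1 h2; rewrite palm_densityE; split; last first.
  apply: lee_pmul => //; rewrite ?lee_fin ?mulr_ge0 ?expeR_ge0 ?(ltW lam0)//.
  by rewrite lee_expeR leeN2 lee_pmul2l.
rewrite -muleA; apply: lee_pmul => //; rewrite ?expeR_ge0// ?lee_fin.
  by rewrite mulr_ge0// ltW.
rewrite -[(expR _)%:E]/(expeR (lam * h)%:E) -expeRD lee_expeR.
case: e e0 h1 h2 => [e| |]// e0; last first.
  by rewrite leye_eq => /eqP -> _; rewrite gt0_muley ?lte_fin//= leNye.
case: (void_exponent x) => [v ev ve|_ |]; last by rewrite leeNy_eq.
  2: by rewrite -EFinD leye_eq.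
rewrite -!EFinM -!EFinN -EFinD lee_fin; move: ve; rewrite -EFinD lee_fin => ve.
by rewrite lerNl opprD opprK lerBlDr -mulrDr ler_pM2l.
Qed.

(** The cell is empty with probability exp (- lam * h), independently of the outside, so the
    complement carries the factor 1 - exp (- lam * h) <= lam * h. *)
Let integral_not_empty x :
  \int[P]_(w in ~` [set w | N B w = 0]) avoid x w <=
  (lam * h)%:E * expeR (- (lam%:E * \int[leb]_y (1 - expeR (- off B (Phi x) y)))).
Proof.
have mE : measurable [set w | N B w = 0].
  by have := measurable_count_eq X 0 mB; exact.
have tot : \int[P]_w avoid x w =
    expeR (- (lam%:E * \int[leb]_y (1 - expeR (- off B (Phi x) y)))).
  (* The unrestricted expectation is the Laplace functional with the empty set in place of B and
     count 0. *)
  have := PPP_laplace lam0 PPPX 0 measurable0 _ (moff x) (off_ge0 x).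
  rewrite (_ : [set w | N set0 w = 0] = setT) => [->//|].
  - by rewrite measure0 mulr0 /poisson_weight expr0 fact0 divr1 oppr0 expR0 !mul1r mul1e.
  - by rewrite measure0.
  - apply/seteqP; split => // w _; rewrite /= /point_count eseries0// => j _ _.
    by rewrite indicE in_set0.
have : \int[P]_w avoid x w = \int[P]_(w in [set w | N B w = 0]) avoid x w +
    \int[P]_(w in ~` [set w | N B w = 0]) avoid x w.
  rewrite -{1}(setUv [set w | N B w = 0]) ge0_integral_setU//.
  - exact: measurableC.
  - by rewrite setUv; exact: mavoid.
  - by move=> w _; exact: expeR_ge0.
  - by apply/disj_set2P; rewrite setICr.
have := avoid_laplace x 0; rewrite -[0%R%:E]/(0 : \bar R) => ->; rewrite tot.
rewrite /poisson_weight expr0 fact0 divr1 mul1r.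
move: (integral P (~` _) _) => I.
set e := lam%:E * _.
have e0 : 0 <= e.
  rewrite mule_ge0 ?lee_fin ?(ltW lam0)//; apply: integral_ge0 => y _.
  by rewrite sube_ge0 ?expeRN_ge0_le1// expeRN_fin_num.
rewrite -(fineK (expeRN_fin_num e0)); move: (fine _) (fine_ge0 (expeR_ge0 (- e))).
move=> E E0; case: I => [I| |]//; rewrite -!EFinM -?EFinD.
move=> [EI]; rewrite lee_fin.
have := expR_ge1Dx (- (lam * h))%R.
by move=> /(ler_wpM2r E0); lra.
Qed.

(* At most one point of B contributes to the sum; its weight is largest at the
   left end a, and the points in B only decrease the exponential. *)
Lemma campbell_sum_le :
  campbell_sum B <= (palm_density a * h * expR (lam * h))%:E.
Proof.
rewrite campbell_sumE//.
have mE : measurable [set w | N B w = 0].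
  by have := measurable_count_eq X 0 mB; exact.
apply: (@le_trans _ _ (\int[P]_(w in ~` [set w | N B w = 0]) ((c a)%:E * avoid a w))).
  rewrite [leRHS]integral_mkcond; apply: ge0_le_integral => //.
  - move=> w _; apply: nneseries_ge0 => i _ _.
    by rewrite mule_ge0 ?lee_fin ?point_weight_ge0.
  - apply: (@ge0_emeasurable_sum _ _ _ _ _ xpredT).
      by move=> i w _ _; rewrite mule_ge0 ?lee_fin ?point_weight_ge0.
    move=> i _; apply: emeasurable_funM; last exact: measurable_point_weight.
    by apply/measurable_EFinP; exact: (measurableT_comp (measurable_indic mB)).
  - apply/(measurable_restrictT _ _).1; first exact: measurableC.
    by apply: measurable_funTS; apply: emeasurable_funM.
  move=> w _.
  have [[i [Bi wi0]]|no] := pselect (exists i, B (X i w) /\ point_weight i w != 0);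
      last first.
    rewrite eseries0 => [|i _ _].
      by rewrite patchE; case: ifP => // _; rewrite mule_ge0 ?lee_fin ?expeR_ge0.
    have [Bi|Bi] := boolP (X i w \in B); last by rewrite indicE (negbTE Bi) mul0e.
    have [->|wi] := eqVneq (point_weight i w) 0; first by rewrite mule0.
    by exfalso; apply: no; exists i; split => //; exact: set_mem.
  have only j : j != i -> (\1_B (X j w))%:E * point_weight j w = 0.
    move=> ji; have [/set_mem Bj|Bj] := boolP (X j w \in B); last first.
      by rewrite indicE (negbTE Bj) mul0e.
    rewrite (@point_weight_excluded j i) ?mule0 1?eq_sym//.
    apply: Phi_excl; [exact: SB|exact: SB|].
    (* A point [X j] to the left of [X i] would exclude [X i], against its nonzero weight; hence
       [X j] is the point excluded by the other. *)
    rewrite leNgt; apply/negP => /ltW ji'; move/eqP: wi0; apply.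
    by apply: (@point_weight_excluded i j) => //; apply: Phi_excl => //; exact: SB.
  rewrite (@nneseriesD1 _ _ i)//; last first.
    by move=> k _; rewrite mule_ge0 ?lee_fin ?point_weight_ge0.
  rewrite eseries0 ?adde0; last by move=> k _; exact: only.
  rewrite indicE mem_set// mul1e patchE ifT; last first.
    rewrite inE/= => N0.
    have := @nneseriesD1 R (fun i => (\1_B (X i w))%:E) i xpredT.
    rewrite -[\sum_(0 <= k <oo) _]/(N B w) N0 indicE mem_set// => /(_ _ isT) h1.
    have /eqP : 0 = 1 + \sum_(0 <= k <oo | predC1 i k) (\1_B (X k w))%:E :> \bar R.
      by apply: h1 => k _; rewrite lee_fin.
    rewrite lt_eqF// (@lt_le_trans _ _ 1)// leeDl//.
    by apply: nneseries_ge0 => k _ _; rewrite lee_fin.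
  rewrite /point_weight; apply: lee_pmul; rewrite ?lee_fin ?expeR_ge0//.
    apply: c_anti => //; first exact: SB.
    by move: Bi; rewrite /B/= in_itv/= => /andP[/ltW].
  rewrite lee_expeR leeN2 (@nneseriesD1 _ _ i)//= {1}/off mem_set// add0e.
  apply: lee_nneseries => // j _; rewrite /off; case: ifP => // _.
  apply: Phi_mono => //; first exact: SB.
  by move: Bi; rewrite /B/= in_itv/= => /andP[/ltW].
rewrite ge0_integralZl//; last 4 first.
- exact: measurableC.
- exact: measurable_funTS.
- by move=> w _; exact: expeR_ge0.
- by rewrite lee_fin.
apply: le_trans (lee_wpmul2l _ (integral_not_empty a)) _; first by rewrite lee_fin.
have [+ _] := off_density a.
have h0 : (0 <= h)%R by rewrite subr_ge0.
move=> /(lee_wpmul2l (_ : 0 <= h%:E)); rewrite lee_fin => /(_ h0).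
by rewrite !muleA -!EFinM (mulrCA (c a)) mulrA (mulrC h) (mulrC (palm_density a)) mulrAC.
Qed.

(* Only the event that B holds exactly one point is kept. *)
Lemma campbell_sum_ge :
  (palm_density b * h * expR (- (lam * h)))%:E <= campbell_sum B.
Proof.
rewrite campbell_sumE//.
have h0 : (0 <= h)%R by rewrite subr_ge0.
have mE : measurable [set w | N B w = 1%:R%:E] by exact: measurable_count_eq.
apply: (@le_trans _ _ (\int[P]_(w in [set w | N B w = 1%:R%:E]) ((c b)%:E * avoid b w))).
  rewrite ge0_integralZl//; last 3 first.
  - exact: measurable_funTS.
  - by move=> w _; exact: expeR_ge0.
  - by rewrite lee_fin.
  rewrite avoid_laplace /poisson_weight expr1 (_ : 1`! = 1)%N// divr1.
  have [_ ] := off_density b.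
  move=> /(lee_wpmul2l (_ : 0 <= (h * expR (- (lam * h)))%:E)).
  rewrite lee_fin mulr_ge0 ?expR_ge0// => /(_ isT); rewrite -EFinM.
  rewrite !muleA -!EFinM.
  rewrite (_ : h * expR (- (lam * h)) * palm_density b =
    palm_density b * h * expR (- (lam * h)))%R; last by ring.
  rewrite (_ : h * expR (- (lam * h)) * (lam * c b) =
    c b * (lam * h * expR (- (lam * h))))%R; last by ring.
  exact.
rewrite integral_mkcond; apply: ge0_le_integral => //.
- by move=> w _; rewrite patchE; case: ifP => // _; rewrite mule_ge0 ?lee_fin ?expeR_ge0.
- by apply/(measurable_restrictT _ _).1 => //; apply: measurable_funTS; apply: emeasurable_funM.
- apply: (@ge0_emeasurable_sum _ _ _ _ _ xpredT).
    by move=> i w _ _; rewrite mule_ge0 ?lee_fin ?point_weight_ge0.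
  move=> i _; apply: emeasurable_funM; last exact: measurable_point_weight.
  by apply/measurable_EFinP; exact: (measurableT_comp (measurable_indic mB)).
move=> w _; rewrite patchE; case: ifPn => [|_]; last first.
  by apply: nneseries_ge0 => i _ _; rewrite mule_ge0 ?lee_fin ?point_weight_ge0.
rewrite inE/= => N1.
have I0 k : 0 <= (\1_B (X k w))%:E :> \bar R by rewrite lee_fin.
have [i Bi] : exists i, B (X i w).
  apply: contrapT => no; move: N1; rewrite /point_count eseries0.
    by move=> [] /eqP; rewrite eq_sym oner_eq0.
  by move=> k _ _; rewrite indicE memNset// => Bk; apply: no; exists k.
have only j : j != i -> X j w \notin B.
  move=> ji; apply/negP => /set_mem Bj.
  move: N1; rewrite /point_count (@nneseriesD1 _ _ i)// (@nneseriesD1 _ _ j)//=.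
  rewrite !indicE !mem_set//.
  have := @nneseries_ge0 R (fun k => (\1_B (X k w))%:E)
     (fun k => true && (k != i) && (k != j)) 0 (fun k _ _ => I0 k).
  case: (\sum_(0 <= k <oo | _) _) => [r| |]//; rewrite lee_fin => r0 [].
  by move: r0; lra.
rewrite (@nneseriesD1 _ _ i)//; last first.
  by move=> k _; rewrite mule_ge0 ?lee_fin ?point_weight_ge0.
rewrite indicE mem_set// mul1e.
have xb : (X i w <= b)%R by move: Bi; rewrite /B/= in_itv/= => /andP[].
apply: (@le_trans _ _ (point_weight i w)); last first.
  rewrite leeDl//; apply: nneseries_ge0 => k _ _.
  by rewrite mule_ge0 ?lee_fin ?point_weight_ge0.
rewrite /point_weight; apply: lee_pmul; rewrite ?lee_fin ?expeR_ge0//.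
  by apply: c_anti => //; exact: SB.
rewrite lee_expeR leeN2 [leRHS](@nneseriesD1 _ _ i)//= {1}/off mem_set// add0e.
apply: lee_nneseries => // j ji; rewrite /off (negbTE (only j ji)).
by apply: Phi_mono => //; exact: SB.
Qed.

End cell.
End campbell.

(* On the subdivision of ]a, b] into n + 1 equal cells the two Riemann sums
   telescope: they differ by O(1/n). *)
Lemma sandwiched_le (R : realType) (G1 G2 : R -> R -> \bar R) (rho : R -> R)
    (lam a b : R) : (a <= b)%R -> (forall x, (0 <= rho x)%R) ->
  (forall x y z, (a <= x)%R -> (x <= y)%R -> (y <= z)%R -> (z <= b)%R ->
     G1 x z = G1 x y + G1 y z) ->
  (forall x y z, (a <= x)%R -> (x <= y)%R -> (y <= z)%R -> (z <= b)%R ->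
     G2 x z = G2 x y + G2 y z) ->
  (forall x y, (a <= x)%R -> (x <= y)%R -> (y <= b)%R ->
     G1 x y <= (rho x * (y - x) * expR (lam * (y - x)))%:E) ->
  (forall x y, (a <= x)%R -> (x <= y)%R -> (y <= b)%R ->
     (rho y * (y - x) * expR (- (lam * (y - x))))%:E <= G2 x y) ->
  G1 a b <= G2 a b.
Proof.
move=> ab rho0 G1D G2D G1le G2ge.
pose h n : R := ((b - a) * harmonic n)%R.
have h0 n : (0 <= h n)%R by rewrite mulr_ge0 ?subr_ge0 ?harmonic_ge0.
have hn n : (a + n.+1%:R * h n = b)%R.
  by rewrite /h /harmonic/= mulrCA mulfV ?pnatr_eq0// mulr1 addrC subrK.
have bound n i : (i <= n.+1)%N ->
    G1 a (a + i%:R * h n)%R <=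
      (\sum_(0 <= j < i) rho (a + j%:R * h n) * h n * expR (lam * h n))%R%:E /\
    (\sum_(0 <= j < i) rho (a + j.+1%:R * h n) * h n * expR (- (lam * h n)))%R%:E
      <= G2 a (a + i%:R * h n)%R.
  elim: i => [_|i IHi i_n].
    rewrite !big_nil mul0r addr0.
    have := G1le a a (lexx a) (lexx a) ab; have := G2ge a a (lexx a) (lexx a) ab.
    by rewrite subrr !mulr0 !mul0r.
  have [le1 le2] := IHi (ltnW i_n).
  have ai : (a <= a + i%:R * h n)%R by rewrite lerDl mulr_ge0.
  have ii : (a + i%:R * h n <= a + i.+1%:R * h n)%R.
    by rewrite lerD2l ler_wpM2r// ler_nat.
  have ib : (a + i.+1%:R * h n <= b)%R.
    by rewrite -(hn n) lerD2l ler_wpM2r// ler_nat.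
  have dE : (a + i.+1%:R * h n - (a + i%:R * h n) = h n)%R.
    by rewrite -natr1; ring.
  rewrite (G1D _ _ _ (lexx a) ai ii ib) (G2D _ _ _ (lexx a) ai ii ib).
  rewrite !big_nat_recr//= !EFinD; split; apply: leeD => //.
    by have := G1le _ _ ai ii ib; rewrite dE.
  by have := G2ge _ _ ai ii ib; rewrite dE.
case G2E : (G2 a b) => [g| |]; last 2 first.
- by rewrite leey.
- by have := G2ge a b (lexx a) ab (lexx b); rewrite G2E leeNy_eq.
(* Put E = exp (lam * h n) and let s be the common part of the two Riemann sums. The lower bound for
   G2 gives s * h n <= g * E, and the upper bound (rho a + s) * h n * E for G1 is then at most
   [u n]. *)
pose u n : R := (h n * rho a * expR (lam * h n) + expR (lam * h n) * expR (lam * h n) * g)%R.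
have ug : u @ \oo --> g.
  have hc : h @ \oo --> 0%R.
    by rewrite -(mulr0 (b - a)%R); apply: cvgM; [exact: cvg_cst|exact: cvg_harmonic].
  have ec : expR (lam * h n)%R @[n --> \oo] --> (1 : R)%R.
    rewrite -expR0; apply: continuous_cvg; first exact: continuous_expR.
    by rewrite -[X in _ --> X](mulr0 lam); apply: cvgM => //; exact: cvg_cst.
  have gE : (0 * rho a * 1 + 1 * 1 * g = g)%R by ring.
  rewrite -[X in _ --> X]gE.
  apply: cvgD; apply: cvgM => //; try exact: cvg_cst.
    by apply: cvgM => //; exact: cvg_cst.
  exact: cvgM.
have ugE : (u n)%:E @[n --> \oo] --> g%:E by apply: cvg_EFin => //; exact: nearW.
apply: (cvge_to_ge ugE); apply: nearW => n.
have [le1 le2] := bound n n.+1 (leqnn _).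
rewrite hn in le1 le2; apply: (le_trans le1); rewrite lee_fin.
rewrite -!mulr_suml big_nat_recl//= mul0r addr0.
move: le2; rewrite G2E lee_fin -!mulr_suml big_nat_recr//= => le2.
set s := (\sum_(0 <= i < n) _)%R in le2 *.
have e0 := expR_gt0 (lam * h n).
move: le2; rewrite expRN ler_pdivrMr// => le2.
set t := rho (a + n.+1%:R * h n)%R in le2.
have t0 : (0 <= t * h n)%R by apply: mulr_ge0; [exact: rho0|exact: h0].
have sh : (s * h n <= g * expR (lam * h n))%R.
  by apply: le_trans le2; rewrite mulrDl lerDl.
have := ler_wpM2r (ltW e0) sh.
by rewrite /u; lra.
Qed.

Section campbell_formula.
Context (R : realType) d (T : measurableType d) (P : probability T R).
Variables (lam : R) (X : nat -> {RV P >-> R}) (c : R -> R) (Phi : R -> R -> \bar R).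
Local Notation leb := (@lebesgue_measure R).
Hypothesis lam0 : (0 < lam)%R.
Hypothesis PPPX : homogeneous_PPP lam X.
Hypothesis c0 : forall x, (0 <= c x)%R.
Hypothesis Phi0 : forall x y, 0 <= Phi x y.
Hypothesis mc : measurable_fun setT c.
Hypothesis mPhi : forall i j, measurable_fun setT (fun w => Phi (X i w) (X j w)).
Hypothesis mPhir : forall x, measurable_fun setT (Phi x).
Hypothesis mpalm : measurable_fun setT (palm_density lam c Phi).
Variable S : set R.
Hypothesis c_anti : forall x y, S x -> S y -> (x <= y)%R -> (c y <= c x)%R.
Hypothesis Phi_mono : forall x y z, S x -> S y -> (x <= y)%R -> Phi x z <= Phi y z.
Hypothesis Phi_excl : forall x y, S x -> S y -> (y <= x)%R -> Phi x y = +oo.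
Let rho := palm_density lam c Phi.

Let rho0 x : (0 <= rho x)%R.
Proof. exact: palm_density_ge0. Qed.

Let rho_anti x y : S x -> S y -> (x <= y)%R -> (rho y <= rho x)%R.
Proof. exact: palm_density_anti. Qed.

Let mrho (A : set R) : measurable_fun A (EFin \o rho).
Proof. by apply/measurable_EFinP; exact: measurable_funTS. Qed.

Let leb_itv (x y : R) : (x <= y)%R -> leb `]x, y] = (y - x)%:E.
Proof.
move=> xy; rewrite lebesgue_measure_itv/= lte_fin; have [//|yx] := ltP x y.
by congr EFin; apply/esym/eqP; rewrite subr_eq0 eq_le xy yx.
Qed.

Let integral_cst_itv (r x y : R) : (x <= y)%R ->
  \int[leb]_(t in `]x, y]) r%:E = (r * (y - x))%:E.
Proof.
move=> xy; rewrite integral_cst; last exact: measurable_itv.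
by transitivity (r%:E * leb `]x, y]) => //; rewrite leb_itv.
Qed.

Let itv_split (x y z : R) : (x <= y)%R -> (y <= z)%R ->
  `]x, z]%classic = `]x, y] `|` `]y, z] :> set R.
Proof.
move=> xy yz; apply/seteqP; split => t /=; rewrite !in_itv/=.
  by move=> /andP[xt tz]; case: (leP t y) => ty; [left|right]; rewrite ?xt ?tz.
by case=> /andP[h1 h2]; rewrite ?h1 ?h2 ?andbT//= ?(le_trans h2 yz)// (le_lt_trans xy).
Qed.

Let itv_disj (x y z : R) : [disjoint `]x, y]%classic & `]y, z]%classic].
Proof.
apply/disj_set2P/seteqP; split => // t [/=]; rewrite !in_itv/= => /andP[_ ty] /andP[].
by rewrite ltNge ty.
Qed.

(** Both sides are additive over adjacent intervals and satisfy the same upper and lower bounds on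
    short ones, so the comparison applies in either direction. *)
Lemma campbell_cell a b : (a <= b)%R -> (forall x, (a <= x <= b)%R -> S x) ->
  campbell_sum X c Phi `]a, b] = \int[leb]_(x in `]a, b]) (rho x)%:E.
Proof.
move=> ab abS.
have sub x y t : (a <= x)%R -> (y <= b)%R -> (x <= t <= y)%R -> S t.
  by move=> ax yb /andP[xt ty]; apply: abS; rewrite (le_trans ax xt) (le_trans ty yb).
have CD x y z : (a <= x)%R -> (x <= y)%R -> (y <= z)%R -> (z <= b)%R ->
    campbell_sum X c Phi `]x, z] =
    campbell_sum X c Phi `]x, y] + campbell_sum X c Phi `]y, z].
  by move=> _ xy yz _; rewrite (itv_split xy yz); apply: campbell_sumU => //;
    exact: itv_disj.
have ID x y z : (a <= x)%R -> (x <= y)%R -> (y <= z)%R -> (z <= b)%R ->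
    \int[leb]_(t in `]x, z]) (rho t)%:E =
    \int[leb]_(t in `]x, y]) (rho t)%:E + \int[leb]_(t in `]y, z]) (rho t)%:E.
  move=> _ xy yz _; rewrite (itv_split xy yz) ge0_integral_setU//.
  - exact: mrho.
  - by move=> t _; rewrite lee_fin.
have Ile x y : (a <= x)%R -> (x <= y)%R -> (y <= b)%R ->
    \int[leb]_(t in `]x, y]) (rho t)%:E <= (rho x * (y - x) * expR (lam * (y - x)))%:E.
  move=> ax xy yb.
  apply: (@le_trans _ _ (\int[leb]_(t in `]x, y]) (rho x)%:E)).
    apply: ge0_le_integral => //.
    - by move=> t _; rewrite lee_fin.
    - exact: mrho.
    - move=> t /=; rewrite in_itv/= => /andP[xt ty]; rewrite lee_fin.
      by apply: rho_anti; [apply: (sub x y)|apply: (sub x y)|]; rewrite ?lexx ?(ltW xt).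
  rewrite integral_cst_itv// lee_fin; apply: ler_peMr.
    by rewrite mulr_ge0 ?subr_ge0// rho0.
  by rewrite -expR0 ler_expR mulr_ge0 ?subr_ge0// ltW.
have Ige x y : (a <= x)%R -> (x <= y)%R -> (y <= b)%R ->
    (rho y * (y - x) * expR (- (lam * (y - x))))%:E <= \int[leb]_(t in `]x, y]) (rho t)%:E.
  move=> ax xy yb.
  apply: (@le_trans _ _ (\int[leb]_(t in `]x, y]) (rho y)%:E)).
    rewrite integral_cst_itv// lee_fin; apply: ler_piMr.
      by rewrite mulr_ge0 ?subr_ge0// rho0.
    by rewrite -expR0 ler_expR oppr_le0 mulr_ge0 ?subr_ge0// ltW.
  apply: ge0_le_integral => //.
  - by move=> t _; rewrite lee_fin.
  - exact: mrho.
  - move=> t /=; rewrite in_itv/= => /andP[xt ty]; rewrite lee_fin.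
    by apply: rho_anti; [apply: (sub x y)|apply: (sub x y)|]; rewrite ?lexx ?(ltW xt) ?ty ?xy.
apply/eqP; rewrite eq_le; apply/andP; split.
  apply: (@sandwiched_le _ (fun x y => campbell_sum X c Phi `]x, y])
    (fun x y => \int[leb]_(t in `]x, y]) (rho t)%:E) rho lam) => //.
  move=> x y ax xy yb.
  by apply: (campbell_sum_le c0 Phi0 mc mPhi mPhir lam0 PPPX c_anti Phi_mono Phi_excl) => // t;
    exact: sub.
apply: (@sandwiched_le _ (fun x y => \int[leb]_(t in `]x, y]) (rho t)%:E)
  (fun x y => campbell_sum X c Phi `]x, y]) rho lam) => //.
move=> x y ax xy yb.
by apply: (campbell_sum_ge c0 Phi0 mc mPhi mPhir lam0 PPPX c_anti Phi_mono) => // t;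
  exact: sub.
Qed.

(** The bounds on a cell evaluate the weights at both of its ends, which must therefore lie in S,
    whereas the regions of interest are open. They are exhausted by intervals with ends in S, and
    both sides converge monotonically. *)
Lemma campbell_region (a b : nat -> R) : (forall n, (a n <= b n)%R) ->
  (forall n x, (a n <= x <= b n)%R -> S x) ->
  (forall n m, (n <= m)%N -> (a m <= a n)%R /\ (b n <= b m)%R) ->
  campbell_sum X c Phi (\bigcup_n `]a n, b n]%classic) =
  \int[leb]_(x in \bigcup_n `]a n, b n]%classic) (rho x)%:E.
Proof.
move=> ab abS mono.
have nd : nondecreasing_seq (fun n => `]a n, b n]%classic : set R).
  move=> n m nm; apply/subsetPset => t /=; rewrite !in_itv/= => /andP[h1 h2].
  by have [h3 h4] := mono _ _ nm; rewrite (le_lt_trans h3 h1) (le_trans h2 h4).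
have lhs : campbell_sum X c Phi `]a n, b n] @[n --> \oo] -->
    campbell_sum X c Phi (\bigcup_n `]a n, b n]%classic).
  by apply: campbell_sum_cvg.
have rhs : \int[leb]_(x in `]a n, b n]) (rho x)%:E @[n --> \oo] -->
    \int[leb]_(x in \bigcup_n `]a n, b n]%classic) (rho x)%:E.
  apply: ge0_nondecreasing_set_cvg_integral => //.
  - by move=> n; exact: mrho.
  - by move=> n x _; rewrite lee_fin.
have E n : campbell_sum X c Phi `]a n, b n] = \int[leb]_(x in `]a n, b n]) (rho x)%:E.
  by apply: campbell_cell => // x; exact: abS.
by rewrite -(eq_cvg _ _ E) in rhs; exact: (cvg_unique _ lhs rhs).
Qed.

End campbell_formula.

(** * Coverage given the base stations and the blockages *)

(** [\esum] is a supremum over finite subsets, so negative terms are simply left out. The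
    interference is thus expressed by positive parts of the fading for every realization. *)
Lemma esum_max0 (R : realType) (a : nat -> R) (i : nat) :
  \esum_(j in [set~ i]) (a j)%:E =
  \sum_(0 <= j <oo | j != i) (Num.max (a j) 0)%:E.
Proof.
rewrite nneseries_esum; last by move=> j _; rewrite lee_fin le_max lexx orbT.
rewrite (_ : [set j | j != i] = [set~ i]); last first.
  by apply/seteqP; split => j /= /eqP.
apply/eqP; rewrite eq_le; apply/andP; split.
  apply: ub_ereal_sup => _ [A [fA Ai] <-].
  apply: (@le_trans _ _ (\sum_(j \in A) (Num.max (a j) 0)%:E)).
    by apply: lee_fsum => // j _; rewrite lee_fin le_max lexx.
  by apply: ereal_sup_ubound; exists A.
apply: ub_ereal_sup => _ [A [fA Ai] <-].
apply: ereal_sup_ubound; exists (A `&` [set j | (0 < a j)%R]).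
  by split; [exact: finite_setIl|exact: subset_trans (@subIsetl _ _ _) Ai].
rewrite fsbig_mkcondr; apply: eq_fsbigr => j _.
have [aj|aj] := ltP 0%R (a j); first by rewrite mem_set//= .
by rewrite memNset//= => /lt_geF; rewrite aj.
Qed.

(** Serves monotone functions of either direction and the reciprocal alike: intervals are Borel. *)
Lemma measurable_superlevel_interval (R : realType) (g : R -> \bar R) :
  (forall a : R, is_interval [set x | a%:E < g x]) -> measurable_fun setT g.
Proof.
move=> ig; apply: (measurability _ (ErealGenOInfty.measurableE R)).
move=> /= _ [_ [a ->]] <-; rewrite setTI preimage_itvoy.
exact: is_interval_measurable.
Qed.

Lemma measurable_nondecreasing (R : realType) (g : R -> \bar R) :
  {homo g : x y / (x <= y)%R >-> x <= y} -> measurable_fun setT g.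
Proof.
move=> hg; apply: measurable_superlevel_interval => a x y /= ax _ z /andP[xz _].
exact: lt_le_trans ax (hg _ _ xz).
Qed.

Lemma measurable_nonincreasing (R : realType) (g : R -> \bar R) :
  (forall x y, (x <= y)%R -> g y <= g x) -> measurable_fun setT g.
Proof.
move=> hg; apply: measurable_superlevel_interval => a x y /= _ ay z /andP[_ zy].
exact: lt_le_trans ay (hg _ _ zy).
Qed.

(** With 0^-1 = 0 the reciprocal of the positive part jumps at 0, yet its superlevel sets are
    intervals: the whole line for a negative level, a subset of ]0, +oo[ otherwise. *)
Lemma measurable_inv_nneg d (T : measurableType d) (R : realType) (f : T -> R) :
  measurable_fun setT f -> (forall x, (0 <= f x)%R) ->
  measurable_fun setT (fun x => (f x)^-1)%R.
Proof.
move=> mf f0.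
have m : measurable_fun setT (fun x : R => ((Num.max x 0)^-1)%:E).
  apply: measurable_superlevel_interval => a x y /=.
  rewrite !lte_fin => ax ay z /andP[xz zy].
  have [a0|a0] := ltP a 0%R.
    by rewrite lte_fin (lt_le_trans a0)// invr_ge0 le_max lexx orbT.
  have x0 : (0 < x)%R.
    rewrite ltNge; apply/negP => x0; move: ax.
    by rewrite max_r// invr0 ltNge a0.
  have z0 := lt_le_trans x0 xz; have y0 := lt_le_trans z0 zy.
  rewrite lte_fin max_l ?(ltW z0)//; move: ay; rewrite max_l ?(ltW y0)// => ay.
  by apply: lt_le_trans ay _; rewrite lef_pV2.
rewrite (_ : (fun x => _) = (fun y : R => (Num.max y 0)^-1)%R \o f).
  by apply: measurableT_comp mf; exact/measurable_EFinP.
by apply: funext => x /=; rewrite max_l.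
Qed.

Section network.
Context {R : realType}.
Variables (ell : link -> R -> R) (noise tau : R).
Hypothesis noise0 : (0 < noise)%R.
Hypothesis tau0 : (0 < tau)%R.
Hypothesis path_loss_ell : forall s, path_loss (ell s).

Lemma ell_ge0 s x : (0 <= x)%R -> (0 <= ell s x)%R.
Proof. by have [h _ _] := path_loss_ell s; exact: h. Qed.

Lemma ell_anti s x y : (0 <= x)%R -> (x <= y)%R -> (ell s y <= ell s x)%R.
Proof. by have [_ _ h] := path_loss_ell s; exact: h. Qed.

Lemma excl_mono v s x y : (0 <= x)%R -> (x <= y)%R ->
  excl ell v s x <= excl ell v s y.
Proof.
move=> x0 xy; case: v; case: s => /=; rewrite ?lee_fin//.
  apply: le_ereal_inf => _ [z [z0 zy] <-]; exists z => //; split => //.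
  by apply: le_trans zy _; exact: ell_anti.
apply: le_ereal_inf => _ [z [z0 zy] <-]; exists z => //; split => //.
by apply: le_trans zy _; exact: ell_anti.
Qed.

(** Path losses are monotone on nonnegative arguments only. Truncating the argument at 0 gives a
    function monotone on all of R, with the same composite with the absolute value. *)
Lemma measurable_ell s : measurable_fun setT (fun x : R => ell s `|x|).
Proof.
have m : measurable_fun setT (fun x : R => (ell s (Num.max x 0)%R)%:E).
  apply: measurable_nonincreasing => x y xy; rewrite lee_fin; apply: ell_anti.
    by rewrite le_max lexx orbT.
  by rewrite ge_max !le_max xy lexx /= orbT.
rewrite (_ : (fun x : R => _) = (fun x : R => ell s (Num.max x 0)%R) \o (fun x : R => `|x|)%R).
  by apply: measurableT_comp => //; exact/measurable_EFinP.
by apply: funext => x /=; rewrite max_l.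
Qed.

Lemma measurable_excl v s : measurable_fun setT (fun x : R => excl ell v s `|x|).
Proof.
have m : measurable_fun setT (fun x : R => excl ell v s (Num.max x 0)%R).
  apply: measurable_nondecreasing => x y xy; apply: excl_mono.
    by rewrite le_max lexx orbT.
  by rewrite ge_max !le_max xy lexx /= orbT.
rewrite (_ : (fun x : R => _) = (fun x : R => excl ell v s (Num.max x 0)%R) \o (fun x : R => `|x|)%R).
  exact: measurableT_comp.
by apply: funext => x /=; rewrite max_l.
Qed.

(* The type of a base station at y when the nearest blockages are at the
   distances q on the right and q' on the left. *)
Definition los (q q' : \bar R) (y : R) : bool :=
  ((0 < y)%R && (y%:E < q)) || ((y < 0)%R && (`|y|%:E < q')).

Definition typ q q' y : link := if los q q' y then LoS else NLoS.

Definition gain q q' y : R := ell (typ q q' y) `|y|.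

(* exp (- penalty) is the factor that a base station at y contributes to the
   conditional coverage probability given that one of type s at x is serving. *)
Definition penalty (s : link) (q q' : \bar R) (x y : R) : \bar R :=
  if (`|y|%:E <= excl ell (typ q q' y) s `|x|) || (ell s `|x| == 0)%R then +oo
  else (ln (1 + tau * (gain q q' y / ell s `|x|)))%:E.

Lemma gain_ge0 q q' y : (0 <= gain q q' y)%R.
Proof. exact: ell_ge0. Qed.

Lemma penalty_ge0 s q q' x y : 0 <= penalty s q q' x y.
Proof.
rewrite /penalty; case: ifP => // _; rewrite lee_fin ln_ge0// lerDl mulr_ge0 ?(ltW tau0)//.
by rewrite divr_ge0 ?gain_ge0 ?ell_ge0.
Qed.

(** Moving the serving station away enlarges the exclusion zone and lowers its mean power: either
    cause of an infinite penalty persists, and a finite one has its denominator decreased. *)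
Lemma penalty_mono s q q' x y z : (0 <= x)%R -> (x <= y)%R ->
  penalty s q q' x z <= penalty s q q' y z.
Proof.
move=> x0 xy; have y0 := le_trans x0 xy.
rewrite /penalty (ger0_norm x0) (ger0_norm y0).
have [/orP hx|hx] := boolP ((`|z|%:E <= excl ell (typ q q' z) s x) || (ell s x == 0)%R);
    last first.
  have [hy|hy] := boolP ((`|z|%:E <= excl ell (typ q q' z) s y) || (ell s y == 0)%R).
    by rewrite leey.
  move: hx hy; rewrite !negb_or => /andP[_ ex] /andP[_ ey].
  have ex0 : (0 < ell s x)%R by rewrite lt0r ex ell_ge0.
  have ey0 : (0 < ell s y)%R by rewrite lt0r ey ell_ge0.
  have g0 := gain_ge0 q q' z.
  have r : (gain q q' z / ell s x <= gain q q' z / ell s y)%R.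
    by rewrite ler_wpM2l// lef_pV2 ?posrE// ell_anti.
  have p t : (0 < t)%R -> (0 < 1 + tau * (gain q q' z / t))%R.
    by move=> t0; rewrite ltr_pwDl// mulr_ge0 ?(ltW tau0)// divr_ge0// ltW.
  by rewrite lee_fin ler_ln ?posrE ?p// lerD2l ler_pM2l.
rewrite ifT//; case: hx => [h|/eqP h].
  by rewrite (le_trans h)//; exact: excl_mono.
by rewrite orbC eq_le ell_ge0// andbT -h ell_anti.
Qed.

Lemma penalty_same_type s q q' x y : typ q q' y = s -> (`|y| <= `|x|)%R ->
  penalty s q q' x y = +oo.
Proof. by move=> <- yx; rewrite /penalty; case: (typ _ _ _); rewrite /= lee_fin yx. Qed.

Lemma noise_factor_ge0 a : (0 <= noise_factor noise tau a)%R.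
Proof. by rewrite /noise_factor; case: ifP => // _; exact: expR_ge0. Qed.

Lemma noise_factor_anti s x y : (0 <= x)%R -> (x <= y)%R ->
  (noise_factor noise tau (ell s y) <= noise_factor noise tau (ell s x))%R.
Proof.
move=> x0 xy; have y0 := le_trans x0 xy.
rewrite /noise_factor; case: ifPn => [_|ey]; first by case: ifP => // _; exact: expR_ge0.
have ey0 : (0 < ell s y)%R by rewrite lt0r ey ell_ge0.
have ex0 : (0 < ell s x)%R by apply: lt_le_trans ey0 _; exact: ell_anti.
rewrite gt_eqF// ler_expR lerN2 ler_pM2l ?mulr_gt0// lef_pV2 ?posrE//.
exact: ell_anti.
Qed.

Section measurability.
Context d (T : measurableType d).

Lemma measurable_los (q q' : T -> \bar R) (y : T -> R) :
  measurable_fun setT q -> measurable_fun setT q' -> measurable_fun setT y ->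
  measurable_fun setT (fun t => los (q t) (q' t) (y t)).
Proof.
move=> mq mq' my; apply: measurable_or; apply: measurable_and.
- exact: measurable_fun_ltr.
- by apply: measurable_fun_lte => //; exact/measurable_EFinP.
- exact: measurable_fun_ltr.
- by apply: measurable_fun_lte => //; apply/measurable_EFinP; exact: measurableT_comp.
Qed.

Lemma measurable_gain (q q' : T -> \bar R) (y : T -> R) :
  measurable_fun setT q -> measurable_fun setT q' -> measurable_fun setT y ->
  measurable_fun setT (fun t => gain (q t) (q' t) (y t)).
Proof.
move=> mq mq' my.
rewrite (_ : (fun t => _) = fun t => if los (q t) (q' t) (y t)
  then ell LoS `|y t| else ell NLoS `|y t|)%R; last first.
  by apply: funext => t; rewrite /gain /typ; case: ifP.
apply: measurable_fun_ifT.
- exact: measurable_los.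
- exact: (measurableT_comp (measurable_ell LoS)).
- exact: (measurableT_comp (measurable_ell NLoS)).
Qed.

Lemma measurable_penalty s (q q' : T -> \bar R) (x y : T -> R) :
  measurable_fun setT q -> measurable_fun setT q' ->
  measurable_fun setT x -> measurable_fun setT y ->
  measurable_fun setT (fun t => penalty s (q t) (q' t) (x t) (y t)).
Proof.
move=> mq mq' mx my.
have mlos := measurable_los mq mq' my.
have mabs : measurable_fun setT (fun t => `|y t|%:E : \bar R).
  by apply/measurable_EFinP; exact: measurableT_comp.
have mg := measurable_gain mq mq' my.
have mlx : measurable_fun setT (fun t => ell s `|x t|)%R.
  exact: (measurableT_comp (measurable_ell s)).
apply: measurable_fun_ifT => //.
- apply: measurable_or; last exact: measurable_fun_eqr.
  apply: measurable_fun_lee => //.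
  rewrite (_ : (fun t => _) = fun t => if los (q t) (q' t) (y t)
    then excl ell LoS s `|x t|%R else excl ell NLoS s `|x t|%R); last first.
    by apply: funext => t; rewrite /typ; case: ifP.
  apply: measurable_fun_ifT => //.
  - exact: (measurableT_comp (measurable_excl LoS s)).
  - exact: (measurableT_comp (measurable_excl NLoS s)).
- apply/measurable_EFinP; apply: measurableT_comp => //.
  apply: measurable_funD => //; apply: measurable_funM => //.
  apply: measurable_funM => //; apply: measurable_inv_nneg => // t.
  exact: ell_ge0.
Qed.

End measurability.
End network.

Section coverage_given.
Context (R : realType) d (T : measurableType d) (P : probability T R).
Variables (ell : link -> R -> R) (noise tau : R) (H : nat -> {RV P >-> R}).
Hypothesis noise0 : (0 < noise)%R.
Hypothesis tau0 : (0 < tau)%R.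
Hypothesis path_loss_ell : forall s, path_loss (ell s).
Hypothesis iidH : iid_exponential H.

(** The inequality SINR > tau solved for [h i]: multiply by the denominator, divide by the mean
    power a. Both sides are false if a = 0, and also if the interference is infinite, the SINR then
    being 0. *)
Lemma coverage_raceE (x b h : nat -> R) i :
  let q := nearest_right b in let q' := nearest_left b in
  let a := gain ell q q' (x i) in
  (tau%:E < sinr ell noise x b h i) =
  (0 < a)%R && ((tau * noise / a)%:E +
    \sum_(0 <= j <oo | j != i)
      ((tau * (gain ell q q' (x j) / a)) * Num.max (h j) 0)%:E < (h i)%:E).
Proof.
move=> q q' a; have a0 : (0 <= a)%R by exact: gain_ge0.
have interferenceE : interference ell x b h i =
    \sum_(0 <= j <oo | j != i) (gain ell q q' (x j))%:E * (Num.max (h j) 0)%:E.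
  rewrite /interference esum_max0; apply: eq_eseriesr => j _.
  rewrite -EFinM; congr EFin.
  have g0 : (0 <= gain ell q q' (x j))%R by exact: gain_ge0.
  rewrite -[RHS]mulrC maxr_pMl// mul0r; congr (Num.max _ _).
rewrite /sinr interferenceE -/a.
have [a1|a1] := ltP 0%R a; last first.
  have aE : a = 0%R by apply/eqP; rewrite eq_le a1 a0.
  rewrite /received -[ell _ _]/a aE mulr0 mul0e.
  by apply/negbTE; rewrite -leNgt lee_fin ltW.
rewrite /=.
set I := \sum_(0 <= j <oo | j != i) (_ * _).
have I0 : 0 <= I.
  by apply: nneseries_ge0 => j _ _; rewrite mule_ge0 ?lee_fin ?gain_ge0// le_max lexx orbT.
have -> : \sum_(0 <= j <oo | j != i)
      ((tau * (gain ell q q' (x j) / a)) * Num.max (h j) 0)%:E = (tau / a)%:E * I.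
  rewrite -nneseriesZl; last first.
    by move=> j _; rewrite mule_ge0 ?lee_fin ?gain_ge0// le_max lexx orbT.
  by apply: eq_eseriesr => j _; rewrite -!EFinM; congr EFin; ring.
case: I I0 => [I| |]// I0.
  rewrite -EFinD inver gt_eqF ?ltr_pwDl// -!EFinM -EFinD !lte_fin.
  rewrite /received -[ell _ _]/a.
  rewrite ltr_pdivlMr ?ltr_pwDl//.
  rewrite -[RHS](ltr_pM2r a1); congr (_ < _)%R.
  by field; rewrite gt_eqF.
rewrite addey// invey mule0 gt0_muley ?lte_fin ?divr_gt0// addey//.
by rewrite ltNge (ltW tau0) ltNge leey.
Qed.

Lemma servingE (x b : nat -> R) i : serving ell x b i <->
  forall j, j != i ->
  ~~ (`|x j|%:E <= excl ell (typ (nearest_right b) (nearest_left b) (x j))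
        (typ (nearest_right b) (nearest_left b) (x i)) `|x i|).
Proof.
split=> [h j ji|h j ji]; first by rewrite -ltNge; apply: h; exact/eqP.
by rewrite ltNge; apply: h; exact/eqP.
Qed.

(** For a serving station of positive mean power a this is [fading_race] with c0 = tau * noise / a
    and coefficients tau * gain / a. A station that does not serve meets an infinite penalty, and
    one of zero mean power has noise factor 0; both sides are then 0. *)
Lemma coverage_given (x b : nat -> R) i :
  let q := nearest_right b in let q' := nearest_left b in
  P [set w | serving ell x b i /\ tau%:E < sinr ell noise x b (H ^~ w) i] =
  (noise_factor noise tau (ell (typ q q' (x i)) `|x i|))%:E *
  expeR (- \sum_(0 <= j <oo | j != i)
    penalty ell tau (typ q q' (x i)) q q' (x i) (x j)).
Proof.
move=> q q'; set a := ell _ `|x i|.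
have a0 : (0 <= a)%R by exact: ell_ge0.
have pen0 j : 0 <= penalty ell tau (typ q q' (x i)) q q' (x i) (x j) by exact: penalty_ge0.
have [ae|an] := eqVneq a 0%R.
  rewrite /noise_factor ae eqxx mul0e (_ : [set _ | _] = set0) ?measure0//.
  apply/seteqP; split => // w [_]; rewrite coverage_raceE.
  by rewrite -[gain _ _ _ _]/a ae ltxx.
have a1 : (0 < a)%R by rewrite lt0r an.
have [hs|ns] := pselect (serving ell x b i); last first.
  rewrite (_ : [set _ | _] = set0) ?measure0; last by apply/seteqP; split => // w [].
  have [j [ji jx]] : exists j, j != i /\
      `|x j|%:E <= excl ell (typ q q' (x j)) (typ q q' (x i)) `|x i|.
    apply: contrapT => no; apply: ns; apply/servingE => j ji; apply/negP => jx.
    by apply: no; exists j.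
  rewrite (@nneseries_pinfty _ _ _ j)//=; first by rewrite mule0.
  by rewrite /penalty jx.
rewrite (_ : [set _ | _] = [set w | (tau * noise / a)%:E +
    \sum_(0 <= j <oo | j != i)
      ((tau * (gain ell q q' (x j) / a)) * Num.max (H j w) 0)%:E < (H i w)%:E]); last first.
  apply/seteqP; split => w /=; first by move=> [_]; rewrite coverage_raceE => /andP[_].
  by move=> h; split => //; rewrite coverage_raceE -[gain _ _ _ _]/a a1.
rewrite (fading_race iidH (c := fun j => (tau * (gain ell q q' (x j) / a))%R)); last 2 first.
- by rewrite divr_ge0 ?mulr_ge0// ltW.
- by move=> j; apply: mulr_ge0; [exact: ltW|apply: divr_ge0 => //; exact: gain_ge0].
congr (_ * _); first by rewrite /noise_factor (negbTE an).
congr (expeR (- _)); apply: eq_eseriesr => j ji.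
move/servingE : hs => /(_ j ji) hs.
by rewrite /penalty (negbTE hs) -/a (negbTE an).
Qed.

End coverage_given.

(** * Summing the weights over the four regions of constant type *)

Lemma harmonic_lt (R : realType) (e : R) : (0 < e)%R ->
  exists n, forall m, (n <= m)%N -> (harmonic m < e)%R.
Proof.
move=> e0; have /cvgrPdist_lt/(_ _ e0)[n _ hn] := @cvg_harmonic R.
exists n => m nm; have := hn m nm.
by rewrite sub0r normrN ger0_norm// harmonic_ge0.
Qed.

Lemma harmonic_anti (R : realType) n m : (n <= m)%N ->
  (harmonic m <= harmonic n :> R)%R.
Proof. by move=> nm; rewrite /harmonic/= lef_pV2 ?posrE// ler_nat. Qed.

Lemma harmonic_le1 (R : realType) n : (harmonic n <= 1 :> R)%R.
Proof. by rewrite /harmonic/= invf_le1// ler1n. Qed.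

(** Harmonic terms are at most 1, so margins of q / 2 times such a term keep the ends in order from
    index 0 on. *)
Lemma itv0o_bigcup (R : realType) (q : R) : (0 < q)%R ->
  `]0%R, q[%classic =
  \bigcup_n `](q / 2 * harmonic n)%R, (q - q / 2 * harmonic n)%R]%classic.
Proof.
move=> q0; have q2 : (0 < q / 2)%R by rewrite divr_gt0.
apply/seteqP; split => [x|x [n _]] /=; rewrite !in_itv/=.
  move=> /andP[x0 xq].
  have [n h1] := harmonic_lt (divr_gt0 x0 q2).
  have qx0 : (0 < q - x)%R by rewrite subr_gt0.
  have [m h2] := harmonic_lt (divr_gt0 qx0 q2).
  exists (maxn n m) => //=; rewrite in_itv/=.
  have := h1 _ (leq_maxl n m); rewrite ltr_pdivlMr// mulrC => {}h1.
  have := h2 _ (leq_maxr n m); rewrite ltr_pdivlMr// mulrC => {}h2.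
  by rewrite h1/= lerBrDr -lerBrDl; exact: ltW.
have h0 : (0 < q / 2 / n.+1%:R)%R by rewrite divr_gt0.
move=> /andP[h1 h2]; rewrite (lt_trans h0 h1)/=.
by apply: le_lt_trans h2 _; rewrite ltrBlDr ltrDl.
Qed.

(** The summand 1 keeps q + harmonic n at most the right end, from index 0 on. *)
Lemma itvoy_bigcup (R : realType) (q : R) :
  `]q, +oo[%classic = \bigcup_n `](q + harmonic n)%R, (q + 1 + n%:R)%R]%classic.
Proof.
apply/seteqP; split => [x|x [n _]] /=; rewrite !in_itv/= ?andbT.
  move=> qx; have qx0 : (0 < x - q)%R by rewrite subr_gt0.
  have [n hn] := harmonic_lt qx0.
  have [m xm] : exists m : nat, (x - q <= m%:R)%R.
    by exists (Num.trunc (x - q)).+1; rewrite ltW// truncnS_gt.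
  exists (maxn n m) => //=; rewrite in_itv/=.
  have := hn _ (leq_maxl n m); rewrite ltrBrDl => ->/=.
  rewrite -lerBlDl opprD addrA (le_trans _ (_ : m%:R <= _)%R) ?ler_nat ?leq_maxr//.
  by rewrite (le_trans _ xm)// gerBl.
by move=> /andP[h _]; apply: le_lt_trans h; rewrite lerDl harmonic_ge0.
Qed.

Lemma nneseriesD4 (R : realType) (f1 f2 f3 f4 : nat -> \bar R) :
  (forall i, 0 <= f1 i) -> (forall i, 0 <= f2 i) ->
  (forall i, 0 <= f3 i) -> (forall i, 0 <= f4 i) ->
  \sum_(0 <= i <oo) (f1 i + f2 i + (f3 i + f4 i)) =
  \sum_(0 <= i <oo) f1 i + \sum_(0 <= i <oo) f2 i +
  (\sum_(0 <= i <oo) f3 i + \sum_(0 <= i <oo) f4 i).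
Proof.
move=> h1 h2 h3 h4.
by rewrite nneseriesD ?nneseriesD// => i *; exact: adde_ge0.
Qed.

(** The points 0, q and - q' are hit with probability 0; off them the position lies in one of four
    open regions, which will be those of constant station type. *)
Lemma integral_split_points d (T : measurableType d) (R : realType)
    (P : probability T R) (Z : {RV P >-> R}) (W : T -> \bar R) (q q' : R) :
  (0 < q)%R -> (0 < q')%R -> (forall p, P (Z @^-1` [set p]) = 0) ->
  measurable_fun setT W -> (forall w, 0 <= W w) ->
  \int[P]_w W w =
  \int[P]_(w in Z @^-1` `]0%R, q[) W w + \int[P]_(w in Z @^-1` `]q, +oo[) W w +
  (\int[P]_(w in Z @^-1` (-%R @^-1` `]0%R, q'[)) W w +
   \int[P]_(w in Z @^-1` (-%R @^-1` `]q', +oo[)) W w).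
Proof.
move=> q0 q'0 PZ mW W0.
have mN (E : set R) : measurable E -> measurable (-%R @^-1` E).
  by move=> mE; rewrite -[X in measurable X]setTI; exact: (oppr_measurable measurableT mE).
have mZ (E : set R) : measurable E -> measurable (Z @^-1` E).
  by move=> mE; exact: measurable_funPTI.
have mpt p : measurable (Z @^-1` [set p]) by exact: mZ.
pose A := Z @^-1` `]0%R, q[; pose B := Z @^-1` `]q, +oo[.
pose C := Z @^-1` (-%R @^-1` `]0%R, q'[); pose D := Z @^-1` (-%R @^-1` `]q', +oo[).
have mA : measurable A by apply: mZ; exact: measurable_itv.
have mB : measurable B by apply: mZ; exact: measurable_itv.
have mC : measurable C by apply: mZ; apply: mN; exact: measurable_itv.
have mD : measurable D by apply: mZ; apply: mN; exact: measurable_itv.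
pose N := Z @^-1` [set 0%R] `|` Z @^-1` [set q] `|` Z @^-1` [set (- q')%R].
have mNN : measurable N by apply: measurableU => //; apply: measurableU.
have PN : P N = 0.
  apply/eqP; rewrite -measure_le0.
  have h1 : P (Z @^-1` [set 0%R] `|` Z @^-1` [set q]) <= 0.
    by rewrite -[leRHS]adde0 -{1}(PZ 0%R) -(PZ q); exact: measureU2.
  apply: le_trans h1; rewrite -[leRHS]adde0 -(PZ (- q')%R).
  by apply: measureU2 => //; exact: measurableU.
have memA w : A w <-> (0 < Z w < q)%R by rewrite /A/= in_itv.
have memB w : B w <-> (q < Z w)%R by rewrite /B/= in_itv/= andbT.
have memC w : C w <-> (0 < - Z w < q')%R by rewrite /C/= in_itv.
have memD w : D w <-> (q' < - Z w)%R by rewrite /D/= in_itv/= andbT.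
have NE : setT `\` N = (A `|` B) `|` (C `|` D).
  apply/seteqP; split => w.
    move=> [_ nN]; have [x0|x0|x0] := ltgtP (Z w) 0%R; last by exfalso; apply: nN; left; left.
      have [x1|x1|x1] := ltgtP (- Z w)%R q'.
      - by right; left; apply/memC; rewrite oppr_gt0 x0.
      - by right; right; apply/memD.
      - by exfalso; apply: nN; right; rewrite /= -x1 opprK.
    have [x1|x1|x1] := ltgtP (Z w) q.
    - by left; left; apply/memA; rewrite x0.
    - by left; right; apply/memB.
    - by exfalso; apply: nN; left; right.
  move=> h; split => // n; have : (Z w = 0 \/ Z w = q \/ Z w = - q')%R.
    by case: n => [[->|->]|->]; auto.
  by case: h => [[/memA/andP[h1 h2]|/memB h1]|[/memC/andP[h1 h2]|/memD h1]];
    case=> [e|[e|e]]; rewrite e in h1 *; try rewrite e in h2; lra.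
have mWS E : measurable_fun E W by exact: measurable_funTS.
have dAB : [disjoint A & B].
  apply/disj_set2P/seteqP; split => // w [/memA/andP[_ h1] /memB h2].
  by have := lt_trans h1 h2; rewrite ltxx.
have dCD : [disjoint C & D].
  apply/disj_set2P/seteqP; split => // w [/memC/andP[_ h1] /memD h2].
  by have := lt_trans h1 h2; rewrite ltxx.
have dABCD : [disjoint A `|` B & C `|` D].
  apply/disj_set2P/seteqP; split => // w [h1 h2].
  have p : (0 < Z w)%R by case: h1 => [/memA/andP[]|/memB]//; exact: lt_trans.
  have n : (0 < - Z w)%R by case: h2 => [/memC/andP[]|/memD]//; exact: lt_trans.
  by move: n; rewrite oppr_gt0 => /(lt_trans p); rewrite ltxx.
rewrite (@ge0_negligible_integral _ _ _ _ setT N)// NE.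
by rewrite !ge0_integral_setU//; exact: measurableU.
Qed.

Section density.
Context {R : realType}.
Variables (ell : link -> R -> R) (noise tau lam : R).
Hypothesis noise0 : (0 < noise)%R.
Hypothesis tau0 : (0 < tau)%R.
Hypothesis lam0 : (0 < lam)%R.
Hypothesis path_loss_ell : forall s, path_loss (ell s).
Local Notation leb := (@lebesgue_measure R).

Definition nf s (x : R) : R := noise_factor noise tau (ell s `|x|).

Definition density s (q q' : \bar R) (x : R) : R :=
  palm_density lam (nf s) (penalty ell tau s q q') x.

Lemma nf_ge0 s x : (0 <= nf s x)%R.
Proof. exact: noise_factor_ge0. Qed.

Lemma density_ge0 s q q' x : (0 <= density s q q' x)%R.
Proof. by apply: palm_density_ge0 => //; exact: nf_ge0. Qed.

Lemma measurable_nf s : measurable_fun setT (nf s).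
Proof.
have ml := measurable_ell path_loss_ell s.
apply: measurable_fun_ifT => //; first exact: measurable_fun_eqr.
apply: measurableT_comp => //; apply: measurableT_comp => //.
apply: measurable_funM => //; apply: measurable_inv_nneg => // x.
exact: ell_ge0.
Qed.

(** Joint measurability in the blockage distances and the position prepares the later exchanges of
    integrals; the exponent is a partial integral of a jointly measurable function. *)
Lemma measurable_density d (T : measurableType d) s (q q' : T -> \bar R)
    (x : T -> R) :
  measurable_fun setT q -> measurable_fun setT q' -> measurable_fun setT x ->
  measurable_fun setT (fun t => density s (q t) (q' t) (x t)).
Proof.
move=> mq mq' mx; apply: measurable_funM.
  by apply: measurable_funM => //; exact: (measurableT_comp (measurable_nf s)).
have mv : measurable_fun setT
    (fun t => void_exponent (penalty ell tau s (q t) (q' t)) (x t)).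
  pose f (z : T * measurableTypeR R) : \bar R :=
    1 - expeR (- penalty ell tau s (q z.1) (q' z.1) (x z.1) z.2).
  have mf : measurable_fun setT f.
    apply: emeasurable_funB => //; apply: measurable_expeRN.
    apply: (@measurable_penalty R ell tau path_loss_ell _ (T * measurableTypeR R)%type s
      (fun z => q z.1) (fun z => q' z.1) (fun z => x z.1) snd).
    - exact: measurableT_comp.
    - exact: measurableT_comp.
    - exact: measurableT_comp.
    - exact: measurable_snd.
  have f0 z : 0 <= f z.
    rewrite /f sube_ge0 ?expeRN_ge0_le1 ?penalty_ge0//.
    by rewrite expeRN_fin_num// penalty_ge0.
  exact: (@measurable_fun_fubini_tonelli_F _ _ T (measurableTypeR R) R leb f mf f0).
apply: measurableT_comp => //; apply: measurable_expeRN.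
exact: emeasurable_funM.
Qed.

Section composite.
Context d (S : measurableType d).
Variables (x : nat -> S -> R) (q q' : S -> \bar R).
Hypothesis mx : forall j, measurable_fun setT (x j).
Hypothesis mq : measurable_fun setT q.
Hypothesis mq' : measurable_fun setT q'.

Lemma measurable_typ_penalty i j : measurable_fun setT (fun t =>
  penalty ell tau (typ (q t) (q' t) (x i t)) (q t) (q' t) (x i t) (x j t)).
Proof.
have mp s := measurable_penalty tau path_loss_ell s mq mq' (mx i) (mx j).
rewrite (_ : (fun t => _) = fun t => if los (q t) (q' t) (x i t)
  then penalty ell tau LoS (q t) (q' t) (x i t) (x j t)
  else penalty ell tau NLoS (q t) (q' t) (x i t) (x j t)); last first.
  by apply: funext => t; rewrite /typ; case: ifP.
by apply: measurable_fun_ifT; [exact: measurable_los|exact: mp|exact: mp].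
Qed.

(** The conditional probability, given the stations and the nearest blockages, that station i serves
    and covers the user. *)
Definition coverage_weight (q q' : \bar R) (x : nat -> R) i : \bar R :=
  let s := typ q q' (x i) in
  (nf s (x i))%:E *
  expeR (- \sum_(0 <= j <oo | j != i) penalty ell tau s q q' (x i) (x j)).

Lemma coverage_weight_ge0 a a' y i : 0 <= coverage_weight a a' y i.
Proof. by rewrite mule_ge0 ?expeR_ge0// lee_fin nf_ge0. Qed.

Lemma measurable_coverage_weight i :
  measurable_fun setT (fun t => coverage_weight (q t) (q' t) (x ^~ t) i).
Proof.
apply: emeasurable_funM; last first.
  apply: measurable_expeRN; apply: (@ge0_emeasurable_sum _ _ _ _ _ (predC1 i)).
    by move=> j t _ _; exact: penalty_ge0.
  by move=> j _; exact: measurable_typ_penalty.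
apply/measurable_EFinP.
rewrite (_ : (fun t => _) = fun t => if los (q t) (q' t) (x i t)
  then nf LoS (x i t) else nf NLoS (x i t)); last first.
  by apply: funext => t; rewrite /typ; case: ifP.
have mn s : measurable_fun setT (fun t => nf s (x i t)).
  by apply: measurableT_comp; [exact: measurable_nf|exact: mx].
by apply: measurable_fun_ifT; [exact: measurable_los|exact: mn|exact: mn].
Qed.

End composite.

End density.

Section regions.
Context (R : realType) d (T : measurableType d) (P : probability T R).
Variables (ell : link -> R -> R) (noise tau lam : R).
Hypothesis noise0 : (0 < noise)%R.
Hypothesis tau0 : (0 < tau)%R.
Hypothesis lam0 : (0 < lam)%R.
Hypothesis path_loss_ell : forall s, path_loss (ell s).
Local Notation leb := (@lebesgue_measure R).
Local Notation rho := (density ell noise tau lam).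
Local Notation csum X s q q' := (campbell_sum X (nf ell noise tau s) (penalty ell tau s q q')).

(** On the positive half-line distance and position coincide, so monotonicity in the distance is
    monotonicity in the position. *)
Let campbell_open (X : nat -> {RV P >-> R}) s (q q' : \bar R) (S : set R)
    (a b : nat -> R) :
  homogeneous_PPP lam X ->
  (forall x, S x -> (0 < x)%R /\ typ q q' x = s) ->
  (forall n, (a n <= b n)%R) -> (forall n x, (a n <= x <= b n)%R -> S x) ->
  (forall n m, (n <= m)%N -> (a m <= a n)%R /\ (b n <= b m)%R) ->
  S = \bigcup_n `]a n, b n]%classic ->
  csum X s q q' S = \int[leb]_(x in S) (rho s q q' x)%:E.
Proof.
move=> PPPX Ss ab abS abm SE; rewrite SE.
apply: (@campbell_region R d T P lam X _ _ lam0 PPPX _ _ _ _ _ _ S) => //.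
- by move=> x; exact: nf_ge0.
- by move=> x y; exact: penalty_ge0.
- exact: measurable_nf.
- by move=> i j; apply: (@measurable_penalty R ell tau path_loss_ell _ T s
    (fun=> q) (fun=> q') (X i) (X j)) => //.
- by move=> x; apply: (@measurable_penalty R ell tau path_loss_ell _ R s
    (fun=> q) (fun=> q') (fun=> x) idfun) => //;
    exact: measurable_id.
- by apply: (@measurable_density R ell noise tau lam tau0 path_loss_ell _ R s
    (fun=> q) (fun=> q') idfun) => //; exact: measurable_id.
- move=> x y /Ss[x0 _] /Ss[y0 _] xy; rewrite /nf !gtr0_norm//.
  by apply: noise_factor_anti => //; exact: ltW.
- by move=> x y z /Ss[x0 _] _ xy; apply: penalty_mono => //; exact: ltW.
- move=> x y /Ss[x0 _] /Ss[y0 ys] yx; apply: penalty_same_type => //.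
  by rewrite !gtr0_norm.
Qed.

Lemma campbell_los (X : nat -> {RV P >-> R}) (q : R) q' :
  homogeneous_PPP lam X -> (0 < q)%R ->
  csum X LoS q%:E q' `]0%R, q[ = \int[leb]_(x in `]0%R, q[) (rho LoS q%:E q' x)%:E.
Proof.
move=> PPPX q0; have q2 : (0 < q / 2)%R by rewrite divr_gt0.
apply: (campbell_open PPPX _ _ _ _ (itv0o_bigcup q0)).
- move=> x; rewrite /= in_itv/= => /andP[x0 xq]; split => //.
  by rewrite /typ /los x0 lte_fin xq.
- move=> n; have h : (q / 2 * harmonic n <= q / 2)%R.
    by rewrite ler_piMr ?(ltW q2)// harmonic_le1.
  by lra.
- move=> n x /andP[h1 h2]; rewrite /= in_itv/=.
  have p : (0 < q / 2 * harmonic n)%R by rewrite mulr_gt0// /harmonic/= invr_gt0.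
  by rewrite (lt_le_trans p h1)/= (le_lt_trans h2)// ltrBlDr ltrDl.
- move=> n m nm; have h : (q / 2 * harmonic m <= q / 2 * harmonic n)%R.
    by rewrite ler_pM2l// harmonic_anti.
  by split => //; rewrite lerD2l lerN2.
Qed.

Lemma campbell_nlos (X : nat -> {RV P >-> R}) (q : R) q' :
  homogeneous_PPP lam X -> (0 < q)%R ->
  csum X NLoS q%:E q' `]q, +oo[ = \int[leb]_(x in `]q, +oo[) (rho NLoS q%:E q' x)%:E.
Proof.
move=> PPPX q0.
apply: (campbell_open PPPX _ _ _ _ (itvoy_bigcup q)).
- move=> x; rewrite /= in_itv/= andbT => qx; have x0 := lt_trans q0 qx.
  by split => //; rewrite /typ /los x0 (lt_gtF x0) lte_fin (lt_gtF qx).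
- by move=> n; have := harmonic_le1 R n; have : (0 <= n%:R :> R)%R by []; lra.
- move=> n x /andP[h1 _]; rewrite /= in_itv/= andbT (lt_le_trans _ h1)//.
  by rewrite ltrDl /harmonic/= invr_gt0.
- move=> n m nm; split; first by rewrite lerD2l harmonic_anti.
  by rewrite lerD2l ler_nat.
Qed.

Definition opp_points (X : nat -> {RV P >-> R}) (i : nat) : {RV P >-> R} :=
  (\- (X i : T -> R))%R.

(** Counting mirrored points in A is counting points in - A, and Lebesgue measure is invariant under
    reflection. *)
Lemma opp_points_PPP (X : nat -> {RV P >-> R}) :
  homogeneous_PPP lam X -> homogeneous_PPP lam (opp_points X).
Proof.
move=> PPPX n A k mA Aoo tA.
have mN (B : set R) : measurable B -> measurable (-%R @^-1` B).
  by move=> mB; rewrite -[X in measurable X]setTI; exact: (oppr_measurable measurableT mB).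
have lN (B : set R) : measurable B -> leb (-%R @^-1` B) = leb B.
  by move=> mB; exact: lebesgue_measureN.
have -> : [set w | forall j, point_count (opp_points X) (A j) w = (k j)%:R%:E] =
    [set w | forall j, point_count X (-%R @^-1` A j) w = (k j)%:R%:E] by [].
rewrite PPPX//.
- by congr EFin; apply: eq_bigr => j _ /=; rewrite lN.
- by move=> j; exact: mN.
- by move=> j; rewrite lN.
- move=> i j _ _ [x [xi xj]]; apply: tA => //.
  by exists (- x)%R.
Qed.

Lemma penaltyN s q q' x y : penalty ell tau s q q' (- x) (- y) = penalty ell tau s q' q x y.
Proof.
have losN : los q q' (- y) = los q' q y.
  rewrite /los oppr_gt0 oppr_lt0 normrN; case: (ltgtP y 0%R) => //= y0.
    by rewrite orbF ltr0_norm.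
  by rewrite orbF gtr0_norm.
by rewrite /penalty /gain /typ !normrN losN.
Qed.

Lemma campbell_opp (X : nat -> {RV P >-> R}) s q q' (A : set R) :
  csum X s q q' (-%R @^-1` A) = csum (opp_points X) s q' q A.
Proof.
apply: eq_eseriesr => i _; apply: eq_integral => w _; rewrite /point_weight/=.
rewrite /nf normrN; congr (_ * expeR (- _)); apply: eq_eseriesr => j _.
by rewrite -penaltyN.
Qed.

Variable X : nat -> {RV P >-> R}.
Hypothesis PPPX : homogeneous_PPP lam X.

(** A singleton has length 0, so its count is Poisson of mean 0. *)
Lemma PPP_point i (p : R) : P (X i @^-1` [set p]) = 0.
Proof.
have N0 : P [set w | point_count X [set p] w = 0] = 1.
  have := PPP_count PPPX 0 (measurable_set1 p).
  rewrite lebesgue_measure_set1 ltry => /(_ isT) ->.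
  by rewrite /poisson_weight mulr0 expr0 fact0 divr1 oppr0 expR0 mul1r.
have mN : measurable [set w | point_count X [set p] w = 0].
  by have := measurable_count_eq X 0 (measurable_set1 p); exact.
apply/eqP; rewrite -measure_le0.
apply: (@le_trans _ _ (P (~` [set w | point_count X [set p] w = 0]))); last first.
  by rewrite probability_setC// N0 subee.
apply: le_measure; rewrite ?inE.
- exact: measurable_funPTI.
- exact: measurableC.
- by move=> w /= Xw /point_count_eq0/(_ i).
Qed.

(** The expected total weight of the stations on the positive half-line for fixed q and q'. *)
Definition right_half (q q' : R) : \bar R :=
  \int[leb]_(x in `]0%R, q[) (rho LoS q%:E q'%:E x)%:E +
  \int[leb]_(x in `]q, +oo[) (rho NLoS q%:E q'%:E x)%:E.

Local Notation cov q q' i w := (coverage_weight ell noise tau q q' (X ^~ w) i).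

Let measurable_cov q q' i : measurable_fun setT (fun w => cov q q' i w).
Proof. by apply: (measurable_coverage_weight noise tau0 path_loss_ell (x := X)). Qed.

Lemma coverage_weight_total (q q' : R) : (0 < q)%R -> (0 < q')%R ->
  \sum_(0 <= i <oo) \int[P]_w cov q%:E q'%:E i w =
  right_half q q' + right_half q' q.
Proof.
move=> q0 q'0.
pose A := `]0%R, q[%classic : set R; pose B := `]q, +oo[%classic : set R.
pose C := (-%R @^-1` `]0%R, q'[%classic) : set R.
pose D := (-%R @^-1` `]q', +oo[%classic) : set R.
have mN (E : set R) : measurable E -> measurable (-%R @^-1` E).
  by move=> mE; rewrite -[X in measurable X]setTI; exact: (oppr_measurable measurableT mE).
have mA : measurable A by exact: measurable_itv.
have mB : measurable B by exact: measurable_itv.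
have mC : measurable C by apply: mN; exact: measurable_itv.
have mD : measurable D by apply: mN; exact: measurable_itv.
have PPPoX := opp_points_PPP PPPX.
have eA : csum X LoS q%:E q'%:E A = _ := campbell_los q'%:E PPPX q0.
have eB : csum X NLoS q%:E q'%:E B = _ := campbell_nlos q'%:E PPPX q0.
have eC : csum X LoS q%:E q'%:E C =
    \int[leb]_(x in `]0%R, q'[) (rho LoS q'%:E q%:E x)%:E.
  by rewrite /C campbell_opp; exact: (campbell_los q%:E PPPoX q'0).
have eD : csum X NLoS q%:E q'%:E D =
    \int[leb]_(x in `]q', +oo[) (rho NLoS q'%:E q%:E x)%:E.
  by rewrite /D campbell_opp; exact: (campbell_nlos q%:E PPPoX q'0).
transitivity (csum X LoS q%:E q'%:E A + csum X NLoS q%:E q'%:E B +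
              (csum X LoS q%:E q'%:E C + csum X NLoS q%:E q'%:E D)); last first.
  by rewrite eA eB eC eD.
have pw0 s i : 0 <= \int[P]_(w in X i @^-1` s) cov q%:E q'%:E i w.
  by move=> *; apply: integral_ge0 => w _; exact: coverage_weight_ge0.
pose f E i := \int[P]_(w in X i @^-1` E) cov q%:E q'%:E i w.
(* On a region of constant type s, weighting each station by its own type is weighting it by s. *)
have csumE s E : (forall x, E x -> typ q%:E q'%:E x = s) -> csum X s q%:E q'%:E E =
    \sum_(0 <= i <oo) f E i.
  move=> Es; apply: eq_eseriesr => i _; apply: eq_integral => w; rewrite inE => /= Ew.
  by rewrite /coverage_weight (Es _ Ew).
have tA x : A x -> typ q%:E q'%:E x = LoS.
  by rewrite /A/= in_itv/= => /andP[x0 xq]; rewrite /typ /los x0 lte_fin xq.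
have tB x : B x -> typ q%:E q'%:E x = NLoS.
  rewrite /B/= in_itv/= andbT => qx; have x0 := lt_trans q0 qx.
  by rewrite /typ /los x0 (lt_gtF x0) lte_fin (lt_gtF qx).
have tC x : C x -> typ q%:E q'%:E x = LoS.
  rewrite /C/= in_itv/= oppr_gt0 => /andP[x0 xq].
  by rewrite /typ /los (lt_gtF x0) x0/= ltr0_norm// lte_fin xq.
have tD x : D x -> typ q%:E q'%:E x = NLoS.
  rewrite /D/= in_itv/= andbT => qx.
  have x0 : (x < 0)%R by rewrite -oppr_gt0 (lt_trans q'0 qx).
  by rewrite /typ /los (lt_gtF x0) x0/= ltr0_norm// lte_fin (lt_gtF qx).
have csA := csumE _ _ tA; have csB := csumE _ _ tB.
have csC := csumE _ _ tC; have csD := csumE _ _ tD.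
rewrite csA csB csC csD.
have f0 E i : 0 <= f E i by exact: pw0.
apply: (etrans _ (nneseriesD4 (f0 A) (f0 B) (f0 C) (f0 D))).
apply: eq_eseriesr => i _; rewrite /f /A /B /C /D.
exact: (integral_split_points q0 q'0 (PPP_point i)
  (measurable_cov q%:E q'%:E i)
  (fun w => coverage_weight_ge0 ell noise tau q%:E q'%:E (X ^~ w) i)).
Qed.

End regions.

(** * Explicit form of the coverage density *)

Lemma ge0_integral_reflect (R : realType) (f : R -> \bar R) :
  measurable_fun setT f -> (forall x, 0 <= f x) ->
  \int[lebesgue_measure]_x f x =
  \int[lebesgue_measure]_(x in `]0%R, +oo[) f x +
  \int[lebesgue_measure]_(x in `]0%R, +oo[) f (- x)%R.
Proof.
move=> mf f0.
have mfN : measurable_fun setT (fun x : R => f (- x)%R).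
  by apply: measurableT_comp mf _; exact: oppr_measurable.
rewrite [X in _ + X]integral_itv_obnd_cbnd; last exact: measurable_funTS.
rewrite ge0_integration_by_substitution0//.
rewrite [X in _ = _ + X](_ : _ = \int[lebesgue_measure]_(x in `]-oo, 0%R]) f x); last first.
  by apply: eq_integral => x _; rewrite opprK.
rewrite -ge0_integral_setU//=; last 2 first.
- exact: measurable_funTS.
- apply/disj_set2P/seteqP; split => // x [/=]; rewrite !in_itv/= andbT => h.
  by rewrite leNgt h.
congr (integral _ _ _); apply/seteqP; split => // x _ /=.
by rewrite !in_itv/= andbT; case: (leP x 0%R); [right|left].
Qed.

(** Up to e the integrand is 1 and contributes a length, which will enter g; beyond e the integral
    remains, which will enter kappa. *)
Lemma integral_cut (R : realType) (D : set R) (e : \bar R) (r : R -> R) :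
  measurable D -> measurable_fun setT r -> (forall y, (0 <= r y)%R) ->
  \int[lebesgue_measure]_(y in D) (if y%:E <= e then 1 else (r y)%:E) =
  lebesgue_measure (D `&` [set y | y%:E <= e]) +
  \int[lebesgue_measure]_(y in D `&` [set y | e < y%:E]) (r y)%:E.
Proof.
move=> mD mr r0.
have mE : measurable [set y : R | y%:E <= e].
  have := @measurable_lee _ _ R setT measurableT EFin (cst e).
  by rewrite setTI; apply => //; apply/measurable_EFinP; exact: measurable_id.
have mDE : measurable (D `&` [set y | y%:E <= e]) by exact: measurableI.
have mE' : measurable (D `&` [set y | e < y%:E]).
  apply: measurableI => //; rewrite (_ : [set y | _] = ~` [set y | y%:E <= e]).
    exact: measurableC.
  by apply/seteqP; split => y /=; rewrite ltNge => /negP.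
pose g (y : R) : \bar R := if y%:E <= e then 1 else (r y)%:E.
have e1 : lebesgue_measure (D `&` [set y | y%:E <= e]) =
    \int[lebesgue_measure]_(y in D `&` [set y | y%:E <= e]) g y.
  rewrite (eq_integral (cst 1)); last first.
    by move=> y; rewrite inE/= => -[_ ye]; rewrite /g ye.
  rewrite integral_cst; last exact: mDE.
  by rewrite mul1e.
have e2 : \int[lebesgue_measure]_(y in D `&` [set y | e < y%:E]) (r y)%:E =
    \int[lebesgue_measure]_(y in D `&` [set y | e < y%:E]) g y.
  by apply: eq_integral => y; rewrite inE/= /g => -[_]; rewrite ltNge => /negbTE ->.
rewrite e1 e2.
have mif : measurable_fun setT g.
  apply: measurable_fun_ifT => //; last exact/measurable_EFinP.
  by apply: measurable_fun_lee => //; apply/measurable_EFinP; exact: measurable_id.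
rewrite -ge0_integral_setU//.
- congr (integral _ _ _); apply/seteqP; split => y /=; last by case=> -[].
  by move=> Dy; case: (leP y%:E e); [left|right].
- exact: measurable_funTS.
- by move=> y _; rewrite /g; case: ifP => // _; rewrite lee_fin.
- apply/disj_set2P/seteqP; split => // y [[_ /= h1] [_ /=]].
  by rewrite ltNge h1.
Qed.

Section frac.
Context {R : realType}.
Variable tau : R.
Hypothesis tau0 : (0 < tau)%R.

(** 1 - 1 / (1 + t) = 1 / (1 + t^-1) with t = tau * g / a; for g = 0 both sides are 0, by the
    convention built into [frac]. *)
Lemma frac_expR (a g : R) : (0 < a)%R -> (0 <= g)%R ->
  (1 - expR (- ln (1 + tau * (g / a))))%R = frac tau a g.
Proof.
move=> a0 g0; have p : (0 < 1 + tau * (g / a))%R.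
  by rewrite ltr_pwDl// mulr_ge0 ?(ltW tau0)// divr_ge0// ltW.
rewrite expRN lnK ?posrE// /frac; case: eqP => [->|/eqP gn].
  by rewrite mul0r mulr0 addr0 invr1 subrr.
have g1 : (0 < g)%R by rewrite lt0r gn.
have q : (0 < a + tau * g)%R by rewrite addr_gt0// mulr_gt0.
have -> : (1 + tau * (g / a) = (a + tau * g) / a)%R by field; rewrite gt_eqF.
have -> : (1 + tau^-1 * (a / g) = (a + tau * g) / (tau * g))%R.
  by field; rewrite !gt_eqF.
by field; rewrite !gt_eqF.
Qed.

Lemma frac_ge0 (a g : R) : (0 <= a)%R -> (0 <= g)%R -> (0 <= frac tau a g)%R.
Proof.
move=> a0 g0; rewrite /frac; case: ifP => // _; rewrite divr_ge0// addr_ge0//.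
by rewrite mulr_ge0 ?invr_ge0 ?(ltW tau0)// divr_ge0.
Qed.

Lemma measurable_frac d (T : measurableType d) (a g : T -> R) :
  measurable_fun setT a -> measurable_fun setT g ->
  (forall t, (0 <= a t)%R) -> (forall t, (0 <= g t)%R) ->
  measurable_fun setT (fun t => frac tau (a t) (g t)).
Proof.
move=> ma mg a0 g0; apply: measurable_fun_ifT => //; first exact: measurable_fun_eqr.
apply: measurable_funM => //; apply: measurable_inv_nneg; last first.
  by move=> t; rewrite addr_ge0// mulr_ge0 ?invr_ge0 ?(ltW tau0)// divr_ge0.
apply: measurable_funD => //; apply: measurable_funM => //.
by apply: measurable_funM => //; exact: measurable_inv_nneg.
Qed.

End frac.

Section density_identification.
Context {R : realType}.
Variables (ell : link -> R -> R) (noise tau lam : R).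
Hypothesis noise0 : (0 < noise)%R.
Hypothesis tau0 : (0 < tau)%R.
Hypothesis lam0 : (0 < lam)%R.
Hypothesis path_loss_ell : forall s, path_loss (ell s).
Hypothesis excl_lt : forall x, (0 < x)%R ->
  excl ell NLoS LoS x < x%:E /\ x%:E < excl ell LoS NLoS x.
Local Notation leb := (@lebesgue_measure R).

Lemma excl_ge0 v s x : (0 <= x)%R -> 0 <= excl ell v s x.
Proof.
by move=> x0; case: v; case: s; rewrite /= ?lee_fin//;
  apply: le_ereal_inf_tmp => _ [y [y0 _] <-]; rewrite lee_fin.
Qed.

(** The exponent of one half-line with its nearest blockage at q: LoS stations before q, NLoS
    stations beyond, each split into an excluded part, measured by its length, and a part weighted
    by [frac]. *)
Definition half_void s (q : R) (x : R) : \bar R :=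
  leb (`]0%R, q[ `&` [set y | y%:E <= excl ell LoS s x]) +
  \int[leb]_(y in `]0%R, q[ `&` [set y | excl ell LoS s x < y%:E])
    (frac tau (ell s x) (ell LoS y))%:E +
  (leb (`]q, +oo[ `&` [set y | y%:E <= excl ell NLoS s x]) +
   \int[leb]_(y in `]q, +oo[ `&` [set y | excl ell NLoS s x < y%:E])
     (frac tau (ell s x) (ell NLoS y))%:E).

Lemma half_voidE s (q : R) (q' : \bar R) (x : R) : (0 < q)%R -> (0 < x)%R ->
  (0 < ell s x)%R ->
  \int[leb]_(y in `]0%R, +oo[) (1 - expeR (- penalty ell tau s q%:E q' x y)) =
  half_void s q x.
Proof.
move=> q0 x0 a0.
have a0' := ltW a0.
have mp : measurable_fun setT (fun y => 1 - expeR (- penalty ell tau s q%:E q' x y)).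
  apply: emeasurable_funB => //; apply: measurable_expeRN.
  by apply: (@measurable_penalty R ell tau path_loss_ell _ R s
    (fun=> q%:E) (fun=> q') (fun=> x) idfun) => //; exact: measurable_id.
have p0 y : 0 <= 1 - expeR (- penalty ell tau s q%:E q' x y).
  rewrite sube_ge0 ?expeRN_ge0_le1 ?penalty_ge0//.
  by rewrite expeRN_fin_num// penalty_ge0.
have penE v y : (0 < y)%R -> typ q%:E q' y = v ->
    1 - expeR (- penalty ell tau s q%:E q' x y) =
    if y%:E <= excl ell v s x then 1 else (frac tau (ell s x) (ell v `|y|))%:E.
  move=> y0 ty; rewrite /penalty /gain ty !gtr0_norm// (gt_eqF a0) orbF.
  case: ifPn => _; first by rewrite /= sube0.
  rewrite /= -EFinB frac_expR//; exact/ell_ge0/ltW.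
have mfr v : measurable_fun setT (fun y : R => frac tau (ell s x) (ell v `|y|)).
  apply: measurable_frac => //; first exact: measurable_ell.
  by move=> y; exact: ell_ge0.
have fr0 v y : (0 <= frac tau (ell s x) (ell v `|y|))%R.
  by apply: frac_ge0 => //; exact: ell_ge0.
have -> : `]0%R, +oo[%classic = `]0%R, q[ `|` ([set q] `|` `]q, +oo[) :> set R.
  apply/seteqP; split => y /=; rewrite !in_itv/= ?andbT.
    by move=> y0; rewrite y0/=; have [h|h|->] := ltgtP y q; [left|right; right|right; left].
  by case=> [/andP[]//|[->//|]]; exact: lt_trans.
rewrite ge0_integral_setU//; last 3 first.
- by apply: measurableU.
- exact: measurable_funTS.
- apply/disj_set2P/seteqP; split => // y [/=]; rewrite !in_itv/= ?andbT.
  by move=> /andP[_ yq] [e|/(lt_trans yq)]; [move: yq; rewrite e|]; rewrite ltxx.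
rewrite ge0_integral_setU//; last 2 first.
- exact: measurable_funTS.
- apply/disj_set2P/seteqP; split => // y [/= ->]; rewrite !in_itv/= ?andbT.
  by rewrite ltxx.
rewrite integral_set1 add0e; congr (_ + _).
  transitivity (\int[leb]_(y in `]0%R, q[)
    (if y%:E <= excl ell LoS s x then 1 else (frac tau (ell s x) (ell LoS `|y|))%:E)).
    apply: eq_integral => y; rewrite inE/= in_itv/= => /andP[y0 yq].
    by apply: penE => //; rewrite /typ /los y0 lte_fin yq.
  rewrite integral_cut//; congr (_ + _); apply: eq_integral => y.
  by rewrite inE/= in_itv/= => -[/andP[y0 _] _]; rewrite gtr0_norm.
transitivity (\int[leb]_(y in `]q, +oo[)
  (if y%:E <= excl ell NLoS s x then 1 else (frac tau (ell s x) (ell NLoS `|y|))%:E)).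
  apply: eq_integral => y; rewrite inE/= in_itv/= andbT => qy.
  have y0 := lt_trans q0 qy.
  by apply: penE => //; rewrite /typ /los y0 (lt_gtF y0) lte_fin (lt_gtF qy).
rewrite integral_cut//; congr (_ + _); apply: eq_integral => y.
rewrite inE/= in_itv/= andbT => -[qy _]; rewrite gtr0_norm//.
exact: lt_trans qy.
Qed.

Lemma void_exponentE s (q q' x : R) : (0 < q)%R -> (0 < q')%R -> (0 < x)%R ->
  (0 < ell s x)%R ->
  void_exponent (penalty ell tau s q%:E q'%:E) x =
  half_void s q x + half_void s q' x.
Proof.
move=> q0 q'0 x0 a0.
rewrite /void_exponent ge0_integral_reflect; last 2 first.
- apply: emeasurable_funB => //; apply: measurable_expeRN.
  by apply: (@measurable_penalty R ell tau path_loss_ell _ R s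
    (fun=> q%:E) (fun=> q'%:E) (fun=> x) idfun) => //; exact: measurable_id.
- move=> y; rewrite sube_ge0 ?expeRN_ge0_le1 ?penalty_ge0//.
  by rewrite expeRN_fin_num// penalty_ge0.
rewrite half_voidE//; congr (_ + _).
rewrite -(half_voidE q%:E)//; apply: eq_integral => y _.
by rewrite -penaltyN opprK /penalty normrN.
Qed.

End density_identification.

Section half_line_measure.
Context {R : realType}.
Local Notation leb := (@lebesgue_measure R).

Lemma lebesgue_cut_left (q : R) (e : \bar R) : (0 < q)%R -> 0 <= e ->
  leb (`]0%R, q[ `&` [set y | y%:E <= e]) = if q%:E <= e then q%:E else e.
Proof.
move=> q0 e0; case: ifPn => [qe|]; last rewrite -ltNge => eq.
  rewrite (_ : _ `&` _ = `]0%R, q[%classic); last first.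
    apply/seteqP; split => y /=; first by case.
    move=> y0q; split => //; move: y0q; rewrite in_itv/= => /andP[_ yq].
    by rewrite (le_trans _ qe)// lee_fin ltW.
  by rewrite lebesgue_measure_itv/= lte_fin q0 oppr0 adde0.
case: e e0 eq => [r| |]//; rewrite lee_fin lte_fin => r0 rq.
rewrite (_ : _ `&` _ = `]0%R, r]%classic); last first.
  apply/seteqP; split => y /=; rewrite !in_itv/= lee_fin.
    by move=> [/andP[-> _] ->].
  by move=> /andP[-> yr]; rewrite yr (le_lt_trans yr).
rewrite lebesgue_measure_itv/= lte_fin; case: ltP => [_|r0']; first by rewrite oppr0 adde0.
by congr EFin; apply/eqP; rewrite eq_le r0 r0'.
Qed.

Lemma lebesgue_cut_right (q r : R) :
  leb (`]q, +oo[ `&` [set y | y%:E <= r%:E]) = if (q < r)%R then (r - q)%:E else 0.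
Proof.
rewrite (_ : _ `&` _ = `]q, r]%classic); last first.
  apply/seteqP; split => y /=; rewrite !in_itv/= andbT lee_fin.
    by move=> [-> ->].
  by move=> /andP[].
by rewrite lebesgue_measure_itv/= lte_fin.
Qed.

Lemma integral_bool_restrict (A : set R) (b : R -> bool) (r : R -> R) :
  \int[leb]_(y in A) ((b y)%:R * r y)%:E =
  \int[leb]_(y in A `&` [set y | b y]) (r y)%:E.
Proof.
rewrite integral_mkcondr; apply: eq_integral => y _; rewrite patchE.
case: (boolP (b y)) => by_; first by rewrite mem_set// mul1r.
by rewrite memNset ?mul0r//=; exact/negP.
Qed.

Lemma expeRN_scaleD (lam : R) (a b : \bar R) : (0 <= lam)%R -> 0 <= a -> 0 <= b ->
  expeR (- (lam%:E * (a + b))) = expeR (- (lam%:E * a)) * expeR (- (lam%:E * b)).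
Proof.
move=> lam0 a0 b0; rewrite ge0_muleDr// oppeD ?expeRD//.
by apply: ge0_adde_def; rewrite inE mule_ge0 ?lee_fin.
Qed.

(** Sorts the terms of the two half-line exponents: b, c, e and g are the integrals that form kappa,
    while a, d and f are lengths of exclusion zones. *)
Lemma adde_regroup (a b c d e f g : \bar R) :
  ((a + b) + c) + ((d + e) + (f + g)) = (((c + g) + b) + e) + (a + (d + f)).
Proof. by rewrite !addeA (ACl (3*7*2*5*1*4*6)). Qed.

End half_line_measure.

Section density_identification.
Context {R : realType}.
Variables (ell : link -> R -> R) (noise tau lam : R).
Hypothesis noise0 : (0 < noise)%R.
Hypothesis tau0 : (0 < tau)%R.
Hypothesis lam0 : (0 < lam)%R.
Hypothesis path_loss_ell : forall s, path_loss (ell s).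
Hypothesis excl_lt : forall x, (0 < x)%R ->
  excl ell NLoS LoS x < x%:E /\ x%:E < excl ell LoS NLoS x.
Local Notation leb := (@lebesgue_measure R).

Let frac_int_ge0 s v x (D : set R) : (0 < x)%R -> (forall y, D y -> (0 < y)%R) ->
  0 <= \int[leb]_(y in D) (frac tau (ell s x) (ell v y))%:E.
Proof.
move=> x0 D0; apply: integral_ge0 => y Dy; rewrite lee_fin.
by apply: frac_ge0 => //; apply: ell_ge0 => //; apply: ltW => //; exact: D0.
Qed.

Let densityE s (q q' x : R) : (0 < q)%R -> (0 < q')%R -> (0 < x)%R ->
  (density ell noise tau lam s q%:E q'%:E x)%:E =
  lam%:E * ((noise_factor noise tau (ell s x))%:E *
    expeR (- (lam%:E * (half_void ell tau s q x + half_void ell tau s q' x)))).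
Proof.
move=> q0 q'0 x0; rewrite /density palm_densityE//; last by move=> y z; exact: penalty_ge0.
rewrite EFinM -muleA; congr (_ * _); rewrite /nf gtr0_norm//.
have [e0|en] := eqVneq (ell s x) 0%R.
  by rewrite /noise_factor e0 eqxx !mul0e.
rewrite void_exponentE//; rewrite lt0r en; apply: ell_ge0 => //; exact: ltW.
Qed.

(** The integrals form kappa, the lengths form g. As e_{N|L}(x) < x < q, the zone on the right has
    length x; on the left min (q', x) for LoS and the positive part of e_{N|L}(x) - q' for NLoS add
    up to e_{N|L}(x), q' or x, the three cases of [g_L]. *)
Lemma density_los (q q' x : R) : (0 < q')%R -> (0 < x)%R -> (x < q)%R ->
  (density ell noise tau lam LoS q%:E q'%:E x)%:E =
  lam%:E * ((noise_factor noise tau (ell LoS x))%:E *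
    kappa_L ell lam tau x q' q * g_L ell lam x q q').
Proof.
move=> q'0 x0 xq; have q0 := lt_trans x0 xq.
have [eNx _] := excl_lt x0.
have eN0 : 0 <= excl ell NLoS LoS x by apply: excl_ge0; exact: ltW.
rewrite densityE// -muleA; congr (_ * (_ * _)).
pose a := ell LoS x.
pose I1 := \int[leb]_(y in `]q, +oo[) (frac tau a (ell NLoS y))%:E.
pose I2 := \int[leb]_(y in `]q', +oo[ `&` [set y | excl ell NLoS LoS x < y%:E])
  (frac tau a (ell NLoS y))%:E.
pose I3 := \int[leb]_(y in `]x, q[) (frac tau a (ell LoS y))%:E.
pose I4 := \int[leb]_(y in `]0%R, q'[ `&` [set y | x%:E < y%:E])
  (frac tau a (ell LoS y))%:E.
pose L1 := leb (`]0%R, q'[ `&` [set y | y%:E <= x%:E]).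
pose L2 := leb (`]q', +oo[ `&` [set y | y%:E <= excl ell NLoS LoS x]).
have hq : half_void ell tau LoS q x = x%:E + I3 + (0 + I1).
  rewrite /half_void lebesgue_cut_left ?lee_fin ?(ltW x0)//= leNgt xq/=.
  congr (_ + _ + (_ + _)).
  - congr (integral _ _ _); apply/seteqP; split => y /=; rewrite !in_itv/= lte_fin.
      by move=> [/andP[_ ->] ->].
    by move=> /andP[xy yq]; rewrite xy yq (lt_trans x0 xy).
  - rewrite (_ : _ `&` _ = set0) ?measure0//; apply/seteqP; split => // y /=.
    rewrite in_itv/= andbT => -[qy ye]; have := le_lt_trans ye eNx.
    by rewrite lte_fin => /(lt_trans qy)/(lt_trans xq); rewrite ltxx.
  - congr (integral _ _ _); apply/seteqP; split => y /=; rewrite !in_itv/= andbT; first by case.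
    by move=> qy; split => //; rewrite (lt_trans eNx)// lte_fin (lt_trans xq).
have hq' : half_void ell tau LoS q' x = L1 + I4 + (L2 + I2) by [].
have kE : kappa_L ell lam tau x q' q = expeR (- (lam%:E * (I1 + I2 + I3 + I4))).
  rewrite /kappa_L; congr (expeR (- (_ * (_ + _ + _ + _)))).
  - rewrite (integral_bool_restrict _ (fun y => q' < y)%R (fun y => frac tau a (ell NLoS y))).
    by congr (integral _ _ _); apply/seteqP; split => y /=; rewrite in_itv/= andbT => -[].
  - rewrite (integral_bool_restrict _ (fun y => y < q')%R (fun y => frac tau a (ell LoS y))).
    congr (integral _ _ _); apply/seteqP; split => y /=; rewrite !in_itv/= ?andbT lte_fin.
      by move=> [xy ->]; rewrite xy (lt_trans x0 xy).
    by move=> [/andP[_ ->] ->].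
have I1_ge0 : 0 <= I1.
  by apply: frac_int_ge0 => // y; rewrite /= in_itv/= andbT; exact: lt_trans.
have I2_ge0 : 0 <= I2.
  by apply: frac_int_ge0 => // y; rewrite /= in_itv/= andbT => -[h _]; exact: lt_trans h.
have I3_ge0 : 0 <= I3.
  by apply: frac_int_ge0 => // y; rewrite /= in_itv/= => /andP[h _]; exact: lt_trans h.
have I4_ge0 : 0 <= I4.
  by apply: frac_int_ge0 => // y; rewrite /= in_itv/= => -[/andP[]].
have L1_ge0 : 0 <= L1 by exact: measure_ge0.
have L2_ge0 : 0 <= L2 by exact: measure_ge0.
rewrite hq hq' adde_regroup ?add0e expeRN_scaleD ?(ltW lam0)//; last 2 first.
- exact: (adde_ge0 (adde_ge0 (adde_ge0 I1_ge0 I2_ge0) I3_ge0) I4_ge0).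
- by apply: adde_ge0; [rewrite lee_fin ltW|exact: adde_ge0].
rewrite kE; congr (_ * _); rewrite expeRN_scaleD ?(ltW lam0) ?adde_ge0 ?lee_fin ?(ltW x0)//.
rewrite /g_L xq mul1e; congr (_ * _).
have L1E : L1 = (Num.min q' x)%:E.
  rewrite /L1 lebesgue_cut_left ?lee_fin ?(ltW x0)//.
  by have [h|h] := leP q' x.
have [r rE] : exists r : R, excl ell NLoS LoS x = r%:E.
  by move: eN0 eNx; case: (excl _ _ _ _) => [r| |]// _ _; exists r.
have L2E : L2 = if (q' < r)%R then (r - q')%:E else 0.
  by rewrite /L2 rE lebesgue_cut_right.
rewrite L1E L2E rE; move: eNx; rewrite rE lte_fin => rx.
rewrite lee_fin; have [q'r|rq'] := leP q' r.
  have q'x := le_lt_trans q'r rx.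
  rewrite min_l ?(ltW q'x)//; case: ltgtP q'r => // [h|->] _.
    by rewrite -EFinD addrC subrK.
  by rewrite adde0.
rewrite (lt_gtF rq') adde0 -EFinM -EFinN/=.
by have [h|h] := ltP q' x.
Qed.

(** As q < x < e_{L|N}(x), the right half-line is excluded up to x, with length q + (x - q). On the
    left min (q', e_{L|N}(x)) and the positive part of x - q' add up to x, q' or e_{L|N}(x), the
    three cases of [g_N]; if the radius is infinite, the last one does not occur. *)
Lemma density_nlos (q q' x : R) : (0 < q)%R -> (0 < q')%R -> (q < x)%R ->
  (density ell noise tau lam NLoS q%:E q'%:E x)%:E =
  lam%:E * ((noise_factor noise tau (ell NLoS x))%:E *
    kappa_N ell lam tau x q' q * g_N ell lam x q q').
Proof.
move=> q0 q'0 qx; have x0 := lt_trans q0 qx.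
have [_ xeL] := excl_lt x0.
have eL0 : 0 <= excl ell LoS NLoS x by apply: excl_ge0; exact: ltW.
rewrite densityE// -muleA; congr (_ * (_ * _)).
pose a := ell NLoS x.
pose I1 := \int[leb]_(y in `]x, +oo[) (frac tau a (ell NLoS y))%:E.
pose I2 := \int[leb]_(y in `]q', +oo[ `&` [set y | x%:E < y%:E])
  (frac tau a (ell NLoS y))%:E.
pose I4 := \int[leb]_(y in `]0%R, q'[ `&` [set y | excl ell LoS NLoS x < y%:E])
  (frac tau a (ell LoS y))%:E.
pose L1 := leb (`]0%R, q'[ `&` [set y | y%:E <= excl ell LoS NLoS x]).
pose L2 := leb (`]q', +oo[ `&` [set y | y%:E <= x%:E]).
have hq : half_void ell tau NLoS q x = x%:E + 0 + I1.
  rewrite /half_void lebesgue_cut_left// lebesgue_cut_right qx ifT; last first.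
    by rewrite (le_trans _ (ltW xeL))// lee_fin ltW.
  rewrite (_ : `]0%R, q[ `&` [set y | excl ell LoS NLoS x < y%:E] = set0); last first.
    apply/seteqP; split => // y /=; rewrite in_itv/= => -[/andP[_ yq] /(lt_trans xeL)].
    by rewrite lte_fin => /lt_trans/(_ yq)/(lt_trans qx); rewrite ltxx.
  rewrite integral_set0 !adde0 addeA -EFinD [(q + (x - q))%R]addrC subrK; congr (_ + _).
  congr (integral _ _ _); apply/seteqP; split => y /=; rewrite !in_itv/= !andbT lte_fin.
    by case.
  by move=> xy; rewrite xy (lt_trans qx).
have hq' : half_void ell tau NLoS q' x = L1 + I4 + (L2 + I2) by [].
(* The 0 holds the place of the LoS integral on the right, absent because all of ]0, q[ is
   excluded. *)
have kE : kappa_N ell lam tau x q' q = expeR (- (lam%:E * (I1 + I2 + 0 + I4))).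
  rewrite adde0 /kappa_N; congr (expeR (- (_ * (_ + _ + _)))).
  - rewrite (integral_bool_restrict _ (fun y => q' < y)%R (fun y => frac tau a (ell NLoS y))).
    congr (integral _ _ _); apply/seteqP; split => y /=; rewrite !in_itv/= !andbT lte_fin;
      by case.
  - rewrite (integral_bool_restrict _ (fun y => y < q')%R (fun y => frac tau a (ell LoS y))).
    congr (integral _ _ _); apply/seteqP; split => y /=; rewrite !in_itv/=.
      move=> [xy ->]; split => //; rewrite andbT -lte_fin.
      exact: le_lt_trans xy.
    by move=> [/andP[_ ->] ->].
have I1_ge0 : 0 <= I1.
  by apply: frac_int_ge0 => // y; rewrite /= in_itv/= andbT; exact: lt_trans.
have I2_ge0 : 0 <= I2.
  by apply: frac_int_ge0 => // y; rewrite /= in_itv/= andbT => -[h _]; exact: lt_trans h.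
have I4_ge0 : 0 <= I4.
  by apply: frac_int_ge0 => // y; rewrite /= in_itv/= => -[/andP[]].
have L1_ge0 : 0 <= L1 by exact: measure_ge0.
have L2_ge0 : 0 <= L2 by exact: measure_ge0.
rewrite hq hq' adde_regroup ?add0e expeRN_scaleD ?(ltW lam0)//; last 2 first.
- exact: (adde_ge0 (adde_ge0 (adde_ge0 I1_ge0 I2_ge0) (lexx 0)) I4_ge0).
- by apply: adde_ge0; [rewrite lee_fin ltW|exact: adde_ge0].
rewrite kE; congr (_ * _); rewrite expeRN_scaleD ?(ltW lam0) ?adde_ge0 ?lee_fin ?(ltW x0)//.
rewrite /g_N (ltW qx) mul1e; congr (_ * _).
have L1E : L1 = if q'%:E <= excl ell LoS NLoS x then q'%:E else excl ell LoS NLoS x.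
  by rewrite /L1 lebesgue_cut_left.
have L2E : L2 = if (q' < x)%R then (x - q')%:E else 0.
  by rewrite /L2 lebesgue_cut_right.
rewrite L1E L2E; have [q'x|xq'] := ltP q' x.
  rewrite ifT; last by rewrite (le_trans _ (ltW xeL))// lee_fin ltW.
  by rewrite -EFinD addrC subrK.
rewrite adde0; have [q'e|eq'|<-] := ltgtP q'%:E (excl ell LoS NLoS x) => //.
Qed.

End density_identification.

(** * Distances to the nearest blockages *)

Section nearest.
Context {R : realType}.

(** The weak inequality is the one that a void event expresses, whether or not the infimum is
    attained. *)
Lemma le_nearest_right (b : nat -> R) (a : R) :
  a%:E <= nearest_right b <-> forall j, ~ (0 < b j < a)%R.
Proof.
split=> [h j /andP[b0 ba]|h].
  have : nearest_right b <= (b j)%:E by apply: ereal_inf_lbound; exists j.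
  by move/(le_trans h); rewrite lee_fin leNgt ba.
apply: le_ereal_inf_tmp => _ [j b0 <-].
by rewrite lee_fin leNgt; apply/negP => ba; apply: (h j); rewrite b0.
Qed.

Lemma nearest_leftE (b : nat -> R) : nearest_left b = nearest_right (fun j => - b j)%R.
Proof.
rewrite /nearest_left /nearest_right; congr ereal_inf.
apply/seteqP; split => _ [j b0 <-]; exists j => //=.
- by rewrite oppr_gt0.
- by rewrite ltr0_norm.
- by rewrite -oppr_gt0.
- by rewrite ltr0_norm// -oppr_gt0.
Qed.

Lemma measurable_nearest_right d (T : measurableType d) (b : nat -> T -> R) :
  (forall j, measurable_fun setT (b j)) ->
  measurable_fun setT (fun t => nearest_right (b ^~ t)).
Proof.
move=> mb; apply: (measurability _ (ErealGenCInfty.measurableE R)).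
move=> _ [_ [a ->] <-]; rewrite setTI.
rewrite (_ : _ @^-1` _ = \bigcap_j ~` [set t | (0 < b j t < a)%R]); last first.
  apply/seteqP; split => t /=; rewrite in_itv/= andbT.
    by move=> /le_nearest_right h j _; exact: h.
  by move=> h; apply/le_nearest_right => j; exact: (h j).
apply: bigcapT_measurable => j; apply: measurableC.
rewrite (_ : [set t | _] = b j @^-1` `]0%R, a[); last first.
  by apply/seteqP; split => t /=; rewrite in_itv.
by rewrite -[X in measurable X]setTI; apply: mb => //; exact: measurable_itv.
Qed.

Lemma measurable_nearest_left d (T : measurableType d) (b : nat -> T -> R) :
  (forall j, measurable_fun setT (b j)) ->
  measurable_fun setT (fun t => nearest_left (b ^~ t)).
Proof.
move=> mb; under eq_fun do rewrite nearest_leftE.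
apply: (@measurable_nearest_right _ T (fun j t => - b j t)%R) => j.
exact: measurableT_comp.
Qed.

End nearest.

Section blockage_law.
Context (R : realType) d (T : measurableType d) (P : probability T R).
Variables (mu : R) (Y : nat -> {RV P >-> R}).
Hypothesis mu0 : (0 < mu)%R.
Hypothesis PPPY : homogeneous_PPP mu Y.
Local Notation leb := (@lebesgue_measure R).
Let q w := nearest_right (Y ^~ w).
Let q' w := nearest_left (Y ^~ w).

Lemma PPP_empty2 (A B : set R) : measurable A -> measurable B ->
  leb A < +oo -> leb B < +oo -> A `&` B = set0 ->
  P [set w | (forall i, ~ A (Y i w)) /\ (forall i, ~ B (Y i w))] =
  (expR (- (mu * fine (leb A))))%:E * (expR (- (mu * fine (leb B))))%:E.
Proof.
move=> mA mB Aoo Boo AB.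
have := PPPY (A := fun j : 'I_2 => if j == ord0 then A else B) (fun _ : 'I_2 => 0%N).
rewrite !big_ord_recl big_ord0 /= !expr0 fact0 divr1 !mul1r mulr1 EFinM => <-.
- congr (P _); apply/seteqP; split => w /=.
    move=> [hA hB] j; apply/point_count_eq0; case: ifP => _ //.
  by move=> h; split; apply/point_count_eq0; [exact: (h ord0)|exact: (h (lift ord0 ord0))].
- by move=> j; case: ifP.
- by move=> j; case: ifP.
move=> i j _ _; case: ifPn => i0; case: ifPn => j0 [x [h1 h2]].
- by rewrite (eqP i0) (eqP j0).
- by have : (A `&` B) x; [|rewrite AB].
- by have : (A `&` B) x; [|rewrite AB].
- by apply/val_inj; case: i j i0 j0 {h1 h2} => [[|[]]//= ?] [[|[]]].
Qed.

(** No blockage falls in ]0, s[ and none in ]- t, 0[: void events of disjoint sets, hence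
    independent. The maxima cover nonpositive thresholds, for which the event is certain. *)
Lemma nearest_joint_tail s t :
  P ([set w | s%:E <= q w] `&` [set w | t%:E <= q' w]) =
  (expR (- (mu * Num.max s 0)))%:E * (expR (- (mu * Num.max t 0)))%:E.
Proof.
have leb0 (a : R) : leb `]0%R, a[ = (Num.max a 0)%:E.
  rewrite lebesgue_measure_itv/= lte_fin; have [a0|a0] := ltP 0%R a.
    by rewrite -EFinB subr0.
  by [].
have lebN (a : R) : leb `](- a)%R, 0%R[ = (Num.max a 0)%:E.
  rewrite lebesgue_measure_itv/= lte_fin oppr_lt0; have [a0|a0] := ltP 0%R a.
    by rewrite -EFinB sub0r opprK.
  by [].
rewrite -[X in (mu * X)%R]/(fine (Num.max s 0)%:E) -leb0.
rewrite -[X in _ * (expR (- (mu * X)))%:E]/(fine (Num.max t 0)%:E) -lebN.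
rewrite -PPP_empty2 ?leb0 ?lebN ?ltry//.
- congr (P _); apply/seteqP; split => w /= [h1 h2]; split.
  + by move=> i; rewrite in_itv/=; move/le_nearest_right : h1; exact.
  + move=> i; rewrite in_itv/= => /andP[h3 h4].
    move: h2; rewrite /q' nearest_leftE => /le_nearest_right/(_ i); apply.
    by rewrite oppr_gt0 h4 ltrNl.
  + by apply/le_nearest_right => j; have := h1 j; rewrite in_itv.
  + rewrite /q' nearest_leftE; apply/le_nearest_right => j /andP[h3 h4].
    by apply: (h2 j); rewrite in_itv/= ltrNl h4 -oppr_gt0.
- by apply/seteqP; split => // x /= []; rewrite !in_itv/= => /andP[h _] /andP[_ /(lt_trans h)]; rewrite ltxx.
Qed.

Let mq : measurable_fun setT q.
Proof. by apply: (@measurable_nearest_right _ _ T Y). Qed.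

Let mq' : measurable_fun setT q'.
Proof. by apply: (@measurable_nearest_left _ _ T Y). Qed.

Lemma nearest_right_ge0 (b : nat -> R) : 0 <= nearest_right b.
Proof. by apply/le_nearest_right => j /andP[h1 /(lt_trans h1)]; rewrite ltxx. Qed.

Lemma nearest_left_ge0 (b : nat -> R) : 0 <= nearest_left b.
Proof. by rewrite nearest_leftE; exact: nearest_right_ge0. Qed.

Lemma nearest_right_tail s :
  P [set w | s%:E <= q w] = (expR (- (mu * Num.max s 0)))%:E.
Proof.
have := nearest_joint_tail s 0.
rewrite (maxxx (0%R : R)) mulr0 oppr0 expR0 mule1 => <-; congr (P _); rewrite [X in _ `&` X](_ : _ = setT) ?setIT//.
by apply/seteqP; split => // w _ /=; exact: nearest_left_ge0.
Qed.

Lemma nearest_left_tail t :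
  P [set w | t%:E <= q' w] = (expR (- (mu * Num.max t 0)))%:E.
Proof.
have := nearest_joint_tail 0 t.
rewrite (maxxx (0%R : R)) mulr0 oppr0 expR0 mul1e => <-; congr (P _); rewrite [X in X `&` _](_ : _ = setT) ?setTI//.
by apply/seteqP; split => // w _ /=; exact: nearest_right_ge0.
Qed.

Let tails (r : T -> \bar R) : set (set T) :=
  [set A | exists s : R, A = [set w | s%:E <= r w]].

Let tails_setI r : setI_closed (tails r).
Proof.
move=> _ _ [s ->] [t ->]; exists (Num.max s t); apply/seteqP; split => w /=.
  by move=> [h1 h2]; rewrite EFin_max ge_max h1.
by rewrite EFin_max ge_max => /andP[].
Qed.

Let tails_measurable r : measurable_fun setT r -> tails r `<=` measurable.
Proof.
move=> mr _ [s ->]; have := @measurable_lee _ _ R setT measurableT (cst s%:E) r.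
by rewrite setTI; exact.
Qed.

Let tails_generate (r : T -> \bar R) (B : set (\bar R)) : measurable B -> <<s tails r >> (r @^-1` B).
Proof.
move=> mB; rewrite -[r @^-1` B]setTI.
have mr : measurable_fun setT (r : g_sigma_algebraType (tails r) -> \bar R).
  apply: (measurability _ (ErealGenCInfty.measurableE R)) => _ [_ [a ->] <-].
  rewrite setTI; apply: sub_sigma_algebra; exists a.
  by apply/seteqP; split => w /=; rewrite in_itv/= andbT.
exact: mr.
Qed.

(** The joint tail factorizes, and the tail events of each distance are a pi-system generating its
    events. *)
Lemma nearest_indep A B : measurable A -> measurable B ->
  P (q @^-1` A `&` q' @^-1` B) = P (q @^-1` A) * P (q' @^-1` B).
Proof.
move=> mA mB; apply: (@indep_pi_system _ _ _ P (tails q) (tails q')) => //.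
- exact: tails_measurable.
- exact: tails_measurable.
- move=> _ _ [s ->] [t ->].
  by rewrite nearest_joint_tail nearest_right_tail nearest_left_tail.
- exact: tails_generate.
- exact: tails_generate.
Qed.

(** On closed rays of [\bar R] the law of [r] agrees with the image of the exponential law under
    [EFin], hence on all Borel sets. That [r] is almost surely finite is part of this
    identification. *)
Lemma integral_exponential_tail (r : T -> \bar R) (f : \bar R -> \bar R) :
  measurable_fun setT r ->
  (forall s, P [set w | s%:E <= r w] = (expR (- (mu * Num.max s 0)))%:E) ->
  measurable_fun setT f -> (forall x, 0 <= f x) ->
  \int[P]_w f (r w) =
  \int[leb]_(x in `]0%R, +oo[) (f x%:E * (mu * expR (- (mu * x)))%:E).
Proof.
move=> mr tailr mf f0.
pose r' : {mfun T >-> \bar R} := HB.pack r (isMeasurableFun.Build _ _ _ _ r mr).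
have mE : measurable_fun setT (EFin : measurableTypeR R -> \bar R).
  exact/measurable_EFinP/measurable_id.
pose E : {mfun measurableTypeR R >-> \bar R} := HB.pack (EFin : measurableTypeR R -> \bar R) (isMeasurableFun.Build _ _ _ _ _ mE).
pose nu : {measure set (measurableTypeR R) -> \bar R} := exponential_prob mu.
pose m := nu mu0.
have mA A : measurable A -> m A = \int[leb]_(x in A) (exponential_pdf mu x)%:E by [].
have mray s : m (EFin @^-1` `[s%:E, +oo[) = (expR (- (mu * Num.max s 0)))%:E.
  have mpdf D : measurable_fun D (EFin \o exponential_pdf mu).
    by apply/measurable_EFinP/measurable_funTS; exact: measurable_exponential_pdf.
  have -> : EFin @^-1` `[s%:E, +oo[ = `[s, +oo[%classic.
    by apply/seteqP; split => x; rewrite /preimage/= !in_itv/= !andbT.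
  rewrite -exponential_prob_gt// ?le_max ?lexx ?orbT// /exponential_prob.
  rewrite integral_itv_obnd_cbnd; last exact: mpdf.
  rewrite -[LHS]/(\int[leb]_(x in _) (exponential_pdf mu x)%:E).
  rewrite integral_mkcond [RHS]integral_mkcond; apply: eq_integral => x _.
  rewrite !patchE; have [x0|x0] := ltP x 0%R; first by rewrite lt0_exponential_pdf// !if_same.
  by rewrite !mem_setE !in_itv/= !andbT ge_max x0 andbT.
rewrite -(@ge0_integral_distribution _ _ _ _ _ P r')//.
transitivity (\int[pushforward m E]_y f y).
  have mG : (measurable : set (set \bar R)) = <<s @ErealGenCInfty.G R >>.
    exact: ErealGenCInfty.measurableE.
  apply: eq_measure_integral => A; rewrite mG => GA _.
  apply: (@finite_measure_unique _ _ _ (distribution P r') (pushforward m E)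
    (@ErealGenCInfty.G R)) GA.
  - by move=> _ [s ->]; exact: emeasurable_itv.
  - move=> _ _ [s ->] [t ->]; exists (Num.max s t); apply/seteqP; split => x /=.
      by rewrite !in_itv/= !andbT EFin_max ge_max => -[-> ->].
    by rewrite !in_itv/= !andbT EFin_max ge_max => /andP[].
  - transitivity (1 : \bar R); first exact: (probability_setT P).
    by rewrite -[RHS]/(m setT) mA// integral_exponential_pdf.
  - by rewrite [ltLHS](probability_setT P) ltry.
  - move=> _ [s ->]; rewrite /distribution/= /pushforward mray -tailr; congr (P _).
    by apply/seteqP; split => w /=; rewrite in_itv/= andbT.
rewrite ge0_integral_pushforward// preimage_setT.
rewrite (@ge0_integral_density _ _ _ leb m (exponential_pdf mu))//; last 4 first.
- exact: measurable_exponential_pdf.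
- by move=> x; rewrite exponential_pdf_ge0// ltW.
- exact: (measurableT_comp mf mE).
- by move=> x; exact: f0.
rewrite integral_itv_obnd_cbnd; last first.
  apply: measurable_funTS; apply: emeasurable_funM; first exact: measurableT_comp.
  apply/measurable_EFinP; apply: measurable_funM => //; apply: measurableT_comp => //.
  by apply: measurableT_comp => //; exact: measurable_funM.
rewrite [RHS]integral_mkcond; apply: eq_integral => x _; rewrite patchE.
case: ifPn; rewrite ?inE ?notin_setE/= in_itv/= andbT => x0.
  by rewrite exponential_pdfE// mulNr.
by rewrite lt0_exponential_pdf ?mule0// ltNge; exact/negP.
Qed.

Lemma integral_nearest (g : \bar R * \bar R -> \bar R) :
  measurable_fun setT g -> (forall z, 0 <= g z) ->
  \int[P]_w g (q w, q' w) =
  \int[leb]_(x in `]0%R, +oo[) \int[leb]_(x' in `]0%R, +oo[)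
    (g (x%:E, x'%:E) * (mu ^+ 2 * expR (- (mu * x') - mu * x))%:E).
Proof.
move=> mg g0.
rewrite (ge0_integral_indep mq mq' nearest_indep mg g0).
rewrite (@integral_exponential_tail q (fun x => \int[P]_w' g (x, q' w')))//; last 3 first.
- exact: nearest_right_tail.
- apply: (@measurable_fun_fubini_tonelli_F _ _ _ T R P (fun z : \bar R * T => g (z.1, q' z.2))).
    apply: (measurableT_comp mg); apply: measurable_fun_pair => //.
    exact: (measurableT_comp mq').
  by move=> z; exact: g0.
- by move=> x; exact: integral_ge0.
apply: eq_integral => x _.
have mgx : measurable_fun setT (fun y => g (x%:E, y)) by exact: measurableT_comp mg (measurable_pair1 _).
rewrite (@integral_exponential_tail q' (fun y => g (x%:E, y)))//; last exact: nearest_left_tail.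
rewrite -ge0_integralZr//; last 3 first.
- apply: measurable_funTS; apply: emeasurable_funM.
    apply: (measurableT_comp mgx); exact/measurable_EFinP/measurable_id.
  apply/measurable_EFinP; apply: measurable_funM => //; apply: measurableT_comp => //.
  by apply: measurableT_comp => //; exact: measurable_funM.
- by move=> y _; rewrite mule_ge0// lee_fin mulr_ge0 ?expR_ge0// ltW.
- by rewrite lee_fin mulr_ge0 ?expR_ge0// ltW.
apply: eq_integral => y _; rewrite -muleA -EFinM; congr (_ * _%:E).
rewrite expRD expr2; ring.
Qed.

End blockage_law.

(** * Averaging over fading, base stations and blockages *)

Section events.
Context {R : realType}.
Variables (ell : link -> R -> R) (noise tau : R).
Hypothesis noise0 : (0 < noise)%R.
Hypothesis tau0 : (0 < tau)%R.
Hypothesis path_loss_ell : forall s, path_loss (ell s).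

Definition coverage_event (x b h : nat -> R) i :=
  serving ell x b i /\ tau%:E < sinr ell noise x b h i.

(** When SINR > tau the station has positive mean power, so an infinite penalty can only come from a
    violated exclusion radius. Serving is thereby expressed by [penalty], whose measurability is
    known. *)
Lemma coverage_eventE x b h i :
  let q := nearest_right b in let q' := nearest_left b in
  coverage_event x b h i <->
  (forall j, j != i ->
    penalty ell tau (typ q q' (x i)) q q' (x i) (x j) != +oo) /\
  tau%:E < sinr ell noise x b h i.
Proof.
move=> q q'; rewrite /coverage_event; split=> -[hs hc]; split => //.
  move: hc; rewrite coverage_raceE// => /andP[a0 _] j ji.
  move/servingE : hs => /(_ j ji) hs.
  move: hs; rewrite -/q -/q' => hs; rewrite /penalty (negbTE hs).
  by rewrite (gt_eqF (a0 : (0 < ell (typ q q' (x i)) `|x i|)%R)).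
apply/servingE => j ji; have := hs j ji; rewrite /penalty; case: ifPn => //.
by rewrite negb_or => /andP[].
Qed.

Lemma measurable_coverage_event d (S : measurableType d) (x b h : nat -> S -> R) i :
  (forall j, measurable_fun setT (x j)) -> (forall j, measurable_fun setT (b j)) ->
  (forall j, measurable_fun setT (h j)) ->
  measurable [set t | coverage_event (x ^~ t) (b ^~ t) (h ^~ t) i].
Proof.
move=> mx mb mh.
pose q t := nearest_right (b ^~ t); pose q' t := nearest_left (b ^~ t).
have mq : measurable_fun setT q by exact: measurable_nearest_right.
have mq' : measurable_fun setT q' by exact: measurable_nearest_left.
have mset (c : S -> bool) : measurable_fun setT c -> measurable [set t | c t].
  by move=> mc; have := mc measurableT [set true] I; rewrite setTI.
rewrite (_ : [set t | _] = (\bigcap_(j in [set j | j != i]) [set t |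
    penalty ell tau (typ (q t) (q' t) (x i t)) (q t) (q' t) (x i t) (x j t) != +oo])
  `&` [set t | tau%:E < sinr ell noise (x ^~ t) (b ^~ t) (h ^~ t) i]); last first.
  by apply/seteqP; split => t /coverage_eventE.
apply: measurableI.
  apply: bigcap_measurableType => j _.
  apply: (mset (fun t => penalty ell tau _ _ _ _ _ != +oo)).
  apply: measurable_neg; apply: measurable_fun_eqe => //.
  exact: measurable_typ_penalty.
apply: (mset (fun t => tau%:E < sinr ell noise (x ^~ t) (b ^~ t) (h ^~ t) i)).
under eq_fun do rewrite coverage_raceE//.
rewrite -/(measurable_fun _ _).
have mg j : measurable_fun setT (fun t => gain ell (q t) (q' t) (x j t)).
  exact: measurable_gain.
have mgi : measurable_fun setT (fun t => (gain ell (q t) (q' t) (x i t))^-1)%R.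
  by apply: measurable_inv_nneg => // t; exact: gain_ge0.
apply: measurable_and; first exact: measurable_fun_ltr.
apply: measurable_fun_lte; last exact/measurable_EFinP.
apply: emeasurable_funD; first by apply/measurable_EFinP; exact: measurable_funM.
apply: (@ge0_emeasurable_sum _ _ _ _ _ (predC1 i)).
  move=> j t _ _; rewrite lee_fin mulr_ge0 ?le_max ?lexx ?orbT//.
  by rewrite mulr_ge0 ?(ltW tau0)// divr_ge0// gain_ge0.
move=> j _; apply/measurable_EFinP; apply: measurable_funM; last exact: measurable_pos_part.
by apply: measurable_funM => //; exact: measurable_funM.
Qed.

End events.

Section decoupling.
Context (R : realType) d (T : measurableType d) (P : probability T R).
Context dX (TX : measurableType dX) dY (TY : measurableType dY)
  dH (TH : measurableType dH).
Variables (iX : T -> TX) (iY : T -> TY) (iH : T -> TH).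
Hypothesis miX : measurable_fun setT iX.
Hypothesis miY : measurable_fun setT iY.
Hypothesis miH : measurable_fun setT iH.
Hypothesis indep : forall A B C, measurable A -> measurable B -> measurable C ->
  P (iX @^-1` A `&` iY @^-1` B `&` iH @^-1` C) =
  P (iX @^-1` A) * P (iY @^-1` B) * P (iH @^-1` C).

Let preimage_measurable d' (U : measurableType d') (f : T -> U) A :
  measurable_fun setT f -> measurable A -> measurable (f @^-1` A).
Proof. by move=> mf mA; rewrite -[X in measurable X]setTI; exact: mf. Qed.

Lemma indep2 A B : measurable A -> measurable B ->
  P (iX @^-1` A `&` iY @^-1` B) = P (iX @^-1` A) * P (iY @^-1` B).
Proof.
move=> mA mB; have := indep mA mB measurableT.
by rewrite preimage_setT setIT probability_setT mule1.
Qed.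

Let pairXY w := (iX w, iY w).

(** Rectangles form a pi-system generating the events of the pair, and on them the triple product
    formula is the claim. *)
Lemma indep_pair E C : measurable E -> measurable C ->
  P (pairXY @^-1` E `&` iH @^-1` C) = P (pairXY @^-1` E) * P (iH @^-1` C).
Proof.
move=> mE mC.
pose G : set (set T) := [set D | exists A B,
  [/\ measurable A, measurable B & D = iX @^-1` A `&` iY @^-1` B]].
apply: (@indep_pi_system_left _ _ _ P G).
- move=> _ [A [B [mA mB ->]]].
  by apply: measurableI; exact: preimage_measurable.
- move=> _ _ [A [B [mA mB ->]]] [A' [B' [mA' mB' ->]]].
  exists (A `&` A'), (B `&` B'); split; [exact: measurableI|exact: measurableI|].
  by rewrite !preimage_setI setIACA.
- exact: preimage_measurable.
- by move=> _ [A [B [mA mB ->]]]; rewrite indep// indep2.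
have mp : measurable_fun setT (pairXY : g_sigma_algebraType G -> _).
  apply: measurable_fun_pair => _ A mA; rewrite setTI; apply: sub_sigma_algebra.
    by exists A, setT; split => //; rewrite preimage_setT setIT.
  by exists setT, A; split => //; rewrite preimage_setT setTI.
by rewrite -[X in <<s G>> X]setTI; exact: mp.
Qed.

Variables (x : nat -> TX -> R) (b : nat -> TY -> R) (h : nat -> TH -> R).
Hypothesis mx : forall j, measurable_fun setT (x j).
Hypothesis mb : forall j, measurable_fun setT (b j).
Hypothesis mh : forall j, measurable_fun setT (h j).
Variables (ell : link -> R -> R) (noise tau : R).
Hypothesis noise0 : (0 < noise)%R.
Hypothesis tau0 : (0 < tau)%R.
Hypothesis path_loss_ell : forall s, path_loss (ell s).
Let cov (z1 : TX) (z2 : TY) (z3 : TH) i :=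
  coverage_event ell noise tau (x ^~ z1) (b ^~ z2) (h ^~ z3) i.

(** Stations and blockages are kept at w while the fading is redrawn at w'. *)
Lemma coverage_event_decouple i :
  P [set w | cov (iX w) (iY w) (iH w) i] =
  \int[P]_w P [set w' | cov (iX w) (iY w) (iH w') i].
Proof.
pose ev (z : (TX * TY) * TH) := cov z.1.1 z.1.2 z.2 i.
have mev : measurable [set z | ev z].
  apply: (@measurable_coverage_event _ ell noise tau noise0 tau0 path_loss_ell _
    ((TX * TY) * TH)%type
    (fun j z => x j z.1.1) (fun j z => b j z.1.2) (fun j z => h j z.2)) => j.
  - by apply: (measurableT_comp (mx j)); exact: measurableT_comp.
  - by apply: (measurableT_comp (mb j)); exact: measurableT_comp.
  - exact: (measurableT_comp (mh j)).
have mpair : measurable_fun setT pairXY by exact: measurable_fun_pair.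
have indicE_ (u : T -> (TX * TY) * TH) : measurable_fun setT u ->
    \int[P]_w (\1_[set z | ev z] (u w))%:E = P [set w | ev (u w)].
  move=> mu; rewrite -[X in P X]setIT -integral_indic//.
  by rewrite -[X in measurable X]setTI; exact: (mu measurableT _ mev).
transitivity (\int[P]_w (\1_[set z | ev z] (pairXY w, iH w))%:E).
  by rewrite indicE_//; exact: measurable_fun_pair.
rewrite (@ge0_integral_indep _ _ _ P _ _ _ _ pairXY iH
  (fun z => (\1_[set z | ev z] z)%:E))//.
- by apply: eq_integral => w _; rewrite (indicE_ (fun w' => (pairXY w, iH w')))//;
    exact: measurable_fun_pair.
- exact: indep_pair.
- by apply/measurable_EFinP; exact: measurable_indic.
Qed.

(** Now the blockages are kept at w and the stations are redrawn at w'. *)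
Lemma coverage_weight_decouple i :
  let q w := nearest_right (b ^~ (iY w)) in
  let q' w := nearest_left (b ^~ (iY w)) in
  \int[P]_w coverage_weight ell noise tau (q w) (q' w) (x ^~ (iX w)) i =
  \int[P]_w \int[P]_w' coverage_weight ell noise tau (q w) (q' w) (x ^~ (iX w')) i.
Proof.
move=> q q'.
pose g (z : TY * TX) := coverage_weight ell noise tau
  (nearest_right (b ^~ z.1)) (nearest_left (b ^~ z.1)) (x ^~ z.2) i.
apply: (@ge0_integral_indep _ _ _ P _ _ _ _ iY iX g miY miX).
- by move=> A B mA mB; rewrite setIC muleC; exact: indep2.
- apply: (@measurable_coverage_weight _ ell noise tau tau0 path_loss_ell _ (TY * TX)%type
    (fun j z => x j z.2) (fun z => nearest_right (b ^~ z.1)) (fun z => nearest_left (b ^~ z.1))).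
  + by move=> j; exact: (measurableT_comp (mx j)).
  + apply: (measurable_nearest_right (b := fun j (z : TY * TX) => b j z.1)) => j.
    exact: (measurableT_comp (mb j)).
  + apply: (measurable_nearest_left (b := fun j (z : TY * TX) => b j z.1)) => j.
    exact: (measurableT_comp (mb j)).
- by move=> z; exact: coverage_weight_ge0.
Qed.

End decoupling.

Section coverage.
Context (R : realType) d (T : measurableType d) (P : probability T R).
Variables (X Y H : nat -> {RV P >-> R}).
Hypothesis XYH_indep : independent_families X Y H.
Variables (ell : link -> R -> R) (noise tau : R).
Hypothesis noise0 : (0 < noise)%R.
Hypothesis tau0 : (0 < tau)%R.
Hypothesis path_loss_ell : forall s, path_loss (ell s).
Hypothesis iidH : iid_exponential H.
Local Notation leb := (@lebesgue_measure R).

Let q w := nearest_right (Y ^~ w).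
Let q' w := nearest_left (Y ^~ w).
Let cov_event w i := coverage_event ell noise tau (X ^~ w) (Y ^~ w) (H ^~ w) i.

(** The random elements are the identity maps of T into T with the sigma-algebra generated by X, by
    Y or by H; independence of the families is then independence of three measurable maps. The
    fading is averaged by [coverage_given], after which the stations are decoupled from the
    blockages. *)
Lemma coverage_event_prob i :
  P [set w | cov_event w i] =
  \int[P]_w \int[P]_w' coverage_weight ell noise tau (q w) (q' w) (X ^~ w') i.
Proof.
pose gen (Z : nat -> {RV P >-> R}) := [set A : set T |
  exists i, exists2 B : set R, measurable B & A = Z i @^-1` B].
have gen_sub Z : gen Z `<=` measurable.
  by move=> _ [j [B mB ->]]; exact: measurable_funPTI.
have mid Z : measurable_fun setT (idfun : T -> g_sigma_algebraType (gen Z)).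
  move=> _ A mA; rewrite setTI.
  exact: (smallest_sub (sigma_algebra_measurable T) (gen_sub Z)).
have mZ Z j : measurable_fun setT (Z j : g_sigma_algebraType (gen Z) -> R).
  by move=> _ B mB; rewrite setTI; apply: sub_sigma_algebra; exists j; exists B.
have ind (A : set (g_sigma_algebraType (gen X))) (B : set (g_sigma_algebraType (gen Y)))
    (C : set (g_sigma_algebraType (gen H))) :
    measurable A -> measurable B -> measurable C ->
    P (idfun @^-1` A `&` idfun @^-1` B `&` idfun @^-1` C) =
    P (idfun @^-1` A) * P (idfun @^-1` B) * P (idfun @^-1` C).
  exact: XYH_indep.
have e1 := @coverage_event_decouple R _ T P _ (g_sigma_algebraType (gen X))
  _ (g_sigma_algebraType (gen Y)) _ (g_sigma_algebraType (gen H))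
  idfun idfun idfun (mid X) (mid Y) (mid H) ind X Y H (mZ X) (mZ Y) (mZ H)
  ell noise tau noise0 tau0 path_loss_ell i.
have e2 := @coverage_weight_decouple R _ T P _ (g_sigma_algebraType (gen X))
  _ (g_sigma_algebraType (gen Y)) _ (g_sigma_algebraType (gen H))
  idfun idfun idfun (mid X) (mid Y) ind X Y (mZ X) (mZ Y)
  ell noise tau tau0 path_loss_ell i.
apply: (etrans e1); apply: (etrans _ e2); apply: eq_integral => w _.
exact: (coverage_given noise0 tau0 path_loss_ell iidH).
Qed.

Variables (lam mu : R).
Hypothesis lam0 : (0 < lam)%R.
Hypothesis mu0 : (0 < mu)%R.
Hypothesis PPPX : homogeneous_PPP lam X.
Hypothesis PPPY : homogeneous_PPP mu Y.

Let mq : measurable_fun setT q.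
Proof. by apply: (@measurable_nearest_right _ _ T Y). Qed.

Let mq' : measurable_fun setT q'.
Proof. by apply: (@measurable_nearest_left _ _ T Y). Qed.

(** After exchanging sum and expectation, (q, q') is integrated against its joint density, which
    lives on positive distances, where [coverage_weight_total] applies. *)
Lemma sum_coverage_event :
  \sum_(0 <= i <oo) P [set w | cov_event w i] =
  \int[leb]_(a in `]0%R, +oo[) \int[leb]_(a' in `]0%R, +oo[)
    ((right_half ell noise tau lam a a' + right_half ell noise tau lam a' a) *
     (mu ^+ 2 * expR (- (mu * a') - mu * a))%:E).
Proof.
pose Gi i (z : \bar R * \bar R) :=
  \int[P]_w' coverage_weight ell noise tau z.1 z.2 (X ^~ w') i.
pose G z := \sum_(0 <= i <oo) Gi i z.
have Gi0 i z : 0 <= Gi i z by apply: integral_ge0 => w _; exact: coverage_weight_ge0.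
have mGi i : measurable_fun setT (Gi i).
  apply: (@measurable_fun_fubini_tonelli_F _ _ _ T R P
    (fun y : (\bar R * \bar R) * T => coverage_weight ell noise tau y.1.1 y.1.2 (X ^~ y.2) i)).
    apply: (@measurable_coverage_weight _ ell noise tau tau0 path_loss_ell _
      ((\bar R * \bar R) * T)%type (fun j y => X j y.2) (fun y => y.1.1) (fun y => y.1.2)).
    - by move=> j; exact: measurableT_comp.
    - exact: measurableT_comp.
    - exact: measurableT_comp.
  by move=> y; exact: coverage_weight_ge0.
have mG : measurable_fun setT G.
  by apply: (@ge0_emeasurable_sum _ _ _ _ _ xpredT) => // i z _ _; exact: Gi0.
have G0 z : 0 <= G z by apply: nneseries_ge0 => i _ _; exact: Gi0.
transitivity (\int[P]_w G (q w, q' w)).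
  rewrite /G integral_nneseries//; last first.
    by move=> i; apply: (measurableT_comp (mGi i)); exact: measurable_fun_pair.
  by apply: eq_eseriesr => i _; exact: coverage_event_prob.
rewrite (integral_nearest mu0 PPPY mG G0); apply: eq_integral => a; rewrite inE/=.
rewrite in_itv/= andbT => a0; apply: eq_integral => a'; rewrite inE/= in_itv/= andbT => a'0.
congr (_ * _).
exact: (coverage_weight_total noise0 tau0 lam0 path_loss_ell PPPX a0 a'0).
Qed.

(** Almost surely a single station serves, so at most one of the events holds and the indicator of
    their union is the sum of the indicators. *)
Lemma covered_sum :
  {ae P, forall w, exists! i, serving ell (X ^~ w) (Y ^~ w) i} ->
  coverage_probability ell noise tau X Y H =
  \sum_(0 <= i <oo) P [set w | cov_event w i].
Proof.
move=> uniq_serving; pose C i := [set w | cov_event w i].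
have mC i : measurable (C i).
  by apply: (@measurable_coverage_event _ ell noise tau noise0 tau0 path_loss_ell _ T X Y H).
have covE : covered ell noise tau X Y H = \bigcup_i C i.
  by apply/seteqP; split => w [i]; [move=> h1 h2; exists i|move=> _ [h1 h2]; exists i].
have mcov : measurable (covered ell noise tau X Y H).
  by rewrite covE; exact: bigcupT_measurable.
rewrite /coverage_probability -[X in P X]setIT -integral_indic//.
transitivity (\int[P]_w \sum_(0 <= i <oo) (\1_(C i) w)%:E); last first.
  rewrite integral_nneseries//; last first.
    by move=> i; apply/measurable_EFinP; exact: measurable_indic.
  by apply: eq_eseriesr => i _; rewrite integral_indic// setIT.
apply: ge0_ae_eq_integral => //.
- by apply/measurable_EFinP; exact: measurable_indic.
- apply: (@ge0_emeasurable_sum _ _ _ _ _ xpredT) => //.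
  by move=> i _; apply/measurable_EFinP; exact: measurable_indic.
- by move=> w _; apply: nneseries_ge0 => i _ _; rewrite lee_fin.
apply: filterS uniq_serving => w [i [si ui]] _ /=.
rewrite (@nneseriesD1 _ _ i)//=.
rewrite eseries0 ?adde0; last first.
  move=> k _ ki; rewrite indicE memNset// => -[sk _].
  by move: ki; rewrite (ui k sk) eqxx.
rewrite !indicE; congr ((nat_of_bool _)%:R%:E); apply/idP/idP; rewrite !inE.
  by move=> [k sk ck]; rewrite (ui k sk).
by move=> [h1 h2]; exists i.
Qed.

End coverage.

(** * Order of integration and assembly of the formula *)

Lemma addee_self (R : realType) (e : \bar R) : e + e = 2%:E * e.
Proof.
case: e => [r| |].
- by rewrite -EFinD -EFinM mulr_natl mulr2n.
- by rewrite gt0_muley ?lte_fin.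
- by rewrite gt0_muleNy ?lte_fin.
Qed.

Lemma integral2D (R : realType) (f g : measurableTypeR R * measurableTypeR R -> \bar R) :
  measurable_fun setT f -> (forall p, 0 <= f p) ->
  measurable_fun setT g -> (forall p, 0 <= g p) ->
  \int[@lebesgue_measure R]_a \int[@lebesgue_measure R]_a' (f (a, a') + g (a, a')) =
  \int[@lebesgue_measure R]_a \int[@lebesgue_measure R]_a' f (a, a') +
  \int[@lebesgue_measure R]_a \int[@lebesgue_measure R]_a' g (a, a').
Proof.
move=> mf f0 mg g0; rewrite -ge0_integralD//; last 4 first.
- by move=> q _; exact: integral_ge0.
- exact: (@measurable_fun_fubini_tonelli_F _ _ _ _ R _ f mf f0).
- by move=> q _; exact: integral_ge0.
- exact: (@measurable_fun_fubini_tonelli_F _ _ _ _ R _ g mg g0).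
apply: eq_integral => q _; rewrite ge0_integralD//.
- exact: (measurableT_comp mf (measurable_pair1 q)).
- exact: (measurableT_comp mg (measurable_pair1 q)).
Qed.

Section tonelli3.
Context {R : realType}.
Local Notation leb := (@lebesgue_measure R).
Local Notation M := (measurableTypeR R).
Variable F : (M * M) * M -> \bar R.
Hypothesis mF : measurable_fun setT F.
Hypothesis F0 : forall z, 0 <= F z.

Let mF3 (a : M) : measurable_fun setT (fun p : M * M => F ((a, p.1), p.2)).
Proof.
apply: (measurableT_comp mF); apply: measurable_fun_pair; last exact: measurable_snd.
by apply: measurable_fun_pair => //; exact: measurable_cst.
Qed.

Let mFx : measurable_fun setT (fun p : M * M => \int[leb]_a' F ((p.1, a'), p.2)).
Proof.
apply: (@measurable_fun_fubini_tonelli_F _ _ (M * M)%type M R leb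
  (fun z : (M * M) * M => F ((z.1.1, z.2), z.1.2))); last by move=> z; exact: F0.
apply: (measurableT_comp mF); apply: measurable_fun_pair.
  apply: measurable_fun_pair; last exact: measurable_snd.
  by apply: (measurableT_comp measurable_fst); exact: measurable_fst.
by apply: (measurableT_comp measurable_snd); exact: measurable_fst.
Qed.

(** Averaging over the blockages leaves x innermost, while the formula has it outermost: x is
    exchanged with q' and then with q. *)
Lemma tonelli3 :
  \int[leb]_a \int[leb]_a' \int[leb]_x F ((a, a'), x) =
  \int[leb]_x \int[leb]_a \int[leb]_a' F ((a, a'), x).
Proof.
transitivity (\int[leb]_a \int[leb]_x \int[leb]_a' F ((a, a'), x)).
  apply: eq_integral => a _.
  exact: (@fubini_tonelli _ _ M M R leb leb (fun p => F ((a, p.1), p.2)) (mF3 a) (fun p => F0 _)).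
apply: (@fubini_tonelli _ _ M M R leb leb (fun p => \int[leb]_a' F ((p.1, a'), p.2)) mFx).
by move=> p; exact: integral_ge0.
Qed.

Lemma integral3Zl (c : R) : (0 <= c)%R ->
  \int[leb]_x \int[leb]_a \int[leb]_a' (c%:E * F ((a, a'), x)) =
  c%:E * \int[leb]_x \int[leb]_a \int[leb]_a' F ((a, a'), x).
Proof.
move=> c0; rewrite -ge0_integralZl//; last 2 first.
- apply: (@measurable_fun_fubini_tonelli_G _ _ M M R leb
    (fun p => \int[leb]_a' F ((p.1, a'), p.2)) mFx).
  by move=> p; exact: integral_ge0.
- by move=> x _; apply: integral_ge0 => a _; exact: integral_ge0.
apply: eq_integral => x _; rewrite -ge0_integralZl//; last 2 first.
- exact: (measurableT_comp mFx (measurable_pair2 x)).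
- by move=> a _; exact: integral_ge0.
apply: eq_integral => a _; rewrite -ge0_integralZl//.
exact: (measurableT_comp (mF3 a) (measurable_pair2 x)).
Qed.

Lemma measurable_tonelli3 : measurable_fun setT (fun p : M * M => \int[leb]_x F (p, x)).
Proof. exact: (@measurable_fun_fubini_tonelli_F _ _ (M * M)%type M R leb F mF F0). Qed.

End tonelli3.

Lemma mule_cancel (R : realType) (l : R) (e c h w : \bar R) : (0 < l)%R ->
  e = l%:E * (c * h) -> c * w * h = (l^-1)%:E * (e * w).
Proof.
move=> l0 ->; rewrite [RHS]muleA (muleA (l^-1)%:E) -EFinM mulVf ?gt_eqF//.
by rewrite mul1e muleAC.
Qed.

Section assembly.
Context {R : realType}.
Variables (ell : link -> R -> R) (noise tau lam mu : R).
Hypothesis noise0 : (0 < noise)%R.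
Hypothesis tau0 : (0 < tau)%R.
Hypothesis lam0 : (0 < lam)%R.
Hypothesis mu0 : (0 < mu)%R.
Hypothesis path_loss_ell : forall s, path_loss (ell s).
Hypothesis excl_lt : forall x, (0 < x)%R ->
  excl ell NLoS LoS x < x%:E /\ x%:E < excl ell LoS NLoS x.
Local Notation leb := (@lebesgue_measure R).
Local Notation M := (measurableTypeR R).

Let w2 (q q' : R) : R := (mu ^+ 2 * expR (- (mu * q') - mu * q))%R.

(* The joint density of (q, q', x), where x is the distance of a serving and
   covered base station of type s on the right half-line. *)
Definition joint s (z : (M * M) * M) : \bar R :=
  if [&& (0 < z.2)%R, (0 < z.1.1)%R, (0 < z.1.2)%R &
      (if s is LoS then z.2 < z.1.1 else z.1.1 < z.2)%R]
  then (density ell noise tau lam s z.1.1%:E z.1.2%:E z.2)%:E * (w2 z.1.1 z.1.2)%:E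
  else 0.

Lemma joint_ge0 s z : 0 <= joint s z.
Proof.
rewrite /joint; case: ifP => // _; rewrite mule_ge0// lee_fin.
  exact: density_ge0.
by rewrite /w2 mulr_ge0 ?expR_ge0// sqr_ge0.
Qed.

Lemma measurable_joint s : measurable_fun setT (joint s).
Proof.
have m11 : measurable_fun setT (fun z : (M * M) * M => z.1.1 : R).
  by apply: (measurableT_comp measurable_fst); exact: measurable_fst.
have m12 : measurable_fun setT (fun z : (M * M) * M => z.1.2 : R).
  by apply: (measurableT_comp measurable_snd); exact: measurable_fst.
have m2 : measurable_fun setT (fun z : (M * M) * M => z.2 : R) by exact: measurable_snd.
have mc : measurable_fun setT (cst 0%R : (M * M) * M -> R) by exact: measurable_cst.
apply: measurable_fun_ifT; last exact: measurable_cst.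
- apply: measurable_and; first exact: measurable_fun_ltr.
  apply: measurable_and; first exact: measurable_fun_ltr.
  apply: measurable_and; first exact: measurable_fun_ltr.
  by case: s; exact: measurable_fun_ltr.
- apply: emeasurable_funM; apply/measurable_EFinP.
    apply: (@measurable_density _ ell noise tau lam tau0 path_loss_ell _ ((M * M) * M)%type
      s (fun z => z.1.1%:E) (fun z => z.1.2%:E) (fun z => z.2)) => //.
    + exact/measurable_EFinP.
    + exact/measurable_EFinP.
  apply: measurable_funM; first exact: measurable_cst.
  apply: (measurableT_comp (@measurable_expR R)).
  apply: measurable_funB; last by apply: measurable_funM => //; exact: measurable_cst.
  apply: (measurableT_comp (@oppr_measurable R setT)).
  by apply: measurable_funM => //; exact: measurable_cst.
Qed.

Lemma joint_eq0 s q q' x : ~~ ((0 < q)%R && (0 < q')%R) -> joint s ((q, q'), x) = 0.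
Proof.
rewrite /joint/= negb_and => /orP[/negbTE ->|/negbTE ->]; by rewrite ?andbF.
Qed.

Lemma right_half_joint (q q' : R) : (0 < q)%R -> (0 < q')%R ->
  right_half ell noise tau lam q q' * (w2 q q')%:E =
  \int[leb]_x joint LoS ((q, q'), x) + \int[leb]_x joint NLoS ((q, q'), x).
Proof.
move=> q0 q'0.
have w0 : (0 <= w2 q q')%R by rewrite /w2 mulr_ge0 ?expR_ge0// sqr_ge0.
have md s D : measurable_fun D
    (fun x => (density ell noise tau lam s q%:E q'%:E x)%:E : \bar R).
  apply/measurable_EFinP; apply: measurable_funTS.
  by apply: (@measurable_density _ ell noise tau lam tau0 path_loss_ell _ R
      s (cst q%:E) (cst q'%:E) idfun) => //; exact: measurable_id.
have d0 s x : 0 <= (density ell noise tau lam s q%:E q'%:E x)%:E.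
  by rewrite lee_fin density_ge0.
have pull s D : measurable D ->
    (\int[leb]_(x in D) (density ell noise tau lam s q%:E q'%:E x)%:E) * (w2 q q')%:E =
    \int[leb]_(x in D) ((density ell noise tau lam s q%:E q'%:E x)%:E * (w2 q q')%:E).
  by move=> mD; rewrite ge0_integralZr//; exact: md.
rewrite /right_half ge0_muleDl; last 2 first.
- by apply: integral_ge0 => x _; exact: d0.
- by apply: integral_ge0 => x _; exact: d0.
congr (_ + _).
  apply: (etrans (pull LoS `]0%R, q[%classic (measurable_itv _))).
  rewrite integral_mkcond; apply: eq_integral => x _; rewrite patchE mem_setE in_itv/=.
  by rewrite /joint q0 q'0.
apply: (etrans (pull NLoS `]q, +oo[%classic (measurable_itv _))).
rewrite integral_mkcond; apply: eq_integral => x _; rewrite patchE mem_setE in_itv/=.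
rewrite andbT /joint q0 q'0; case: ltP => qx; last by rewrite /= andbF.
by rewrite (lt_trans q0 (qx : (q < x)%R)).
Qed.

Lemma right_half_ge0 (q q' : R) : 0 <= right_half ell noise tau lam q q'.
Proof.
by apply: adde_ge0; apply: integral_ge0 => x _; rewrite lee_fin density_ge0.
Qed.

(** The density [w2] of the blockage distances is symmetric and the two halves differ by the
    exchange of q and q', so Tonelli identifies their contributions. *)
Lemma integral_right_halves :
  \int[leb]_(q in `]0%R, +oo[) \int[leb]_(q' in `]0%R, +oo[)
    ((right_half ell noise tau lam q q' + right_half ell noise tau lam q' q) *
     (w2 q q')%:E) =
  2%:E * (\int[leb]_x \int[leb]_q \int[leb]_q' joint LoS ((q, q'), x) +
          \int[leb]_x \int[leb]_q \int[leb]_q' joint NLoS ((q, q'), x)).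
Proof.
pose K (p : M * M) := \int[leb]_x joint LoS (p, x) + \int[leb]_x joint NLoS (p, x).
have mKs s : measurable_fun setT (fun p : M * M => \int[leb]_x joint s (p, x)).
  exact: (measurable_tonelli3 (measurable_joint s) (joint_ge0 s)).
have K0s s p : 0 <= \int[leb]_x joint s (p, x).
  by apply: integral_ge0 => x _; exact: joint_ge0.
have mK : measurable_fun setT K by apply: emeasurable_funD; exact: mKs.
have K0 p : 0 <= K p by apply: adde_ge0; exact: K0s.
have mKsw : measurable_fun setT (fun p : M * M => K (p.2, p.1)).
  by apply: (measurableT_comp mK); exact: measurable_fun_pair.
transitivity (\int[leb]_q \int[leb]_q' (K (q, q') + K (q', q))).
  have Kout q q' : ~~ ((0 < q)%R && (0 < q')%R) -> K (q, q') = 0.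
    by move=> h; rewrite /K !integral0_eq ?adde0// => x _; exact: joint_eq0.
  rewrite integral_mkcond; apply: eq_integral => q _; rewrite patchE.
  rewrite mem_setE in_itv/= andbT; case: (ltP 0%R q) => q0; last first.
    by rewrite integral0_eq// => q' _; rewrite !Kout ?adde0// (le_gtF q0) ?andbF.
  rewrite integral_mkcond; apply: eq_integral => q' _; rewrite patchE.
  rewrite mem_setE in_itv/= andbT; case: (ltP 0%R q') => q'0; last first.
    by rewrite !Kout ?adde0// (le_gtF q'0) ?andbF.
  have w2C : w2 q' q = w2 q q' by rewrite /w2; congr (_ * expR _)%R; ring.
  rewrite ge0_muleDl; [|exact: right_half_ge0|exact: right_half_ge0].
  by congr (_ + _); [exact: right_half_joint|rewrite -w2C; exact: right_half_joint].
apply: (etrans (integral2D mK K0 mKsw (fun p => K0 _))).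
have sw : \int[leb]_q \int[leb]_q' K (q', q) = \int[leb]_q \int[leb]_q' K (q, q').
  exact: (@fubini_tonelli _ _ M M R leb leb (fun p => K (p.2, p.1)) mKsw (fun p => K0 _)).
apply: (etrans (congr2 +%E (erefl _) sw)).
apply: (etrans (addee_self _)); congr (_ * _).
apply: (etrans (integral2D (mKs LoS) (K0s LoS) (mKs NLoS) (K0s NLoS))).
exact: (congr2 +%E (tonelli3 (measurable_joint LoS) (joint_ge0 LoS))
  (tonelli3 (measurable_joint NLoS) (joint_ge0 NLoS))).
Qed.

(** [joint] contains the factor lam of [palm_density], which the formula keeps in front of the
    integrals; hence lam^-1. The domains of integration are those encoded by the condition in
    [joint]. *)
Lemma integral_joint_los :
  \int[leb]_(x in `]0%R, +oo[) \int[leb]_(q in `]x, +oo[)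
    \int[leb]_(q' in `]0%R, +oo[)
      ((noise_factor noise tau (ell LoS x))%:E * kappa_L ell lam tau x q' q *
       (w2 q q')%:E * g_L ell lam x q q') =
  (lam^-1)%:E * \int[leb]_x \int[leb]_q \int[leb]_q' joint LoS ((q, q'), x).
Proof.
have lamV : (0 <= lam^-1)%R by rewrite invr_ge0 ltW.
rewrite -(integral3Zl (measurable_joint LoS) (joint_ge0 LoS) lamV).
rewrite integral_mkcond; apply: eq_integral => x _; rewrite patchE mem_setE in_itv/= andbT.
case: (ltP 0%R x) => x0; last first.
  rewrite integral0_eq// => q _; rewrite integral0_eq// => q' _.
  by rewrite /joint/= (le_gtF x0) mule0.
rewrite integral_mkcond; apply: eq_integral => q _; rewrite patchE mem_setE in_itv/= andbT.
case: (ltP x q) => xq; last first.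
  by rewrite integral0_eq// => q' _; rewrite /joint/= (le_gtF xq) !andbF mule0.
rewrite integral_mkcond; apply: eq_integral => q' _; rewrite patchE mem_setE in_itv/= andbT.
case: (ltP 0%R q') => q'0; last by rewrite /joint/= (le_gtF q'0) !andbF mule0.
rewrite /joint/= x0 xq q'0 (lt_trans x0 xq)/=; apply: mule_cancel => //.
exact: density_los.
Qed.

Lemma integral_joint_nlos :
  \int[leb]_(x in `]0%R, +oo[) \int[leb]_(q in `]0%R, x[)
    \int[leb]_(q' in `]0%R, +oo[)
      ((noise_factor noise tau (ell NLoS x))%:E * kappa_N ell lam tau x q' q *
       (w2 q q')%:E * g_N ell lam x q q') =
  (lam^-1)%:E * \int[leb]_x \int[leb]_q \int[leb]_q' joint NLoS ((q, q'), x).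
Proof.
have lamV : (0 <= lam^-1)%R by rewrite invr_ge0 ltW.
rewrite -(integral3Zl (measurable_joint NLoS) (joint_ge0 NLoS) lamV).
rewrite integral_mkcond; apply: eq_integral => x _; rewrite patchE mem_setE in_itv/= andbT.
case: (ltP 0%R x) => x0; last first.
  rewrite integral0_eq// => q _; rewrite integral0_eq// => q' _.
  by rewrite /joint/= (le_gtF x0) mule0.
rewrite integral_mkcond; apply: eq_integral => q _; rewrite patchE mem_setE in_itv/=.
have [/andP[q0 qx]|qN] := boolP ((0 < q)%R && (q < x)%R); last first.
  rewrite integral0_eq// => q' _; rewrite /joint/=.
  by rewrite x0/= andbCA (negbTE qN) andbF mule0.
rewrite integral_mkcond; apply: eq_integral => q' _; rewrite patchE mem_setE in_itv/= andbT.
case: (ltP 0%R q') => q'0; last by rewrite /joint/= (le_gtF q'0) !andbF mule0.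
rewrite /joint/= x0 q0 qx q'0/=; apply: mule_cancel => //.
exact: density_nlos.
Qed.

End assembly.

Theorem theorem3 (R : realType) (d : measure_display) (T : measurableType d)
    (P : probability T R) (lambda mu noise : R) (ell : link -> R -> R)
    (X Y H : nat -> {RV P >-> R})
    (lambda_gt0 : (0 < lambda)%R) (mu_gt0 : (0 < mu)%R)
    (noise_gt0 : (0 < noise)%R)
    (X_PPP : homogeneous_PPP lambda X)
    (Y_PPP : homogeneous_PPP mu Y)
    (H_iid : iid_exponential H)
    (XYH_indep : independent_families X Y H)
    (ell_path_loss : forall s, path_loss (ell s))
    (ell_NL : forall x, (0 <= x)%R -> (ell NLoS x <= ell LoS x)%R)
    (excl_lt : forall x, (0 < x)%R ->
       excl ell NLoS LoS x < x%:E /\ x%:E < excl ell LoS NLoS x)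
    (serving_unique :
       {ae P, forall w, exists! i, serving ell (X ^~ w) (Y ^~ w) i}) :
  forall tau : R, (0 < tau)%R ->
  coverage_probability ell noise tau X Y H =
    (2 * lambda)%:E *
      (\int[lebesgue_measure]_(x in `]0%R, +oo[)
       \int[lebesgue_measure]_(q in `]x, +oo[)
       \int[lebesgue_measure]_(q' in `]0%R, +oo[)
         ((noise_factor noise tau (ell LoS x))%:E *
          kappa_L ell lambda tau x q' q *
          (mu ^+ 2 * expR (- (mu * q') - mu * q))%:E *
          g_L ell lambda x q q'))
  + (2 * lambda)%:E *
      (\int[lebesgue_measure]_(x in `]0%R, +oo[)
       \int[lebesgue_measure]_(q in `]0%R, x[)
       \int[lebesgue_measure]_(q' in `]0%R, +oo[)
         ((noise_factor noise tau (ell NLoS x))%:E *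
          kappa_N ell lambda tau x q' q *
          (mu ^+ 2 * expR (- (mu * q') - mu * q))%:E *
          g_N ell lambda x q q')).
Proof.
move=> tau tau0.
rewrite (covered_sum H noise_gt0 tau0 ell_path_loss serving_unique).
rewrite (sum_coverage_event XYH_indep noise_gt0 tau0 ell_path_loss H_iid
  lambda_gt0 mu_gt0 X_PPP Y_PPP).
apply: (etrans (integral_right_halves noise mu tau0 lambda_gt0 ell_path_loss)).
have eL := integral_joint_los noise mu tau0 lambda_gt0 ell_path_loss excl_lt.
have eN := integral_joint_nlos noise mu tau0 lambda_gt0 ell_path_loss excl_lt.
apply/esym; apply: (etrans (congr2 +%E
  (congr1 (fun y => (2 * lambda)%:E * y) eL) (congr1 (fun y => (2 * lambda)%:E * y) eN))).
have joint3_ge0 s : 0 <= \int[lebesgue_measure]_x \int[lebesgue_measure]_q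
    \int[lebesgue_measure]_q' joint ell noise tau lambda mu s ((q, q'), x).
  apply: integral_ge0 => x _; apply: integral_ge0 => q _; apply: integral_ge0 => q' _.
  exact: joint_ge0.
have cancel (e : \bar R) : (2 * lambda)%:E * ((lambda^-1)%:E * e) = 2%:E * e.
  by rewrite muleA -EFinM mulfK// gt_eqF.
apply: (etrans (congr2 +%E (cancel _) (cancel _))).
exact: (esym (ge0_muleDr _ (joint3_ge0 LoS) (joint3_ge0 NLoS))).
Qed.
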